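(* Let $n\ge2$ and let $A$ be an Artin algebra. The subcategories $\mathcal S_n(A)$ and $\mathcal F_n(A)$ are functorially finite in $\mathrm{Mor}_n(A)$, and hence have Auslander-Reiten sequences.
   Context: $\mathrm{Mor}_n(A)$ is the category whose objects $X_{(\phi_i)}$ are sequences of maps of finitely generated left $A$-modules $X_n\xrightarrow{\phi_{n-1}}X_{n-1}\to\cdots\xrightarrow{\phi_1}X_1$, with commuting families $(f_i:X_i\to Y_i)$ as morphisms; exactness is branchwise (it is equivalent to the category of finitely generated modules over the upper triangular matrix algebra $T_n(A)$). $\mathcal S_n(A)$ (resp. $\mathcal F_n(A)$) is the full subcategory of objects with all $\phi_i$ monomorphisms (resp. epimorphisms); both are closed under direct summands and extensions and carry the exact structure inherited from $\mathrm{Mor}_n(A)$. *)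

(* Defs.v *)
From HB Require Import structures.
From mathcomp Require Import all_boot all_order all_algebra.

Set Implicit Arguments.
Unset Strict Implicit.
Unset Printing Implicit Defensive.

Import GRing.Theory.
Local Open Scope ring_scope.

Definition fin_gen (K : nzRingType) (M : lmodType K) : Prop :=
  exists (k : nat) (e : 'I_k -> M),
    forall x : M, exists c : 'I_k -> K, x = \sum_(i < k) c i *: e i.

Definition artinian_module (K : nzRingType) (M : lmodType K) : Prop :=
  forall I : nat -> {pred M},
    (forall m, submod_closed (I m)) ->
    (forall m, {subset I m.+1 <= I m}) ->
    exists N : nat, forall m, (N <= m)%N -> I m =i I N.

Definition artin_algebra (R : comNzRingType) (A : algType R) : Prop :=
  artinian_module R^o /\ fin_gen A.

Section Mor.
Variables (A : nzRingType) (n : nat).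

(* X_n -> ... -> X_1, with indices shifted to 0 .. n-1: the map phi_i is
   indexed by its target i and its source j, together with a proof that j is
   the successor of i. *)
Record mor_obj := MorObj {
  mor_mod :> 'I_n -> lmodType A;
  mor_map : forall i j : 'I_n, j = i.+1 :> nat ->
    {linear mor_mod j -> mor_mod i};
  mor_fin_gen : forall i, fin_gen (mor_mod i)
}.

Record mor_hom (X Y : mor_obj) := MorHom {
  hom_fun :> forall i : 'I_n, {linear X i -> Y i};
  hom_comm : forall (i j : 'I_n) (e : j = i.+1 :> nat) (x : X j),
    hom_fun i (mor_map X e x) = mor_map Y e (hom_fun j x)
}.

Lemma id_comm (X : mor_obj) (i j : 'I_n) (e : j = i.+1 :> nat) (x : X j) :
  (idfun : {linear X i -> X i}) (mor_map X e x) =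
  mor_map X e ((idfun : {linear X j -> X j}) x).
Proof. by []. Qed.

Definition hom_id (X : mor_obj) : mor_hom X X :=
  MorHom (@id_comm X).

Lemma comp_comm (X Y Z : mor_obj) (g : mor_hom Y Z) (f : mor_hom X Y)
    (i j : 'I_n) (e : j = i.+1 :> nat) (x : X j) :
  (g i \o f i : {linear X i -> Z i}) (mor_map X e x) =
  mor_map Z e ((g j \o f j : {linear X j -> Z j}) x).
Proof. by rewrite /= !hom_comm. Qed.

Definition hom_comp (X Y Z : mor_obj) (g : mor_hom Y Z) (f : mor_hom X Y) :
  mor_hom X Z := MorHom (comp_comm g f).

(* Leibniz equality of mor_hom also compares proofs; morphisms are compared
   as families of functions. *)
Definition hom_eq (X Y : mor_obj) (f g : mor_hom X Y) : Prop :=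
  forall i, f i =1 g i.

Local Notation "g \c f" := (hom_comp g f) (at level 50, left associativity).
Local Notation "f =m g" := (hom_eq f g) (at level 70, no associativity).

Definition split_mono (X Y : mor_obj) (f : mor_hom X Y) : Prop :=
  exists r : mor_hom Y X, r \c f =m hom_id X.

Definition split_epi (X Y : mor_obj) (g : mor_hom X Y) : Prop :=
  exists s : mor_hom Y X, g \c s =m hom_id Y.

Definition hom_iso (X Y : mor_obj) (f : mor_hom X Y) : Prop :=
  exists g : mor_hom Y X, g \c f =m hom_id X /\ f \c g =m hom_id Y.

Definition zero_obj (X : mor_obj) : Prop := forall i (x : X i), x = 0.

Definition is_direct_sum (X Y Z : mor_obj) : Prop :=
  exists (iY : mor_hom Y X) (pY : mor_hom X Y)
         (iZ : mor_hom Z X) (pZ : mor_hom X Z),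
    [/\ pY \c iY =m hom_id Y, pZ \c iZ =m hom_id Z,
        (forall i z, pY i (iZ i z) = 0), (forall i y, pZ i (iY i y) = 0)
      & forall i x, iY i (pY i x) + iZ i (pZ i x) = x].

Definition indecomposable (X : mor_obj) : Prop :=
  ~ zero_obj X /\
  forall Y Z, is_direct_sum X Y Z -> zero_obj Y \/ zero_obj Z.

Definition short_exact (X Y Z : mor_obj) (f : mor_hom X Y) (g : mor_hom Y Z) :
    Prop :=
  forall i, [/\ injective (f i),
                (forall z, exists y, g i y = z)
              & forall y, g i y = 0 <-> exists x, f i x = y].

Section Subcategory.
(* The object class of a full subcategory. *)
Variable C : mor_obj -> Prop.

Definition right_approx (M X : mor_obj) (f : mor_hom X M) : Prop :=
  C X /\ forall (Y : mor_obj) (g : mor_hom Y M), C Y ->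
    exists h : mor_hom Y X, f \c h =m g.

Definition left_approx (M X : mor_obj) (f : mor_hom M X) : Prop :=
  C X /\ forall (Y : mor_obj) (g : mor_hom M Y), C Y ->
    exists h : mor_hom X Y, h \c f =m g.

Definition contravariantly_finite : Prop :=
  forall M, exists (X : mor_obj) (f : mor_hom X M), right_approx f.

Definition covariantly_finite : Prop :=
  forall M, exists (X : mor_obj) (f : mor_hom M X), left_approx f.

Definition functorially_finite : Prop :=
  contravariantly_finite /\ covariantly_finite.

(* Conflations of the exact structure on C inherited from Mor_n(A). *)
Definition exact_in (X Y Z : mor_obj) (f : mor_hom X Y) (g : mor_hom Y Z) :
    Prop :=
  [/\ C X, C Y, C Z & short_exact f g].

Definition exact_projective (P : mor_obj) : Prop :=
  forall (X Y Z : mor_obj) (f : mor_hom X Y) (g : mor_hom Y Z),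
    exact_in f g -> forall u : mor_hom P Z, exists v : mor_hom P Y, g \c v =m u.

Definition exact_injective (I : mor_obj) : Prop :=
  forall (X Y Z : mor_obj) (f : mor_hom X Y) (g : mor_hom Y Z),
    exact_in f g -> forall u : mor_hom X I, exists v : mor_hom Y I, v \c f =m u.

Definition right_almost_split (Y Z : mor_obj) (g : mor_hom Y Z) : Prop :=
  ~ split_epi g /\
  forall (W : mor_obj) (u : mor_hom W Z), C W -> ~ split_epi u ->
    exists v : mor_hom W Y, g \c v =m u.

Definition left_almost_split (X Y : mor_obj) (f : mor_hom X Y) : Prop :=
  ~ split_mono f /\
  forall (W : mor_obj) (u : mor_hom X W), C W -> ~ split_mono u ->
    exists v : mor_hom Y W, v \c f =m u.

Definition right_minimal (Y Z : mor_obj) (g : mor_hom Y Z) : Prop :=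
  forall h : mor_hom Y Y, g \c h =m g -> hom_iso h.

Definition left_minimal (X Y : mor_obj) (f : mor_hom X Y) : Prop :=
  forall h : mor_hom Y Y, h \c f =m f -> hom_iso h.

Definition sink_map (Y Z : mor_obj) (g : mor_hom Y Z) : Prop :=
  [/\ C Y, C Z, right_almost_split g & right_minimal g].

Definition source_map (X Y : mor_obj) (f : mor_hom X Y) : Prop :=
  [/\ C X, C Y, left_almost_split f & left_minimal f].

Definition AR_sequence (X Y Z : mor_obj) (f : mor_hom X Y) (g : mor_hom Y Z) :
    Prop :=
  [/\ exact_in f g, source_map f & sink_map g].

(* In the sense of Auslander-Smalo and Ringel: sink and source maps exist, and
   AR sequences end at each relatively non-projective, and start at each
   relatively non-injective, indecomposable object. *)
Definition has_AR_sequences : Prop :=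
  [/\ (forall Z, C Z -> indecomposable Z ->
         exists (Y : mor_obj) (g : mor_hom Y Z), sink_map g),
      (forall X, C X -> indecomposable X ->
         exists (Y : mor_obj) (f : mor_hom X Y), source_map f),
      (forall Z, C Z -> indecomposable Z -> ~ exact_projective Z ->
         exists (X Y : mor_obj) (f : mor_hom X Y) (g : mor_hom Y Z),
           AR_sequence f g)
    & (forall X, C X -> indecomposable X -> ~ exact_injective X ->
         exists (Y Z : mor_obj) (f : mor_hom X Y) (g : mor_hom Y Z),
           AR_sequence f g)].

End Subcategory.

(* S_n(A) and F_n(A); monomorphisms (epimorphisms) of finitely generated
   modules are the injective (surjective) linear maps. *)
Definition mono_cat (X : mor_obj) : Prop :=
  forall (i j : 'I_n) (e : j = i.+1 :> nat), injective (mor_map X e).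

Definition epi_cat (X : mor_obj) : Prop :=
  forall (i j : 'I_n) (e : j = i.+1 :> nat) (y : X i),
    exists x : X j, mor_map X e x = y.

End Mor.

(* Main.v *)
Require Import Defs.
From HB Require Import structures.
From mathcomp Require Import all_boot all_order all_algebra.
From mathcomp Require Import boolp classical_sets functions.

(* The functors are governed by a duality [Hom(-, E)] over the commutative
   artinian ring [R], where [E] is the injective hull of the sum of the simple
   modules; [E] is obtained as a module of maximal length among those in whose
   socle no simple module is repeated.  A right almost split map ending at an
   indecomposable [Z] comes from a presentation of [Z]: if [phi] is a functional
   on [End(Z)] which kills the non-isomorphisms but not the identity, then the
   pullback of the Nakayama functor applied to the presentation along the map
   determined by [phi] has the property that [u : W -> Z] lifts to it if and only
   if [phi] vanishes on all [u \o h], [h : Z -> W].  An approximation and a passage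
   to minimal length give sink maps in [S_n(A)], whose kernels stay in [S_n(A)],
   hence Auslander-Reiten sequences.  Everything else follows from two exact
   dualities: [S_n(A)] is dual to [S_n(A^op)] by taking annihilators in the dual
   of the largest module, and [F_n(A)] is dual to [S_n(A^op)] levelwise. *)

Set Implicit Arguments.
Unset Strict Implicit.
Unset Printing Implicit Defensive.

Import GRing.Theory.
Local Open Scope ring_scope.
Local Open Scope classical_set_scope.

(** * Lengths of modules *)

(** Representations by monomorphisms are closed under subobjects and extensions, so the kernels and
    pushouts in the classical construction of almost split sequences stay among them. They are not
    closed under quotients, and representations by epimorphisms are not closed under subobjects;
    left ends and the epimorphism case are therefore reached only by duality. The right
    approximation by monomorphisms is also a dual: it comes from an explicit left approximation by
    epimorphisms over the converse ring. Dualities are never functors here. An object and its dual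
    are related by a perfect pairing, two morphisms by adjointness. This relation is symmetric, so
    biduals are not identified with the original objects, and passing to opposite categories only
    exchanges arguments. Lengths enter only as upper bounds for strict chains of submodules. Such
    bounds pass to submodules and quotients, and they suffice to make injective endomorphisms
    surjective and to select objects of minimal length. *)

Section Submodules.
Variables (K : nzRingType).
Implicit Types M N : lmodType K.

Definition submod M (U : set M) :=
  U 0 /\ forall a x y, U x -> U y -> U (a *: x + y).

Lemma submodD M (U : set M) : submod U -> forall x y, U x -> U y -> U (x + y).
Proof. by move=> [_ h] x y Ux Uy; have := h 1 x y Ux Uy; rewrite scale1r. Qed.

Lemma submodZ M (U : set M) : submod U -> forall a x, U x -> U (a *: x).
Proof. by move=> [U0 h] a x Ux; have := h a x 0 Ux U0; rewrite addr0. Qed.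

Lemma submodN M (U : set M) : submod U -> forall x, U x -> U (- x).
Proof. by move=> sU x Ux; rewrite -scaleN1r; apply: submodZ. Qed.

Lemma submodB M (U : set M) : submod U -> forall x y, U x -> U y -> U (x - y).
Proof. by move=> sU x y Ux Uy; apply: submodD => //; apply: submodN. Qed.

Lemma submod0 M : submod [set 0 : M].
Proof. by split=> // a x y -> ->; rewrite scaler0 addr0. Qed.

Lemma submodT M : submod (@setT M).
Proof. by []. Qed.

Lemma submodI M (U V : set M) : submod U -> submod V -> submod (U `&` V).
Proof.
by move=> [U0 hU] [V0 hV]; split=> // a x y [Ux Vx] [Uy Vy]; split; auto.
Qed.

Definition addset M (U V : set M) : set M :=
  [set x | exists u v, [/\ U u, V v & x = u + v]].

Lemma submod_add M (U V : set M) : submod U -> submod V -> submod (addset U V).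
Proof.
move=> sU sV; split; first by exists 0, 0; rewrite addr0; case: sU; case: sV.
move=> a x y [u [v [Uu Vv ->]]] [u' [v' [Uu' Vv' ->]]].
exists (a *: u + u'), (a *: v + v'); split; [by case: sU; auto|by case: sV; auto|].
by rewrite scalerDr addrACA.
Qed.

Lemma addset_l M (U V : set M) : submod V -> U `<=` addset U V.
Proof. by move=> sV x Ux; exists x, 0; rewrite addr0; split=> //; case: sV. Qed.

Lemma addset_r M (U V : set M) : submod U -> V `<=` addset U V.
Proof. by move=> sU x Vx; exists 0, x; rewrite add0r; split=> //; case: sU. Qed.

Lemma addset_sub M (U V W : set M) :
  submod W -> U `<=` W -> V `<=` W -> addset U V `<=` W.
Proof. by move=> sW UW VW x [u [v [/UW Uu /VW Vv ->]]]; apply: submodD. Qed.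

Definition line M (x : M) : set M := [set y | exists r, y = r *: x].

Lemma submod_line M (x : M) : submod (line x).
Proof.
split; first by exists 0; rewrite scale0r.
by move=> a _ _ [r ->] [s ->]; exists (a * r + s); rewrite scalerDl scalerA.
Qed.

Lemma line_id M (x : M) : line x x.
Proof. by exists 1; rewrite scale1r. Qed.

Lemma line_sub M (U : set M) (x : M) : submod U -> U x -> line x `<=` U.
Proof. by move=> sU Ux y [r ->]; apply: submodZ. Qed.

Lemma submod_preim M N (f : {linear M -> N}) (V : set N) :
  submod V -> submod (f @^-1` V).
Proof.
move=> [V0 hV]; split; first by rewrite /preimage /= linear0.
by move=> a x y; rewrite /preimage /= linearP; apply: hV.
Qed.

Lemma submod_img M N (f : {linear M -> N}) (U : set M) :
  submod U -> submod (f @` U).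
Proof.
move=> [U0 hU]; split; first by exists 0 => //; rewrite linear0.
move=> a _ _ [x Ux <-] [y Uy <-]; exists (a *: x + y); first exact: hU.
by rewrite linearP.
Qed.

Lemma submod_ker M N (f : {linear M -> N}) : submod [set x | f x = 0].
Proof.
split=> [|a x y /=]; first exact: linear0.
by rewrite linearP => -> ->; rewrite scaler0 addr0.
Qed.

Lemma ker0_inj M N (f : {linear M -> N}) :
  (forall x, f x = 0 -> x = 0) -> injective f.
Proof.
move=> h x y fxy; apply/eqP; rewrite -subr_eq0; apply/eqP/h.
by rewrite linearB fxy subrr.
Qed.

Lemma inj_ker0 M N (f : {linear M -> N}) :
  injective f -> forall x, f x = 0 -> x = 0.
Proof. by move=> fi x fx; apply: fi; rewrite fx linear0. Qed.

Section Coset.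
Variables (M : lmodType K) (U : set M) (x : M).
Definition colon : set K^o := [set r | U (r *: x)].

Lemma submod_colon : submod U -> submod colon.
Proof.
move=> [U0 hU]; split; first by rewrite /colon /= scale0r.
by move=> a r s; rewrite /colon /= scalerDl -scalerA; apply: hU.
Qed.
End Coset.

(* [flen n U V]: strictly increasing chains of submodules starting at [U] and
   contained in [V] have at most [n] steps. *)
Fixpoint flen n M (U V : set M) : Prop :=
  match n with
  | 0 => forall C, submod C -> U `<=` C -> C `<=` V -> C `<=` U
  | m.+1 => forall C, submod C -> U `<=` C -> C `<=` V -> ~ C `<=` U ->
      flen m C V
  end.

Lemma flenS n M (U V : set M) : flen n U V -> flen n.+1 U V.
Proof.
elim: n U => [|n IH] U /= h C sC UC CV nCU; first by case: nCU; apply: h.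
by apply: IH; apply: h.
Qed.

Lemma flen_le m n M (U V : set M) : (m <= n)%N -> flen m U V -> flen n U V.
Proof.
by move=> /subnK <-; elim: (n - m)%N => // k IH h; rewrite addSn; apply/flenS/IH.
Qed.

Lemma flen_lower n M (U U' V : set M) :
  U `<=` U' -> flen n U V -> flen n U' V.
Proof.
case: n => [|n] UU' /= h C sC U'C CV.
  by apply: (subset_trans _ UU'); apply: h => //; apply: (subset_trans _ U'C).
move=> nCU'; apply: h => //; first exact: (subset_trans _ U'C).
by move=> CU; apply: nCU'; apply: (subset_trans _ UU').
Qed.

Lemma flen_upper n M (U V V' : set M) :
  V' `<=` V -> flen n U V -> flen n U V'.
Proof.
move=> V'V; elim: n U => [|n IH] U /= h C sC UC CV.
  by apply: h => //; apply: (subset_trans _ V'V).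
by move=> nCU; apply: IH; apply: h => //; apply: (subset_trans _ V'V).
Qed.

(** A strict chain inside [V'] can be prolonged by [V] itself, which uses up one step of the
    bound. *)
Lemma flen_strict n M (U V V' : set M) : submod V ->
  U `<=` V' -> V' `<=` V -> ~ V `<=` V' -> flen n.+1 U V -> flen n U V'.
Proof.
move=> sV; elim: n U => [|n IH] U UV' V'V nVV' h C sC UC CV'.
  apply: contrapT => nCU.
  have /= h0 := h C sC UC (subset_trans CV' V'V) nCU.
  apply: nVV'; apply: (subset_trans _ CV'); apply: h0 => //.
  exact: (subset_trans _ V'V).
by move=> nCU; apply: IH => //; apply: h => //; apply: (subset_trans _ V'V).
Qed.

Lemma flen_strict0 M (U V V' : set M) : submod V ->
  U `<=` V' -> V' `<=` V -> ~ V `<=` V' -> ~ flen 0 U V.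
Proof.
move=> sV UV' V'V nVV' /= h; apply: nVV'; apply: (subset_trans _ UV').
by apply: h => //; apply: (subset_trans _ V'V).
Qed.

(** By the modular law a strict step from [C] to [C'] remains strict after intersecting with [W] or
    after adding [W]. Hence each step lowers [a] or [b]; as either may drop, the induction runs on a
    bound for their sum. *)
Lemma flen_glue a b M (C W V : set M) : submod C -> submod W ->
  W `<=` V -> submod V ->
  flen a (C `&` W) W -> flen b (addset C W) V -> flen (a + b) C V.
Proof.
move=> sC sW WV sV.
have modular (C1 C2 : set M) : submod C1 -> submod C2 -> C1 `<=` C2 ->
    C2 `&` W `<=` C1 `&` W -> addset C2 W `<=` addset C1 W -> C2 `<=` C1.
  move=> s1 s2 C12 hI hA x C2x.
  have [|u [v [C1u Wv xE]]] := hA x; first by apply: addset_l.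
  rewrite xE; apply: submodD => //.
  suff : (C2 `&` W) v by move=> /hI[].
  split=> //.
  by rewrite -(addKr u v) -xE; apply: (submodD s2) => //; apply: (submodN s2); apply: C12.
move: {2}(a + b)%N (leqnn (a + b)) => n.
elim: n a b C sC => [|n IH] a b C sC.
  rewrite leqn0 addn_eq0 => /andP[/eqP-> /eqP->] /= ha hb C' sC' CC' C'V.
  apply: modular => //.
    apply: ha; [exact: submodI|by move=> x [/CC']|by move=> x []].
  apply: hb; [exact: submod_add| |exact: addset_sub].
  by move=> x [u [v [/CC' Uu Vv ->]]]; exists u, v.
move=> le ha hb.
have [ab0|ab0] := posnP (a + b); first by apply: IH => //; rewrite ab0.
rewrite -(prednK ab0) /= => C' sC' CC' C'V nC'C.
have mI : C `&` W `<=` C' `&` W by move=> x [/CC'].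
have mA : addset C W `<=` addset C' W.
  by move=> x [u [v [/CC' Uu Vv ->]]]; exists u, v.
have [hI|nI] := pselect (C' `&` W `<=` C `&` W); last first.
  case: a le ha ab0 => [|a] le ha ab0.
    by case: nI; apply: ha => //; exact: submodI.
  rewrite addSn /=; apply: IH => //.
    by apply: ha => //; exact: submodI.
  exact: flen_lower hb.
have [hA|nA] := pselect (addset C' W `<=` addset C W).
  by case: nC'C; apply: modular.
case: b le hb ab0 => [|b] le hb ab0.
  by case: nA; apply: hb => //; [exact: submod_add|exact: addset_sub].
rewrite addnS /=; apply: IH => //; first by rewrite addnS in le.
  exact: flen_lower ha.
by apply: hb => //; [exact: submod_add|exact: addset_sub].
Qed.

Lemma flen_add a b M (U W V : set M) : submod U -> submod W ->
  U `<=` W -> W `<=` V -> submod V ->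
  flen a U W -> flen b W V -> flen (a + b) U V.
Proof.
move=> sU sW UW WV sV ha hb; apply: (flen_glue (W := W)) => //.
  by apply: flen_lower ha => x Ux; split=> //; apply: UW.
by apply: flen_lower hb; apply: addset_r.
Qed.

End Submodules.

Section Transfer.
Variables (K K' : nzRingType) (M : lmodType K) (N : lmodType K').

(** A monotone map sends strict chains to strict chains as soon as it reflects inclusion between
    comparable submodules. This covers images, preimages, images modulo a kernel, and colon
    ideals. *)
Lemma flen_map n (Phi : set M -> set N) (U V : set M) (U' V' : set N) :
  (forall C, submod C -> U `<=` C -> C `<=` V ->
     [/\ submod (Phi C), U' `<=` Phi C & Phi C `<=` V']) ->
  (forall C D, submod C -> submod D -> U `<=` C -> C `<=` D -> D `<=` V ->
     Phi C `<=` Phi D) ->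
  (forall C D, submod C -> submod D -> U `<=` C -> C `<=` D -> D `<=` V ->
     Phi D `<=` Phi C -> D `<=` C) ->
  submod U -> U `<=` V -> flen n (Phi U) V' -> flen n U V.
Proof.
elim: n U => [|n IH] U h1 h2 h3 sU UV h C sC UC CV.
  by apply: h3 => //; apply: h; [by case: (h1 C)|apply: h2|by case: (h1 C)].
move=> nCU; apply: IH => //.
- by move=> D sD CD; apply: h1 => //; apply: (subset_trans _ CD).
- by move=> D D' sD sD' CD; apply: h2 => //; apply: (subset_trans _ CD).
- by move=> D D' sD sD' CD; apply: h3 => //; apply: (subset_trans _ CD).
apply: h; [by case: (h1 C)|exact: h2|by case: (h1 C)|].
by move=> hC; apply: nCU; apply: h3.
Qed.
End Transfer.

Section Length.
Variables (K : nzRingType).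
Implicit Types M N : lmodType K.

Lemma flen_inj n M N (f : {linear M -> N}) (V : set M) (V' : set N) :
  injective f -> submod V -> (forall x, V x -> V' (f x)) ->
  flen n [set 0] V' -> flen n [set 0] V.
Proof.
move=> fi sV VV' h; apply: (@flen_map _ _ _ _ n (fun C => f @` C) _ _ [set 0] V').
- move=> C sC C0 CV; split; first exact: submod_img.
    by move=> _ ->; exists 0; [exact: C0|rewrite linear0].
  by move=> _ [x /CV /VV' Vx <-].
- by move=> C D _ _ _ CD _ _ [x /CD Dx <-]; exists x.
- move=> C D _ _ _ CD _ h' x Dx; have [|y Cy /fi <-//] := h' (f x).
  by exists x.
- exact: submod0.
- by move=> _ ->; case: sV.
- by apply: flen_lower h => _ ->; exists 0; rewrite ?linear0.
Qed.

Lemma flen_surj n M N (f : {linear M -> N}) :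
  (forall y, exists x, f x = y) ->
  flen n [set 0] (@setT M) -> flen n [set 0] (@setT N).
Proof.
move=> fs h.
apply: (@flen_map _ _ _ _ n (fun C => f @^-1` C) _ _ [set 0] setT) => //.
- move=> C sC C0 _; split=> //; first exact: submod_preim.
  by move=> _ ->; apply: C0; rewrite linear0.
- by move=> C D _ _ _ CD _ x /CD.
- by move=> C D _ _ _ CD _ h' y Dy; have [x fx] := fs y; subst y; apply: h'.
- exact: submod0.
- by apply: flen_lower h => _ ->; rewrite /preimage /= linear0.
Qed.

Definition fl n M := flen n [set 0] (@setT M).
Definition fin_len M := exists n, fl n M.

Lemma fin_len_inj M N (f : {linear M -> N}) :
  injective f -> fin_len N -> fin_len M.
Proof. by move=> fi [n h]; exists n; apply: flen_inj fi _ _ h. Qed.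

(** Each new generator is taken outside the submodule reached so far and uses up one step of the
    bound. *)
Lemma flen_gen n M (U V : set M) : submod U -> submod V -> U `<=` V ->
  flen n U V ->
  exists (k : nat) (e : 'I_k -> M), (forall i, V (e i)) /\
    forall x, V x -> exists c : 'I_k -> K, U (x - \sum_i c i *: e i).
Proof.
elim: n U => [|n IH] U sU sV UV h.
  exists 0%N, (fun=> 0); split=> [[]//|x Vx]; exists (fun=> 0).
  by rewrite big_ord0 subr0; apply: (h V).
have [VU|nVU] := pselect (V `<=` U).
  exists 0%N, (fun=> 0); split=> [[]//|x Vx]; exists (fun=> 0).
  by rewrite big_ord0 subr0; apply: VU.
have [y [Vy nUy]] : exists y, V y /\ ~ U y.
  by apply: contrapT => hn; apply: nVU => x Vx; apply: contrapT => nUx; apply: hn; exists x.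
have sU' := submod_add sU (submod_line y).
have lU' : addset U (line y) `<=` V by apply: addset_sub => //; apply: line_sub.
have [|k [e [Ve he]]] := IH (addset U (line y)) sU' sV lU'.
  apply: h => //; first exact: addset_l (submod_line _).
  by move=> hh; apply: nUy; apply: hh; apply: addset_r => //; apply: line_id.
exists k.+1, (fun i => if unlift ord0 i is Some j then e j else y); split.
  by move=> i; case: unlift.
move=> x /he[c [u [_ [Uu [r ->] xE]]]].
exists (fun i => if unlift ord0 i is Some j then c j else r).
rewrite big_ord_recl unlift_none.
under eq_bigr => i _ do rewrite liftK.
by rewrite opprD addrCA xE addrC addrK.
Qed.

Lemma fin_len_gen M (V : set M) : submod V -> fin_len M ->
  exists (k : nat) (e : 'I_k -> M), (forall i, V (e i)) /\
    forall x, V x -> exists c : 'I_k -> K, x = \sum_i c i *: e i.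
Proof.
move=> sV [n h].
have [||k [e [Ve he]]] := @flen_gen n M [set 0] V (submod0 _) sV.
- by move=> _ ->; case: sV.
- exact: flen_upper h.
by exists k, e; split=> // x /he[c /= /eqP]; rewrite subr_eq0 => /eqP ?; exists c.
Qed.

(** [n] is the exact length of [M]: a proper image of [M] in a module of length at most [n] would
    have smaller length. This is applied to endomorphisms and to the evaluation map into a
    bidual. *)
Lemma fl_min M : fin_len M ->
  exists n, fl n M /\ forall N (f : {linear M -> N}),
    injective f -> fl n N -> forall y, exists x, f x = y.
Proof.
move=> hM; have ex : exists n, `[< fl n M >] by case: hM => n h; exists n; apply/asboolP.
case: (ex_minnP ex) => n /asboolP hn hmin; exists n; split=> // N f fi hN y.
apply: contrapT => ny.
have nT : ~ (setT `<=` range f) by move=> /(_ y I)[x _ fx]; apply: ny; exists x.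
have s0 : [set 0] `<=` range f by move=> _ ->; exists 0; rewrite ?linear0.
have sN := submodT N.
case: n hn hmin hN => [|n] hn hmin hN.
  exact: (flen_strict0 sN s0 _ nT hN).
have h' := flen_strict sN s0 (@subsetT _ _) nT hN.
have : fl n M by apply: (flen_inj fi) h' => // x _; exists x.
by move=> /asboolP /hmin; rewrite ltnn.
Qed.

Lemma fin_len_inj_surj M (f : {linear M -> M}) :
  fin_len M -> injective f -> forall y, exists x, f x = y.
Proof. by move=> /fl_min[n [h hh]] fi; apply: hh fi h. Qed.

End Length.

Definition mklin (K : nzRingType) (M N : lmodType K) (f : M -> N)
    (fP : linear f) : {linear M -> N} :=
  HB.pack f (GRing.isLinear.Build K M N _ f fP).

Lemma lin_comb (K : nzRingType) (M N : lmodType K) (f : {linear M -> N}) a x y :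
  f (a *: x + y) = a *: f x + f y.
Proof. exact: linearP. Qed.

(** * Quotients and submodules as module types *)

Section Quotient.
Variables (K : nzRingType) (M : lmodType K) (U : set M).

(** The choice is made from the coset as a set, so congruent elements receive equal representatives;
    the quotient is then the type of the chosen representatives. *)
Definition qrep (x : M) : M := xget 0 [set y | U (y - x)].

(** The proof [sU] is an argument of the type so that the module structure, which depends on it, can
    be declared as an instance. *)
Definition quotm (sU : submod U) : Type := {x : M | qrep x == x}.

Hypothesis sU : submod U.

Lemma qrepP x : U (qrep x - x).
Proof.
by apply: (@xgetPex _ 0 [set y | U (y - x)]); exists x; rewrite /= subrr; case: sU.
Qed.

Lemma qrep_eq x y : U (x - y) -> qrep x = qrep y.
Proof.
move=> Uxy; congr (xget 0 _); apply/seteqP; split=> z /= Uz.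
  by rewrite -(subrKA x); apply: submodD.
by rewrite -(subrKA y); apply: submodD => //; rewrite -opprB; apply: submodN.
Qed.

Lemma qrepK x : qrep (qrep x) == qrep x.
Proof. by apply/eqP/qrep_eq/qrepP. Qed.

Local Notation Q := (quotm sU).

HB.instance Definition _ := Choice.on Q.

Definition qpi (x : M) : Q := exist _ (qrep x) (qrepK x).

Lemma qpi_eq x y : U (x - y) -> qpi x = qpi y.
Proof. by move=> h; apply: val_inj; rewrite /= (qrep_eq h). Qed.

Lemma qpiK (a : Q) : qpi (val a) = a.
Proof. by apply: val_inj; case: a => x /= /eqP. Qed.

Lemma qpi_U x y : qpi x = qpi y -> U (x - y).
Proof.
move=> /(congr1 val) /= h; rewrite -(subrKA (qrep x)); apply: submodD => //.
  by rewrite -opprB; apply: submodN => //; apply: qrepP.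
by rewrite h; apply: qrepP.
Qed.

Definition qadd (a b : Q) : Q := qpi (val a + val b).
Definition qopp (a : Q) : Q := qpi (- val a).
Definition qscale r (a : Q) : Q := qpi (r *: val a).

Lemma qpiD x y : qadd (qpi x) (qpi y) = qpi (x + y).
Proof. by apply: qpi_eq; rewrite /= opprD addrACA; apply: submodD => //; apply: qrepP. Qed.
Lemma qpiN x : qopp (qpi x) = qpi (- x).
Proof. by apply: qpi_eq; rewrite /= -opprD; apply: submodN => //; apply: qrepP. Qed.
Lemma qpiZ r x : qscale r (qpi x) = qpi (r *: x).
Proof. by apply: qpi_eq; rewrite /= -scalerBr; apply: submodZ => //; apply: qrepP. Qed.

Lemma qind (P : Q -> Prop) : (forall x, P (qpi x)) -> forall a, P a.
Proof. by move=> h a; rewrite -(qpiK a). Qed.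

Fact qaddA : associative qadd.
Proof.
by elim/qind=> x; elim/qind=> y; elim/qind=> z; rewrite !qpiD addrA.
Qed.
Fact qaddC : commutative qadd.
Proof. by elim/qind=> x; elim/qind=> y; rewrite !qpiD addrC. Qed.
Fact qadd0 : left_id (qpi 0) qadd.
Proof. by elim/qind=> x; rewrite qpiD add0r. Qed.
Fact qaddN : left_inverse (qpi 0) qopp qadd.
Proof. by elim/qind=> x; rewrite qpiN qpiD addNr. Qed.

HB.instance Definition _ := GRing.isZmodule.Build Q qaddA qaddC qadd0 qaddN.

Fact qscaleA r s (a : Q) : qscale r (qscale s a) = qscale (r * s) a.
Proof. by elim/qind: a => x; rewrite !qpiZ scalerA. Qed.
Fact qscale1 : left_id 1 qscale.
Proof. by elim/qind=> x; rewrite qpiZ scale1r. Qed.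
Fact qscaleDr : right_distributive qscale +%R.
Proof. by move=> r; elim/qind=> x; elim/qind=> y; rewrite [_ + _]qpiD !qpiZ [RHS]qpiD scalerDr. Qed.
Fact qscaleDl (a : Q) : {morph qscale^~ a : r s / r + s}.
Proof. by elim/qind: a => x r s; rewrite !qpiZ [RHS]qpiD scalerDl. Qed.

HB.instance Definition _ :=
  GRing.Zmodule_isLmodule.Build K Q qscaleA qscale1 qscaleDr qscaleDl.

Fact qpi_linear : linear (qpi : M -> Q).
Proof. by move=> r x y; rewrite -qpiD -qpiZ. Qed.
HB.instance Definition _ := GRing.isLinear.Build K M Q _ qpi qpi_linear.

Lemma qpi_surj (a : Q) : exists x, qpi x = a.
Proof. by exists (val a); rewrite qpiK. Qed.

Lemma qpi0 x : qpi x = 0 <-> U x.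
Proof.
split=> [|Ux]; first by move=> /qpi_U; rewrite subr0.
by apply: qpi_eq; rewrite subr0.
Qed.
End Quotient.
Arguments qpi {K M U} sU x.

Section Subtype.
Variables (K : nzRingType) (M : lmodType K) (U : set M).
Definition subm (sU : submod U) : Type := {x : M | `[< U x >]}.
Hypothesis sU : submod U.
Local Notation S := (subm sU).
HB.instance Definition _ := SubChoice.on S.

Fact subm_closed : GRing.subsemimod_closed (fun x : M => `[< U x >]).
Proof.
split; first split.
- by apply/asboolP; case: sU.
- by move=> x y /asboolP Ux /asboolP Uy; apply/asboolP; apply: (submodD sU).
by move=> a x /asboolP Ux; apply/asboolP; apply: (submodZ sU).
Qed.
HB.instance Definition _ :=
  GRing.SubChoice_isSubLmodule.Build K M _ S subm_closed.

Definition subi (x : S) : M := val x.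
HB.instance Definition _ :=
  GRing.isLinear.Build K S M _ subi (fun a x y => linearP val a x y).

Lemma subi_inj : injective subi.
Proof. exact: val_inj. Qed.

Lemma subiP (x : S) : U (subi x).
Proof. by apply/asboolP; case: x. Qed.

Lemma subi_im x : U x -> exists s, subi s = x.
Proof. by move=> /asboolP Ux; exists (exist _ x Ux). Qed.
End Subtype.
Arguments subi {K M U} sU x.

(** * Commutative artinian rings and their injective cogenerators *)

Section Hopkins.
Variable R : comNzRingType.
Hypothesis artR : artinian_module R^o.

Lemma artinian_min (P : set (R^o) -> Prop) :
  (exists I, submod I /\ P I) ->
  exists I, [/\ submod I, P I &
    forall J, submod J -> J `<=` I -> P J -> I `<=` J].
Proof.
move=> [I0 hI0]; apply: contrapT => hn.
pose X := {I : set (R^o) | submod I /\ P I}.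
have step (I : X) : {J : X | sval J `<=` sval I /\ ~ sval I `<=` sval J}.
  apply: cid; apply: contrapT => h; apply: hn; exists (sval I).
  case: I h => I [sI PI] /= h; split=> // J sJ JI PJ; apply: contrapT => nIJ.
  by apply: h; exists (exist _ J (conj sJ PJ)).
have [f [_ fS]] := dependent_choice step (exist _ I0 hI0).
have [||N hN] := artR (I := fun m => [pred x | `[< sval (f m) x >]]).
- move=> m; case: (svalP (f m)) => -[z0 zP] _; split=> [|a x y]; rewrite !inE.
    exact: z0.
  exact: zP.
- by move=> m x; rewrite !inE => hx; apply: (fS m).1.
case: (fS N) => _; apply=> x hx.
have := hN N.+1 (leqnSn N) x; rewrite !inE => h.
by apply/asboolP; rewrite h; apply/asboolP.
Qed.

(** Maximality is expressed by inverses modulo [m], the form in which it is used. *)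
Definition maxid (m : set (R^o)) :=
  [/\ submod m, ~ m 1 & forall r, ~ m r -> exists s, m (1 - s * r)].

Lemma flen_ker (M N : lmodType R) (f : {linear M -> N}) a b (V : set M) :
  submod V -> flen b [set 0] (V `&` [set x | f x = 0]) ->
  flen a [set 0] (f @` V) -> flen (b + a) [set 0] V.
Proof.
move=> sV hb ha; apply: (flen_add (W := V `&` [set x | f x = 0])) => //.
- exact: submod0.
- by apply: submodI => //; apply: submod_ker.
- by move=> _ ->; split; [case: sV|rewrite /= linear0].
apply: (@flen_map _ _ _ _ a (fun C => f @` C) _ _ [set 0] (f @` V)).
- move=> C sC _ CV; split; first exact: submod_img.
    by move=> _ ->; exists 0; rewrite ?linear0 //; case: sC.
  by move=> _ [x /CV Vx <-]; exists x.
- by move=> C D _ _ _ CD _ _ [x /CD Dx <-]; exists x.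
- move=> C D sC sD KC CD DV h x Dx.
  have [|y Cy fyx] := h (f x); first by exists x.
  rewrite -(subrK y x); apply: submodD => //; apply: KC; split.
    by apply: submodB => //; [apply: DV|apply: DV; apply: CD].
  by rewrite /= linearB fyx subrr.
- by apply: submodI => //; apply: submod_ker.
- by move=> x [].
apply: flen_lower ha => _ ->; exists 0; rewrite ?linear0 //.
by split; [case: sV|rewrite /= linear0].
Qed.

Definition mulL (r : R) : {linear R^o -> R^o} :=
  mklin (f := fun x : R^o => (r * x : R^o))
    (fun a x y => etrans (mulrDr r _ _) (congr1 (+%R^~ _) (mulrCA r a x))).

(* An ideal minimal among those of infinite length would be a vector space over
   a residue field, all of whose proper subspaces, in particular a hyperplane,
   have finite length. *)
Lemma artinian_fin_len : fin_len R^o.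
Proof.
apply: contrapT => ninf.
have [I [sI infI minI]] : exists I : set (R^o), [/\ submod I,
    ~ (exists n, flen n [set 0] I) &
    forall J, submod J -> J `<=` I -> ~ (exists n, flen n [set 0] J) -> I `<=` J].
  by apply: artinian_min; exists setT; split=> //; apply: submodT.
have finJ (J : set (R^o)) : submod J -> J `<=` I -> ~ I `<=` J ->
    exists n, flen n [set 0] J.
  by move=> sJ JI nIJ; apply: contrapT => h; apply: nIJ; apply: minI.
have [x [Ix x0]] : exists x, I x /\ x <> 0.
  apply: contrapT => h; apply: infI; exists 0%N => C _ _ CI y Cy /=.
  by apply: contrapT => y0; apply: h; exists y; split=> //; apply: CI.
(* Multiplication by [r] on [I] is zero or onto: otherwise its kernel and its image are both
   properly contained in [I], hence of finite length, and so would be [I]. *)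
have rI r : (forall y, I y -> r * y = 0) \/ I `<=` (mulL r) @` I.
  have [h|h] := pselect (I `<=` (mulL r) @` I); [by right|left].
  have rII : mulL r @` I `<=` I by move=> _ [y Iy <-]; apply: (submodZ sI r).
  have [a ha] := finJ _ (submod_img (mulL r) sI) rII h.
  have sK : submod (I `&` [set y | mulL r y = 0]).
    by apply: submodI => //; apply: submod_ker.
  have [IK y /IK[]//|nIK] := pselect (I `<=` I `&` [set y | mulL r y = 0]).
  have [b hb] := finJ _ sK (@subIsetl _ _ _) nIK.
  by case: infI; exists (b + a)%N; apply: flen_ker hb ha.
pose p : set (R^o) := [set r | forall y, I y -> r * y = 0].
have sp : submod p.
  split=> [y _|a r s pr ps y Iy]; first by rewrite mul0r.
  by rewrite mulrDl -mulrA pr // ps // mulr0 addr0.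
(* The ideals [(r^k) + p] descend, so [r^k = s r^(k+1)] modulo [p] for some [k]. As [r^k I = I], the
   element [1 - s r] kills [I]. Thus [p] is maximal and [I] is a vector space over its residue
   field. *)
have pmax r : ~ p r -> exists s, p (1 - s * r).
  move=> npr; have [|IrI] := rI r; first by move/npr.
  have IrkI k : forall y, I y -> exists2 z, I z & y = r ^+ k * z.
    elim: k => [|k IH] y Iy; first by exists y; rewrite ?mul1r.
    have [z Iz ->] := IH y Iy; have [w Iw <-] := IrI z Iz.
    by exists w; rewrite // exprSr -mulrA.
  have [_ [_ [k ->] kmin]] := artinian_min (P := fun J => exists k,
    J = addset (line (r ^+ k : R^o)) p) (ex_intro _ _
      (conj (submod_add (submod_line _) sp) (ex_intro _ 0%N erefl))).
  have [||||_ [z [[s ->] pz]]] := kmin (addset (line (r ^+ k.+1 : R^o)) p) _ _ _ (r ^+ k).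
  - by apply: submod_add => //; apply: submod_line.
  - apply: addset_sub; [exact: submod_add (submod_line _) sp| |exact: addset_r (submod_line _)].
    move=> _ [s ->]; apply: addset_l => //; exists (s * r).
    by rewrite exprS /GRing.scale /= mulrA.
  - by exists k.+1.
  - by apply: addset_l => //; apply: line_id.
  move=> rkE; exists s => y Iy; have [w Iw ->] := IrkI k y Iy.
  have : r ^+ k * w = s * r * (r ^+ k * w).
    by rewrite {1}rkE mulrDl pz // addr0 /GRing.scale /= exprS -!mulrA.
  by move=> h; rewrite mulrBl mul1r -h subrr.
pose P (H : set (R^o)) := H = set0 \/ [/\ submod H, H `<=` I & ~ H x].
have [|A [PA Amax]] := @Zorn_bigcup _ P.
  move=> F FP Ftot.
  have [[z [X FX Xz]]|F0] := pselect (exists z, (\bigcup_(X in F) X) z); last first.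
    by left; apply/seteqP; split=> z // hz; apply: F0; exists z.
  have FP' Y y : F Y -> Y y -> [/\ submod Y, Y `<=` I & ~ Y x].
    by move=> FY Yy; case: (FP Y FY) => // Y0; move: Yy; rewrite Y0.
  right; split.
  - split; first by exists X => //; case: (FP' X z FX Xz) => -[].
    move=> a u v [Y FY Yu] [W FW Wv].
    have [YW|WY] := Ftot Y W FY FW.
      by exists W => //; have [[_ ?] _ _] := FP' W v FW Wv; auto.
    by exists Y => //; have [[_ ?] _ _] := FP' Y u FY Yu; auto.
  - by move=> y [Y FY Yy]; have [_ YI _] := FP' Y y FY Yy; apply: YI.
  - by move=> [Y FY Yx]; have [_ _] := FP' Y x FY Yx.
have [sA AI nAx] : [/\ submod A, A `<=` I & ~ A x].
  case: PA => // A0; exfalso; apply: (Amax [set 0]); rewrite ?A0.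
    by split=> // /(_ 0 erefl).
  right; split; [exact: submod0| |by move=> /= /x0].
  by move=> _ ->; case: sI.
have linv r y : I y -> ~ r * y = 0 -> exists s, forall z, I z -> z = s * (r * z).
  move=> Iy ry; have [|s ps] := pmax r; first by move=> pr; apply/ry/pr.
  exists s => z /ps; rewrite mulrBl mul1r mulrA => /eqP.
  by rewrite subr_eq0 => /eqP.
(* [A] is a hyperplane: if [y] were outside [A + R x], then [A + R y] would be larger and still
   avoid [x], since a nonzero coefficient of [y] could be inverted. *)
have IAx : I `<=` addset A (line x).
  move=> y Iy; have [Ay|nAy] := pselect (A y).
    by apply: addset_l => //; apply: submod_line.
  apply: contrapT => nAxy; apply: (Amax (addset A (line y))).
    split; first exact: addset_l (submod_line y).
    by move=> h; apply: nAy; apply: h; apply: addset_r => //; apply: line_id.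
  right; split; first exact: submod_add (submod_line y).
    by apply: addset_sub => //; apply: line_sub.
  move=> [u [_ [Au [r ->] xE]]].
  have [|s hs] := linv r y Iy.
    by move=> ry; apply: nAx; rewrite xE [r *: y]ry addr0.
  apply: nAxy; exists (- (s * u)), (s *: (x : R^o)); split.
  - by apply: submodN => //; apply: (submodZ sA s).
  - by exists s.
  by rewrite xE scalerDr addrA addNr add0r; apply: hs.
have [n hn] := finJ A sA AI (fun h => nAx (h x Ix)).
apply: infI; exists (n + 1)%N; apply: (flen_add (W := A)) => //.
- exact: submod0.
- by move=> _ ->; case: sA.
move=> C sC AC CI nCA D sD CD DI.
have [c [Cc nAc]] : exists c, C c /\ ~ A c.
  by apply: contrapT => h; apply: nCA => c Cc; apply: contrapT => nAc; apply: h; exists c.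
have [u [_ [Au [r ->] cE]]] := IAx c (CI c Cc).
have [|s hs] := linv r x Ix.
  by move=> rx; apply: nAc; rewrite cE [r *: x]rx addr0.
have Cx : C x.
  have -> : x = s *: (c - u : R^o) by rewrite cE addrC addKr; apply: hs.
  by apply: submodZ => //; apply: submodB => //; apply: AC.
move=> y /DI /IAx; apply: addset_sub => //; exact: line_sub.
Qed.
End Hopkins.

Section LinearMaps.
Variables (R : comNzRingType) (M N : lmodType R).

Lemma submod_linear : submod ([set f | linear f] : set (M -> N)).
Proof.
split=> [a x y|a f g lf lg b x y] /=; first by rewrite scaler0 addr0.
have -> z : (a *: f + g) z = a *: f z + g z by [].
by rewrite lf lg !scalerDr !scalerA mulrC addrACA.
Qed.

Definition homR : lmodType R := subm submod_linear.

Definition homR_fun (f : homR) : {linear M -> N} := mklin (subiP f).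

Lemma homR_funE f x : homR_fun f x = subi submod_linear f x.
Proof. by []. Qed.

Definition homR_of (f : {linear M -> N}) : homR :=
  exist (fun g : M -> N => `[< linear g >]) (f : M -> N)
    (asboolT (linearP f)).

Lemma homR_ofE f x : homR_fun (homR_of f) x = f x.
Proof. by []. Qed.

Lemma homR_ext (f g : homR) : homR_fun f =1 homR_fun g -> f = g.
Proof. by move=> h; apply: subi_inj; apply/funext. Qed.

Lemma homR_funP a (f g : homR) x :
  homR_fun (a *: f + g) x = a *: homR_fun f x + homR_fun g x.
Proof. by rewrite !homR_funE linearP. Qed.

Lemma homR_fun0 x : homR_fun 0 x = 0.
Proof. by rewrite homR_funE linear0. Qed.

Lemma homR_funD (f g : homR) x :
  homR_fun (f + g) x = homR_fun f x + homR_fun g x.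
Proof. by rewrite !homR_funE linearD. Qed.

Lemma homR_funB (f g : homR) x :
  homR_fun (f - g) x = homR_fun f x - homR_fun g x.
Proof. by rewrite !homR_funE linearB. Qed.

Lemma homR_funZ a (f : homR) x : homR_fun (a *: f) x = a *: homR_fun f x.
Proof. by rewrite !homR_funE linearZ_LR. Qed.

End LinearMaps.

(** * Lengths of Hom modules and modules with multiplicity-free socle *)

Section Matlis.
Variable R : comNzRingType.
Hypothesis flR : fin_len R^o.
Implicit Types M N : lmodType R.

(** [(U + R x) / U] is a quotient of [R]: a submodule between [U] and [U + R x] is recovered from
    its colon ideal at [x]. *)
Lemma flen_line M (U : set M) (x : M) n : submod U -> fl n R^o ->
  flen n U (addset U (line x)).
Proof.
move=> sU hn; have sUx := submod_add sU (submod_line x).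
apply: (@flen_map _ _ _ _ n (fun C => colon C x) _ _ [set 0] setT) => //.
- move=> C sC UC CV; split=> //; first exact: submod_colon.
  by move=> _ ->; rewrite /colon /= scale0r; case: sC.
- by move=> C D _ _ _ CD _ r /CD.
- move=> C D sC sD UC CD DV h y Dy; have [u [_ [Uu [r ->] yE]]] := DV y Dy.
  rewrite yE; apply: submodD => //; first exact: UC.
  apply: h; rewrite /colon /=; have -> : r *: x = y - u by rewrite yE addrC addKr.
  by apply: submodB => //; apply/CD/UC.
- exact: addset_l (submod_line x).
apply: flen_lower hn => _ ->; rewrite /colon /= scale0r; by case: sU.
Qed.

Lemma fin_gen_fin_len M : fin_gen M -> fin_len M.
Proof.
move=> [k [e he]]; have [n hn] := flR.
pose span j : set M := [set x | exists c : 'I_k -> R,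
  x = \sum_(i < k | (i < j)%N) c i *: e i].
have ss j : submod (span j).
  split; first by exists (fun=> 0); rewrite big1 // => i _; rewrite scale0r.
  move=> a _ _ [c ->] [d ->]; exists (fun i => a * c i + d i).
  rewrite scaler_sumr -big_split /=; apply: eq_bigr => i _.
  by rewrite scalerDl scalerA.
have h j : flen (j * n)%N [set 0] (span j).
  elim: j => [|j IH]; first by move=> C _ _ Cs x /Cs[c ->]; rewrite big_pred0.
  have s0 : [set 0] `<=` span j by move=> _ ->; case: (ss j).
  have sS : span j `<=` span j.+1.
    move=> _ [c ->]; exists (fun i : 'I_k => if (i < j)%N then c i else 0).
    rewrite [LHS]big_mkcond [RHS]big_mkcond /=; apply: eq_bigr => i _.
    by case: (ltnP i j) => ij; [rewrite (leqW ij)|rewrite scale0r if_same].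
  rewrite mulSn addnC; apply: (flen_add (W := span j)) => //; first exact: submod0.
  have [jk|kj] := ltnP j k.
    apply: (flen_upper (V := addset (span j) (line (e (Ordinal jk))))).
      move=> _ [c ->]; exists (\sum_(i < k | (i < j)%N) c i *: e i).
      exists (c (Ordinal jk) *: e (Ordinal jk)); split; [by exists c|by exists (c (Ordinal jk))|].
      rewrite (bigD1 (Ordinal jk)) /= ?ltnSn // addrC; congr (_ + _).
      apply: eq_bigl => i; rewrite ltnS -val_eqE /= ltn_neqAle andbC; by [].
    exact: flen_line.
  apply: (@flen_le _ 0%N) => // C _ _ Cs; apply: (subset_trans Cs).
  move=> _ [c ->]; exists c; apply: eq_bigl => i.
  by rewrite !(leq_trans (ltn_ord i)) // leqW.
exists (k * n)%N; apply: flen_upper (h k) => x _; have [c ->] := he x.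
by exists c; apply: eq_bigl => i; rewrite ltn_ord.
Qed.

(* Otherwise repeatedly replacing [x] by a multiple would give arbitrarily long
   descending chains above [U]. *)
Lemma colon_maxid M (U : set M) (v : M) : submod U -> ~ U v ->
  exists s, ~ U (s *: v) /\ maxid (colon U (s *: v)).
Proof.
move=> sU nUv; apply: contrapT => hn.
have step x : ~ U x -> line v x -> exists s, [/\ ~ U (s *: x), line v (s *: x) &
    ~ addset U (line x) `<=` addset U (line (s *: x))].
  move=> nUx [t xE]; apply: contrapT => h; apply: hn; exists t; rewrite -xE.
  split=> //; split; [exact: submod_colon|by rewrite /colon /= scale1r|].
  move=> r nr; apply: contrapT => h'; apply: h; exists r; split=> //.
    by exists (r * t); rewrite xE scalerA.
  move=> /(_ x (addset_r sU (line_id x)))[u [_ [Uu [s ->] xE']]].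
  apply: h'; exists s; rewrite /colon /= scalerBl scale1r {1}xE' -scalerA.
  by rewrite addrK.
have no k x : ~ U x -> line v x -> ~ flen k U (addset U (line x)).
  elim: k x => [|k IH] x nUx vx.
    move=> /(_ (addset U (line x)) (submod_add sU (submod_line x)) (addset_l (submod_line x))).
    by move=> /(_ (@subset_refl _ _) x (addset_r sU (line_id x))).
  have [s [nUs vs ns]] := step x nUx vx => h; apply: (IH _ nUs vs).
  have sUx := submod_add sU (submod_line x).
  apply: flen_strict ns h => //; first exact: addset_l (submod_line _).
  apply: addset_sub => //; first exact: addset_l (submod_line _).
  apply: line_sub => //; apply: addset_r => //; exists s; by [].
by have [n hn'] := flR; apply: (no n v nUv (line_id v)); apply: flen_line.
Qed.

(** A composition series of [M / U]: each simple factor is given by a generator [x] whose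
    annihilator [colon U x] is a maximal ideal. *)
Inductive comp_series M : set M -> nat -> Prop :=
| cs_nil U : (forall x, U x) -> comp_series U 0
| cs_cons U x n : maxid (colon U x) ->
    comp_series (addset U (line x)) n -> comp_series U n.+1.

Lemma flen_comp_series M n (U : set M) : submod U -> flen n U setT ->
  exists2 k, (k <= n)%N & comp_series U k.
Proof.
elim: n U => [|n IH] U sU h.
  by exists 0%N => //; apply: cs_nil => x; apply: (h setT) => //; apply: submodT.
have [hU|nU] := pselect (forall x, U x); first by exists 0%N => //; apply: cs_nil.
have [v nUv] : exists v, ~ U v by apply/existsNP.
have [s [nUs ms]] := colon_maxid sU nUv.
have [|k kn hk] := IH _ (submod_add sU (submod_line (s *: v))).
  apply: h => //; [exact: submod_add (submod_line _)|exact: addset_l (submod_line _)|].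
  by move=> h'; apply: nUs; apply: h'; apply: addset_r => //; apply: line_id.
by exists k.+1 => //; apply: cs_cons hk.
Qed.

(* Each simple module occurs at most once in the socle. *)
Definition simple_socle N := forall m, maxid m -> forall a b : N, a <> 0 ->
  (forall r, m r -> r *: a = 0) -> (forall r, m r -> r *: b = 0) ->
  exists r, b = r *: a.

(** Modulo the maps that also kill [x], a map killing [U] is determined by its value at [x]. That
    value is killed by the maximal ideal [colon U x], so by [simple_socle] the values form at most
    one simple module, and each factor contributes at most one step. *)
Lemma comp_series_hom M N n (U : set M) : submod U -> simple_socle N ->
  comp_series U n ->
  flen n [set 0] [set f : homR M N | forall x, U x -> homR_fun f x = 0].
Proof.
move=> sU ssN cs; elim: cs sU => {n U} [U hU|U x n mU _ IH] sU.
  by move=> C _ _ CV f /CV fU /=; apply: homR_ext => x; rewrite fU // homR_fun0.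
have sUx := submod_add sU (submod_line x).
have sF (W : set M) : submod [set f : homR M N | forall x, W x -> homR_fun f x = 0].
  split=> [y _|a f g hf hg y Wy]; first by rewrite homR_fun0.
  by rewrite homR_funP hf // hg // scaler0 addr0.
rewrite -addn1; apply: (flen_add _ (sF (addset U (line x)))) => //.
- exact: submod0.
- by move=> _ -> y _; rewrite homR_fun0.
- by move=> f hf y Uy; apply: hf; apply: addset_l => //; apply: submod_line.
- exact: IH.
move=> C sC WC CV nCW D sD CD DV.
have [f [Cf fx]] : exists f, C f /\ homR_fun f x <> 0.
  apply: contrapT => h; apply: nCW => f Cf _ [u [_ [Uu [r ->] ->]]].
  rewrite linearD linearZ_LR (CV f Cf) // add0r.
  suff -> : homR_fun f x = 0 by rewrite scaler0.
  by apply: contrapT => fx; apply: h; exists f.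
have mk (g : homR M N) : (forall y, U y -> homR_fun g y = 0) ->
    forall r, colon U x r -> r *: homR_fun g x = 0.
  by move=> hg r Ur; rewrite -linearZ_LR hg.
move=> g /DV gU.
have [r gE] := ssN _ mU _ _ fx (mk f (CV f Cf)) (mk g gU).
rewrite -(subrK (r *: f) g); apply: submodD => //; last exact: submodZ.
apply: WC => _ [u [_ [Uu [s ->] ->]]].
rewrite homR_funB homR_funZ (linearD (homR_fun g)) (linearD (homR_fun f)).
rewrite gU // (CV f Cf) // !add0r (linearZ_LR (homR_fun g)) gE.
by rewrite (linearZ_LR (homR_fun f)) !scalerA mulrC subrr.
Qed.

Lemma fl_hom M N n : simple_socle N -> fl n M -> fl n (homR M N).
Proof.
move=> ssN /(flen_comp_series (submod0 M))[k kn cs]; apply: (flen_le kn).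
apply: flen_upper (comp_series_hom (submod0 M) ssN cs) => f _ _ ->.
by rewrite linear0.
Qed.

(** [N] is the image of [Hom(R, N)] under evaluation at [1]. The resulting bound is the same for all
    [N], and so a module of maximal length exists. *)
Lemma simple_socle_fl N n : simple_socle N -> fl n R^o -> fl n N.
Proof.
move=> ssN /(fl_hom ssN); pose ev (f : homR R^o N) := homR_fun f (1 : R^o).
have evP : linear ev by move=> a f g; rewrite /ev homR_funP.
apply: (flen_surj (f := mklin evP)) => y.
have lP : linear (fun r : R^o => r *: y) by move=> a r s; rewrite scalerDl scalerA.
by exists (homR_of (mklin lP)); rewrite /= /ev homR_ofE /= scale1r.
Qed.

(* Such a module is the injective hull of the direct sum of the simple
   modules. *)
Definition socle_maximal (E : lmodType R) :=
  forall (Q : lmodType R) (f : {linear E -> Q}), injective f -> simple_socle Q ->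
    forall y, exists x, f x = y.

(** A module attaining the least common bound cannot embed properly into another module of the same
    kind. If the bound is [0], all these modules vanish and the zero module serves. *)
Lemma maximal_simple_socle : exists E : lmodType R,
  simple_socle E /\ socle_maximal E.
Proof.
have ex : exists n, `[< forall N, simple_socle N -> fl n N >].
  have [n hn] := flR; exists n; apply/asboolP => N ssN; exact: simple_socle_fl.
case: (ex_minnP ex) => -[|n] /asboolP hn hmin.
  exists ('rV[R]_0)%type; split=> [m _ a b _ _ _|Q f fi ssQ y].
    by exists 0; rewrite !thinmx0.
  exists 0; rewrite linear0; symmetry.
  by apply: (hn Q ssQ setT) => //; apply: submodT.
have [E [ssE nE]] : exists E : lmodType R, simple_socle E /\ ~ fl n E.
  apply: contrapT => h; suff /hmin : `[< forall N, simple_socle N -> fl n N >].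
    by rewrite ltnn.
  by apply/asboolP => N ssN; apply: contrapT => nN; apply: h; exists N.
exists E; split=> // Q f fi ssQ y; apply: contrapT => ny; apply: nE.
apply: (@flen_inj _ n E Q f setT (range f)) => //.
apply: (flen_strict (V := setT)) => //.
- by move=> _ ->; exists 0; rewrite ?linear0.
- by move=> /(_ y I)[x _ fx]; apply: ny; exists x.
exact: hn.
Qed.

(** * Injectivity and the cogenerator property *)

Section Injective.
Variable E : lmodType R.
Hypothesis ssE : simple_socle E.
Hypothesis Emax : socle_maximal E.

(* If [C] is a maximal submodule of [E * V] meeting [E] trivially, then [E] is
   essential in the quotient, so that the quotient still has a simple socle and
   [E] is all of it. *)
Lemma extend_graph (V : lmodType R) (G : set (E * V)%type) :
  submod G -> (forall e, G (e, 0) -> e = 0) ->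
  exists h : {linear V -> E}, forall e v, G (e, v) -> h v = e.
Proof.
move=> sG G0.
pose P (C : set (E * V)%type) :=
  C = set0 \/ [/\ submod C, G `<=` C & forall e, C (e, 0) -> e = 0].
have [|C [PC Cmax]] := @Zorn_bigcup _ P.
  move=> F FP Ftot.
  have [[z [X FX Xz]]|F0] := pselect (exists z, (\bigcup_(X in F) X) z); last first.
    by left; apply/seteqP; split=> z // hz; apply: F0; exists z.
  have FP' Y y : F Y -> Y y -> [/\ submod Y, G `<=` Y & forall e, Y (e, 0) -> e = 0].
    by move=> FY Yy; case: (FP Y FY) => // Y0; move: Yy; rewrite Y0.
  right; split.
  - split; first by exists X => //; case: (FP' X z FX Xz) => -[].
    move=> a u v [Y FY Yu] [W FW Wv].
    have [YW|WY] := Ftot Y W FY FW.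
      by exists W => //; have [[_ ?] _ _] := FP' W v FW Wv; auto.
    by exists Y => //; have [[_ ?] _ _] := FP' Y u FY Yu; auto.
  - by move=> y Gy; exists X => //; have [_ GX _] := FP' X z FX Xz; apply: GX.
  - by move=> e [Y FY Ye]; have [_ _ h] := FP' Y _ FY Ye; apply: h.
have [sC GC C0] : [/\ submod C, G `<=` C & forall e, C (e, 0) -> e = 0].
  case: PC => // CE; exfalso; apply: (Cmax G); last by right; split.
  by rewrite CE; split; [move=> ? []|move=> h; apply: (h 0 sG.1)].
pose inE e : E * V := (e, 0).
have inP : linear (fun e => qpi sC (inE e)).
  move=> a x y; rewrite -linearP; congr (qpi _ _); apply/pair_equal_spec.
  by split=> //=; rewrite scaler0 addr0.
pose j : {linear E -> quotm sC} := mklin inP.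
have ji : injective j.
  by apply: ker0_inj => x /= /(qpi0 sC) /C0.
(* [E] is essential in the quotient: a line meeting [j E] trivially could be added to [C], against
   its maximality. *)
have ess q : q <> 0 -> exists r e, r *: q = j e /\ e <> 0.
  have [x <-] := qpi_surj q => qx0; apply: contrapT => h; apply: (Cmax (addset C (line x))).
    split; first exact: addset_l (submod_line x).
    move=> h'; apply: qx0; apply/qpi0; apply: h'; apply: addset_r => //; exact: line_id.
  right; split; first exact: submod_add (submod_line x).
    by apply: (subset_trans GC); apply: addset_l (submod_line x).
  move=> e [c [_ [Cc [r ->] eE]]]; apply: contrapT => e0; apply: h.
  exists r, e; split=> //; rewrite -linearZ_LR /= /inE eE (linearD (qpi sC)).
  by rewrite /= (qpi0 sC c).2 // add0r.
have ssQ : simple_socle (quotm sC).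
  move=> m mm a b a0 ha hb.
  have inE' q : q <> 0 -> (forall r, m r -> r *: q = 0) ->
      exists e, q = j e.
    move=> q0 hq; have [r [e [re e0]]] := ess q q0.
    have nmr : ~ m r.
      by move=> /hq rq; apply: e0; apply: ji; rewrite -re rq linear0.
    have [_ _ /(_ r nmr)[s ms]] := mm; exists (s *: e).
    rewrite linearZ_LR -re scalerA; apply/eqP; rewrite -subr_eq0 -{1}(scale1r q).
    by rewrite -scalerBl hq.
  have [e1 aE] := inE' a a0 ha.
  have [->|b0] := pselect (b = 0); first by exists 0; rewrite scale0r.
  have [e2 bE] := inE' b b0 hb; subst a b.
  have [|||r ->] := ssE mm (a := e1) (b := e2).
  - by move=> e10; apply: a0; rewrite e10 linear0.
  - by move=> r /ha re; apply: ji; rewrite linearZ_LR re linear0.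
  - by move=> r /hb re; apply: ji; rewrite linearZ_LR re linear0.
  by exists r; rewrite linearZ_LR.
(* By [Emax] the map [j] is onto, so [(0, v)] is congruent modulo [C] to some [(e, 0)], and [C]
   contains [(- e, v)]. As [C] meets [E] trivially, it is the graph of a map. *)
have tot v : exists e, C (e, v).
  have [e je] := Emax ji ssQ (qpi sC (0, v)); exists (- e).
  have : qpi sC ((0, v) - inE e) = 0 by rewrite linearB /= -je /= subrr.
  move=> /qpi0; rewrite /inE; congr (C _).
  by apply/pair_equal_spec; rewrite /= sub0r subr0.
have uniq e1 e2 v : C (e1, v) -> C (e2, v) -> e1 = e2.
  move=> h1 h2; apply/eqP; rewrite -subr_eq0; apply/eqP/C0.
  have := submodB sC h1 h2; congr (C _); apply/pair_equal_spec.
  by rewrite /= subrr.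
have [h hC] := choice tot.
have hP : linear h.
  move=> a x y; apply: (uniq _ _ (a *: x + y)) => //.
  by have := sC.2 a _ _ (hC x) (hC y).
by exists (mklin hP) => e v /GC Ce; apply: (uniq _ _ v) => //; apply: hC.
Qed.

(** Injectivity of [E] in the form used everywhere below: extension from the image of [f], with no
    inclusion of submodules to be named. *)
Lemma extend_factor (U V : lmodType R) (f : {linear U -> V}) (g : {linear U -> E}) :
  (forall x, f x = 0 -> g x = 0) -> exists h : {linear V -> E}, forall x, h (f x) = g x.
Proof.
move=> fg; pose G : set (E * V)%type := [set p | exists x, p = (g x, f x)].
have [||h hG] := @extend_graph V G.
- split; first by exists 0; rewrite !linear0.
  by move=> a _ _ [x ->] [y ->]; exists (a *: x + y); rewrite !linearP.
- by move=> e [x [-> /esym /fg]].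
by exists h => x; apply: hG; exists x.
Qed.

(** Every simple module occurs in [E]: if [R / m] did not, its direct sum with [E] would still
    repeat no simple module, against maximality. *)
Lemma maxid_killed m : maxid m -> exists e : E, e <> 0 /\ forall r, m r -> r *: e = 0.
Proof.
move=> mm; have [sm m1 mmax] := mm; apply: contrapT => hn.
pose Q := (E * quotm sm)%type.
have killE (a : quotm sm) m' : maxid m' -> a <> 0 -> (forall r, m' r -> r *: a = 0) ->
    forall r, m r -> m' r.
  have [x <-] := qpi_surj a => -[sm' _ mmax'] a0 ha r mr.
  apply: contrapT => /mmax'[s ms].
  apply: a0; rewrite -[LHS]scale1r -(subrK (s * r) 1) scalerDl ha // add0r.
  rewrite -linearZ_LR; apply/qpi0; rewrite /GRing.scale /= mulrAC.
  exact: (submodZ sm (s * x : R) mr).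
(* An element of [R / m] can be killed by [m'] without being zero only if [m] is contained in [m'],
   and then by [hn] no nonzero element of [E] is killed by [m']. So the two summands share no simple
   module. *)
have ssQ : simple_socle Q.
  move=> m' mm' [a1 a2] [b1 b2] a0 ha hb.
  have ha1 r : m' r -> r *: a1 = 0 by move=> /ha /(congr1 fst).
  have ha2 r : m' r -> r *: a2 = 0 by move=> /ha /(congr1 snd).
  have hb1 r : m' r -> r *: b1 = 0 by move=> /hb /(congr1 fst).
  have hb2 r : m' r -> r *: b2 = 0 by move=> /hb /(congr1 snd).
  have [a20|a20] := pselect (a2 = 0).
    have [b20|b20] := pselect (b2 = 0).
      have [|||r ->] := ssE mm' (a := a1) (b := b1) => //.
        by move=> a10; apply: a0; rewrite a10 a20.
      by exists r; rewrite a20 b20; apply/pair_equal_spec; rewrite /= scaler0.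
    have mm'' := killE b2 m' mm' b20 hb2.
    by case: hn; exists a1; split=> [a10|r /mm'' /ha1//]; apply: a0; rewrite a10 a20.
  have mm'' := killE a2 m' mm' a20 ha2.
  have no (e : E) : (forall r, m' r -> r *: e = 0) -> e = 0.
    move=> he; apply: contrapT => e0; apply: hn; exists e; split=> // r /mm''; exact: he.
  rewrite (no a1 ha1) (no b1 hb1).
  have [x a2E] := qpi_surj a2; have [y b2E] := qpi_surj b2.
  have nmx : ~ m x by move=> mx; apply: a20; rewrite -a2E; apply/qpi0.
  have [s ms] := mmax x nmx; exists (y * s).
  apply/pair_equal_spec; rewrite /= scaler0; split=> //.
  rewrite -a2E -b2E -linearZ_LR; apply: qpi_eq => //.
  have := submodZ sm (y : R) ms; congr (m _).
  by rewrite /GRing.scale /= mulrBr mulr1 mulrA.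
have inP : linear (fun e : E => (e, 0) : Q).
  by move=> a x y; apply/pair_equal_spec; rewrite /= scaler0 addr0.
have inI : injective (mklin inP) by move=> x y [].
have [e /(congr1 snd) /= e1] := Emax inI ssQ (0, qpi sm 1).
by apply: m1; apply/(qpi0 sm); rewrite -e1.
Qed.

(** Some multiple [s v] generates a simple module modulo [U]. The functional is prescribed on
    [U + R s v], as zero on [U] and with value at [s v] an element of [E] killed by the same maximal
    ideal, and then extended. *)
Lemma separate (V : lmodType R) (U : set V) (v : V) : submod U -> ~ U v ->
  exists h : {linear V -> E}, (forall u, U u -> h u = 0) /\ h v <> 0.
Proof.
move=> sU nUv; have [s [nUs ms]] := colon_maxid sU nUv.
have [e [e0 he]] := maxid_killed ms.
pose G : set (E * V)%type := [set p | exists r u, U u /\ p = (r *: e, u + r *: (s *: v))].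
have [||h hG] := @extend_graph V G.
- split; first by exists 0, 0; rewrite !scale0r addr0; split=> //; case: sU.
  move=> a _ _ [r [u [Uu ->]]] [r' [u' [Uu' ->]]].
  exists (a * r + r'), (a *: u + u'); split; first by case: sU; auto.
  apply/pair_equal_spec; rewrite /= !scalerDl !scalerDr !scalerA !mulrA addrACA.
  by split.
- move=> x [r [u [Uu [-> /esym uE]]]]; apply: he; rewrite /colon /=.
  have -> : r *: (s *: v) = - u by apply/eqP; rewrite -addr_eq0 addrC uE.
  exact: submodN.
exists h; split=> [u Uu|hv].
  by apply: hG; exists 0, u; rewrite !scale0r addr0.
apply: e0; have <- : h (s *: v) = e.
  by apply: hG; exists 1, 0; rewrite !scale1r add0r; split=> //; case: sU.
by rewrite linearZ_LR hv scaler0.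
Qed.

Lemma cogen (V : lmodType R) (v : V) : (forall h : {linear V -> E}, h v = 0) -> v = 0.
Proof.
move=> hv; apply: contrapT => v0.
by have [h [_]] := separate (submod0 V) v0; rewrite hv.
Qed.

End Injective.
End Matlis.

(** * Duality for modules over an artin algebra *)

(* A finite central algebra structure; unlike [algType], it applies verbatim
   to the converse ring. *)
Record central_alg (R : comNzRingType) (A : nzRingType) := CentralAlg {
  rho : {rmorphism R -> A};
  rho_central : forall r a, rho r * a = a * rho r;
  rho_fg : exists (k : nat) (e : 'I_k -> A),
    forall a, exists c : 'I_k -> R, a = \sum_i rho (c i) * e i
}.

(** A synonym of [M] carrying the [R]-structure as an instance, kept apart from the [A]-structure;
    [al] is recorded so that the instance can find [rho]. *)
Definition res (R : comNzRingType) (A : nzRingType) (al : central_alg R A)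
  (M : lmodType A) : Type := M.

Section Restriction.
Variables (R : comNzRingType) (A : nzRingType) (al : central_alg R A).
Variable M : lmodType A.
HB.instance Definition _ := GRing.Zmodule.on (res al M).

Definition res_scale (r : R) (x : res al M) : res al M := rho al r *: (x : M).

Fact res_scaleA r s x : res_scale r (res_scale s x) = res_scale (r * s) x.
Proof. by rewrite /res_scale scalerA rmorphM. Qed.
Fact res_scale1 : left_id 1 res_scale.
Proof. by move=> x; rewrite /res_scale rmorph1 scale1r. Qed.
Fact res_scaleDr : right_distributive res_scale +%R.
Proof. by move=> r x y; rewrite /res_scale scalerDr. Qed.
Fact res_scaleDl x : {morph res_scale^~ x : r s / r + s}.
Proof. by move=> r s; rewrite /res_scale rmorphD scalerDl. Qed.

HB.instance Definition _ := GRing.Zmodule_isLmodule.Build R (res al M)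
  res_scaleA res_scale1 res_scaleDr res_scaleDl.
End Restriction.

Section FiniteModules.
Variables (R : comNzRingType) (A : nzRingType) (al : central_alg R A).
Implicit Types M N : lmodType A.
Local Notation res := (res al).

Lemma resE M r (x : res M) : r *: x = rho al r *: (x : M).
Proof. by []. Qed.

Lemma res_linear M N (f : {linear M -> N}) : linear (f : res M -> res N).
Proof. by move=> r x y; rewrite !resE linearP. Qed.

Definition res_lin M N (f : {linear M -> N}) : {linear res M -> res N} :=
  mklin (@res_linear M N f).

Lemma res_submod M (U : set M) : submod U -> submod (U : set (res M)).
Proof. by move=> [U0 hU]; split=> // r x y; apply: hU. Qed.

Lemma scale_res_linear M a : linear (fun x : res M => (a *: (x : M) : res M)).
Proof.
by move=> r x y; rewrite !resE scalerDr !scalerA rho_central.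
Qed.

Definition scale_res M a : {linear res M -> res M} := mklin (@scale_res_linear M a).

Hypothesis flR : fin_len R^o.

Lemma fin_gen_fin (K : nzRingType) (M : lmodType K) (T : finType) (e : T -> M) :
  (forall x, exists c : T -> K, x = \sum_t c t *: e t) -> fin_gen M.
Proof.
move=> he; exists #|T|, (e \o enum_val) => x; have [c ->] := he x.
exists (c \o enum_val); rewrite -(big_enum_val (A := T) (fun t => c t *: e t)) /=.
by apply: eq_bigl => t; rewrite inE.
Qed.

Lemma fin_gen_res M : fin_gen M -> fin_gen (res M).
Proof.
move=> [k [e he]]; have [l [b hb]] := rho_fg al.
apply: (@fin_gen_fin _ _ ('I_l * 'I_k)%type (fun p => b p.1 *: e p.2 : res M)) => x.
have [c ->] := he x; have [d hd] := choice (fun i => hb (c i)).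
exists (fun p => d p.2 p.1); rewrite -(pair_bigA _ (fun i j => d j i *: (b i *: e j : res M))) /=.
rewrite exchange_big /=; apply: eq_bigr => i _; rewrite {1}hd scaler_suml.
by apply: eq_bigr => j _; rewrite resE scalerA.
Qed.

Lemma fin_gen_len M : fin_gen M -> fin_len (res M).
Proof. by move=> /fin_gen_res; apply: fin_gen_fin_len. Qed.

Lemma fin_len_gens M (U : set M) : submod U -> fin_len (res M) ->
  exists (k : nat) (e : 'I_k -> M), (forall i, U (e i)) /\
    forall x, U x -> exists c : 'I_k -> A, x = \sum_i c i *: e i.
Proof.
move=> sU /(fin_len_gen (res_submod sU))[k [e [Ue he]]].
exists k, e; split=> // x /he[c ->].
by exists (fun i => rho al (c i)); apply: eq_bigr.
Qed.

Lemma fin_len_fin_gen M : fin_len (res M) -> fin_gen M.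
Proof.
by move=> /(fin_len_gens (submodT M))[k [e [_ he]]]; exists k, e => x; apply: he.
Qed.

Lemma fin_gen_inj M N (f : {linear M -> N}) : injective f -> fin_gen N -> fin_gen M.
Proof.
by move=> fi /fin_gen_len fN; apply/fin_len_fin_gen/(fin_len_inj (f := res_lin f)).
Qed.

Lemma fin_gen_surj M N (f : {linear M -> N}) :
  (forall y, exists x, f x = y) -> fin_gen M -> fin_gen N.
Proof.
move=> fs [k [e he]]; exists k, (f \o e) => y.
have [x <-] := fs y; have [c ->] := he x; exists c.
by rewrite linear_sum; apply: eq_bigr => i _; rewrite linearZ_LR.
Qed.

Lemma fin_gen_prod M N : fin_gen M -> fin_gen N -> fin_gen (M * N)%type.
Proof.
move=> [k [e he]] [l [b hb]].
apply: (@fin_gen_fin _ _ ('I_k + 'I_l)%type (fun s => match s with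
  inl i => (e i, 0) | inr j => (0, b j) end : M * N)%type) => -[x y].
have [c ->] := he x; have [d ->] := hb y.
exists (fun s => match s with inl i => c i | inr j => d j end).
rewrite big_sumType /=.
have -> : \sum_i c i *: ((e i, 0) : (M * N)%type) = (\sum_i c i *: e i, 0).
  elim/big_rec2: _ => // i u v _ ->.
  by apply/pair_equal_spec; rewrite /= scaler0 addr0.
have -> : \sum_i d i *: ((0, b i) : (M * N)%type) = (0, \sum_i d i *: b i).
  elim/big_rec2: _ => // i u v _ ->.
  by apply/pair_equal_spec; rewrite /= scaler0 addr0.
by apply/pair_equal_spec; rewrite /= addr0 add0r.
Qed.

Lemma fin_gen_fun M (I : finType) : fin_gen M -> fin_gen (I -> M).
Proof.
move=> [k [e he]].
apply: (@fin_gen_fin _ _ (I * 'I_k)%type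
  (fun p => (fun i => if i == p.1 then e p.2 else 0) : I -> M)) => f.
have [c hc] := choice (fun i => he (f i)).
exists (fun p => c p.1 p.2); apply/funext => i.
rewrite -(pair_bigA _ (fun j l => c j l *: ((fun i => if i == j then e l else 0) : I -> M))) /=.
rewrite fct_sumE (bigD1 i) //= [X in _ + X]big1 ?addr0 => [|j ji].
  rewrite fct_sumE {1}hc; apply: eq_bigr => l _.
  by rewrite [RHS]/GRing.scale /= eqxx.
rewrite fct_sumE big1 // => l _.
by rewrite /GRing.scale /= eq_sym (negPf ji) scaler0.
Qed.

End FiniteModules.

(* Mutually inverse anti-isomorphisms of algebras. *)
Record anti_iso (R : comNzRingType) (A B : nzRingType) (al : central_alg R A)
    (be : central_alg R B) := AntiIso {
  tau : B -> A;
  sig : A -> B;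
  tauK : cancel tau sig;
  sigK : cancel sig tau;
  tauD : forall b c, tau (b + c) = tau b + tau c;
  tau1 : tau 1 = 1;
  tauM : forall b c, tau (b * c) = tau c * tau b;
  tau_rho : forall r, tau (rho be r) = rho al r
}.

Section Swap.
Variables (R : comNzRingType) (A B : nzRingType).
Variables (al : central_alg R A) (be : central_alg R B) (t : anti_iso al be).

Lemma sigD a c : sig t (a + c) = sig t a + sig t c.
Proof. by apply: (can_inj (tauK t)); rewrite tauD !sigK. Qed.
Lemma sig1 : sig t 1 = 1.
Proof. by apply: (can_inj (tauK t)); rewrite tau1 !sigK. Qed.
Lemma sigM a c : sig t (a * c) = sig t c * sig t a.
Proof. by apply: (can_inj (tauK t)); rewrite tauM !sigK. Qed.
Lemma sig_rho r : sig t (rho al r) = rho be r.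
Proof. by apply: (can_inj (tauK t)); rewrite tau_rho !sigK. Qed.

Definition anti_swap : anti_iso be al :=
  AntiIso (sigK t) (tauK t) sigD sig1 sigM sig_rho.
End Swap.

(** * Perfect pairings and dual modules *)

Section Dual.
Variables (R : comNzRingType) (E : lmodType R).

(** A perfect pairing presents each of [M] and [M'] as the [E]-dual of the other. Because the notion
    is symmetric, each fact about one side yields the fact about the other through
    [pairing_swap]. *)
Record pairing (A B : nzRingType) (al : central_alg R A) (be : central_alg R B)
    (t : anti_iso al be) (M : lmodType A) (M' : lmodType B) := Pairing {
  pr :> M -> M' -> E;
  pr_linl : forall y, linear (pr^~ y : res al M -> E);
  pr_linr : forall x, linear (pr x : res be M' -> E);
  pr_bal : forall b x y, pr (tau t b *: x) y = pr x (b *: y);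
  pr_repr : forall f : {linear res al M -> E}, exists y, forall x, pr x y = f x;
  pr_repl : forall g : {linear res be M' -> E}, exists x, forall y, pr x y = g y;
  pr_injr : forall y, (forall x, pr x y = 0) -> y = 0;
  pr_injl : forall x, (forall y, pr x y = 0) -> x = 0
}.

Section PairingTheory.
Variables (A B : nzRingType) (al : central_alg R A) (be : central_alg R B).
Variables (t : anti_iso al be) (M : lmodType A) (M' : lmodType B).
Variable p : pairing t M M'.

Definition prl y : {linear res al M -> E} := mklin (pr_linl p y).
Definition prr x : {linear res be M' -> E} := mklin (pr_linr p x).

Lemma prDr x y y' : p x (y + y') = p x y + p x y'.
Proof. exact: (linearD (prr x)). Qed.
Lemma prBl x x' y : p (x - x') y = p x y - p x' y.
Proof. exact: (linearB (prl y)). Qed.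
Lemma prBr x y y' : p x (y - y') = p x y - p x y'.
Proof. exact: (linearB (prr x)). Qed.
Lemma pr0l y : p 0 y = 0.
Proof. exact: (linear0 (prl y)). Qed.
Lemma pr0r x : p x 0 = 0.
Proof. exact: (linear0 (prr x)). Qed.
Lemma pr_bal' a x y : p (a *: x) y = p x (sig t a *: y).
Proof. by rewrite -pr_bal sigK. Qed.

Lemma pr_extr y y' : (forall x, p x y = p x y') -> y = y'.
Proof.
move=> h; apply/eqP; rewrite -subr_eq0; apply/eqP/(pr_injr (p := p)) => x.
by rewrite prBr h subrr.
Qed.
Lemma pr_extl x x' : (forall y, p x y = p x' y) -> x = x'.
Proof.
move=> h; apply/eqP; rewrite -subr_eq0; apply/eqP/(pr_injl (p := p)) => y.
by rewrite prBl h subrr.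
Qed.

Definition pairing_swap : pairing (anti_swap t) M' M :=
  @Pairing _ _ be al (anti_swap t) M' M (fun y x => p x y)
    (pr_linr p) (pr_linl p) (fun a y x => esym (pr_bal' a x y))
    (pr_repl p) (pr_repr p) (pr_injl (p := p)) (pr_injr (p := p)).

(** [anti_swap (anti_swap t)] has the maps of [t] but other proofs, so the way back is a separate
    construction. *)
Definition pairing_unswap (q : pairing (anti_swap t) M' M) : pairing t M M'.
Proof.
apply: (@Pairing _ _ al be t M M' (fun x y => q y x)).
- exact: (pr_linr q).
- exact: (pr_linl q).
- by move=> b x y; rewrite -(pr_bal q) /= tauK.
- exact: (pr_repl q).
- exact: (pr_repr q).
- exact: (pr_injl (p := q)).
- exact: (pr_injr (p := q)).
Defined.
End PairingTheory.

Section Adjoint.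
Variables (A B : nzRingType) (al : central_alg R A) (be : central_alg R B).
Variables (t : anti_iso al be) (M N : lmodType A) (M' N' : lmodType B).
Variables (p : pairing t M M') (q : pairing t N N').

Lemma adjoint_exists (f : {linear M -> N}) :
  exists g : {linear N' -> M'}, forall x y, q (f x) y = p x (g y).
Proof.
have ex y : exists z, forall x, p x z = q (f x) y.
  exact: (pr_repr p (prl q y \o res_lin al f)).
have [g hg] := choice ex.
have gP : linear g.
  move=> b y y'; apply: (pr_extr (p := p)) => x.
  by rewrite hg !prDr -!pr_bal !hg linearZ_LR.
by exists (mklin gP) => x y; rewrite /= hg.
Qed.
End Adjoint.

Section DualModule.
Variables (A B : nzRingType) (al : central_alg R A) (be : central_alg R B).
Variables (t : anti_iso al be) (M : lmodType A).

Definition dual (t : anti_iso al be) (M : lmodType A) : Type := homR (res al M) E.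
Local Notation D := (dual t M).
HB.instance Definition _ := GRing.Zmodule.on D.

Definition dual_scale (b : B) (f : D) : D :=
  homR_of (homR_fun f \o scale_res al M (tau t b)).

Lemma dual_scaleE b (f : D) x :
  homR_fun (dual_scale b f) x = homR_fun f (tau t b *: (x : M)).
Proof. by []. Qed.

Fact dual_scaleA b c f : dual_scale b (dual_scale c f) = dual_scale (b * c) f.
Proof.
by apply: homR_ext => x; rewrite !dual_scaleE tauM scalerA.
Qed.
Fact dual_scale1 : left_id 1 dual_scale.
Proof. by move=> f; apply: homR_ext => x; rewrite dual_scaleE tau1 scale1r. Qed.
Fact dual_scaleDr : right_distributive dual_scale +%R.
Proof. by move=> b f g; apply: homR_ext. Qed.
Fact dual_scaleDl f : {morph dual_scale^~ f : b c / b + c}.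
Proof.
move=> b c; apply: homR_ext => x.
rewrite dual_scaleE tauD scalerDl; exact: (linearD (homR_fun f)).
Qed.
HB.instance Definition _ := GRing.Zmodule_isLmodule.Build B D
  dual_scaleA dual_scale1 dual_scaleDr dual_scaleDl.

Lemma res_dual_linear : linear (id : homR (res al M) E -> res be D).
Proof.
move=> r f g; apply: homR_ext => x.
rewrite [LHS]homR_funP; congr (_ + _).
by rewrite [RHS]dual_scaleE tau_rho [RHS](linearZ_LR (homR_fun f) r x).
Qed.

Hypothesis flR : fin_len R^o.
Hypothesis ssE : simple_socle E.
Hypothesis Emax : socle_maximal E.

Lemma dual_fl n : fl n (res al M) -> fl n (res be D).
Proof.
move=> /(fl_hom flR ssE); apply: (flen_surj (f := mklin res_dual_linear)) => y.
by exists y.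
Qed.

Lemma dual_fin_gen : fin_gen M -> fin_gen D.
Proof.
move=> /(fin_gen_len al flR)[n /dual_fl h]; apply: (fin_len_fin_gen (al := be)).
by exists n.
Qed.

Lemma dual_lin (x : M) : linear (fun f : res be D => homR_fun (f : D) x).
Proof.
move=> r f g; rewrite [LHS](homR_funD (r *: f : D) g); congr (_ + _).
rewrite [LHS]dual_scaleE tau_rho; exact: (linearZ_LR (homR_fun f) r x).
Qed.

Lemma dual_pairing : fin_gen M ->
  {p : pairing t M D | forall x f, p x f = homR_fun f x}.
Proof.
move=> fM; unshelve eexists; first apply: (@Pairing _ _ al be t M D (fun x f => homR_fun f x)).
- by move=> f a x y; rewrite linearP.
- exact: dual_lin.
- by [].
- by move=> f; exists (homR_of f).
(* Evaluation into the bidual is injective because [E] cogenerates; the bidual is no longer than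
   [M], so evaluation is onto and every functional on the dual is given by an element of [M]. *)
- have evP : linear (fun x : res al M => homR_of (mklin (dual_lin x))).
    move=> r x y; apply: homR_ext => f; rewrite homR_funP.
    exact: (linearP (homR_fun f) r x y).
  have [n [hn /(_ _ (mklin evP)) h]] := fl_min (fin_gen_len al flR fM).
  move=> g; have [||x hx] := h _ _ (homR_of g).
  + apply: ker0_inj => x /= hx; apply: (cogen flR ssE Emax (v := x)) => f.
    have := congr1 (fun k => homR_fun k (homR_of f : res be D)) hx.
    by rewrite homR_fun0.
  + by apply: fl_hom => //; apply: dual_fl.
  by exists x => y; rewrite -(homR_ofE g) -hx.
- by move=> f hf; apply: homR_ext => x; rewrite hf homR_fun0.
- move=> x hx; apply: (cogen flR ssE Emax (v := x : res al M)) => f.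
  by have := hx (homR_of f).
- by [].
Qed.

End DualModule.
End Dual.

(** * Representations of a linear quiver *)

Section Composites.
Variables (A : nzRingType) (n : nat).
Implicit Types X Y : mor_obj A n.

Lemma mor_map_irr X (i j : 'I_n) (e e' : j = i.+1 :> nat) x :
  mor_map X e x = mor_map X e' x.
Proof. by rewrite (eq_irrelevance e e'). Qed.

Definition ord_cast X (i j : 'I_n) (e : j = i) : {linear X j -> X i} :=
  match e in _ = k return {linear X j -> X k} with erefl => idfun end.

Fact ord_step_lt (i j : 'I_n) k : j = (i + k.+1)%N :> nat -> (i + k < n)%N.
Proof. by move=> e; apply: leq_ltn_trans (ltn_ord j); rewrite e leq_add2l leqnSn. Qed.

Fact ord_step_eq (i j : 'I_n) k (e : j = (i + k.+1)%N :> nat) :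
  j = (Ordinal (ord_step_lt e)).+1 :> nat.
Proof. by rewrite e /= addnS. Qed.

Fixpoint pmap_rec X (i : 'I_n) k : forall j : 'I_n, j = (i + k)%N :> nat ->
    {linear X j -> X i} :=
  match k with
  | 0 => fun j e => ord_cast X (val_inj (etrans e (addn0 i)))
  | k'.+1 => fun j e =>
      (@pmap_rec X i k' (Ordinal (ord_step_lt e)) erefl \o
       mor_map X (ord_step_eq e))
  end.

Lemma pmap_recS X (i j j' : 'I_n) k (e : j = (i + k.+1)%N :> nat)
    (e' : j' = (i + k)%N :> nat) (e'' : j = j'.+1 :> nat) x :
  pmap_rec X e x = pmap_rec X e' (mor_map X e'' x).
Proof.
have ej : j' = Ordinal (ord_step_lt e) by apply: val_inj.
subst j'; rewrite (mor_map_irr e'' (ord_step_eq e)).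
by rewrite (eq_irrelevance e' erefl).
Qed.

(* The structure map [X j -> X i]; it is [0] when [j < i]. *)
Definition pmap X (j i : 'I_n) : {linear X j -> X i} :=
  match (i <= j)%N =P true with
  | ReflectT h => pmap_rec X (esym (subnKC h))
  | ReflectF _ => \0
  end.

Lemma pmap_recE X (i j : 'I_n) k (e : j = (i + k)%N :> nat) x :
  pmap X j i x = pmap_rec X e x.
Proof.
rewrite /pmap; case: eqP => [h|]; last by rewrite e leq_addr.
move: (esym _); have -> : (j - i)%N = k by rewrite e addKn.
by move=> e'; rewrite (eq_irrelevance e e').
Qed.

Lemma pmap_id X i x : pmap X i i x = x.
Proof.
rewrite (pmap_recE (k := 0) (esym (addn0 i))) /=.
by rewrite (eq_irrelevance (val_inj _) erefl).
Qed.

Lemma pmap_gt X (i j : 'I_n) x : (j < i)%N -> pmap X j i x = 0.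
Proof. by rewrite ltnNge /pmap => /negP ji; case: eqP. Qed.

Lemma pmap_step X (i j k : 'I_n) (e : j = k.+1 :> nat) x : (i <= k)%N ->
  pmap X j i x = pmap X k i (mor_map X e x).
Proof.
move=> ik; have e1 : j = (i + (k - i).+1)%N :> nat by rewrite addnS subnKC.
have e2 : k = (i + (k - i))%N :> nat by rewrite subnKC.
by rewrite (pmap_recE e1) (pmap_recE e2) (pmap_recS e1 e2 e).
Qed.

Lemma pmap_map X (i j : 'I_n) (e : j = i.+1 :> nat) x :
  pmap X j i x = mor_map X e x.
Proof. by rewrite (pmap_step e) // pmap_id. Qed.

Lemma ord_le_ind (i : 'I_n) (P : 'I_n -> Prop) : P i ->
  (forall j k : 'I_n, j = k.+1 :> nat -> (i <= k)%N -> P k -> P j) ->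
  forall j : 'I_n, (i <= j)%N -> P j.
Proof.
move=> Pi PS j; move: {2}(j - i)%N (erefl (j - i)%N) => m.
elim: m j => [|m IH] j jm ij.
  suff -> : j = i by [].
  by apply/val_inj/eqP; rewrite eqn_leq ij -subn_eq0 jm.
have lt : (i < j)%N by rewrite -subn_gt0 jm.
have kn : (j.-1 < n)%N by apply: leq_ltn_trans (ltn_ord j); apply: leq_pred.
have je : j = (Ordinal kn).+1 :> nat by rewrite /= prednK // (leq_ltn_trans _ lt).
apply: (PS j (Ordinal kn)) => //.
  by rewrite /= -ltnS prednK // (leq_ltn_trans _ lt).
apply: IH; first by rewrite /= -subn1 subnAC jm subn1.
by rewrite /= -ltnS prednK // (leq_ltn_trans _ lt).
Qed.

Lemma pmap_comp X (h i j : 'I_n) x : (h <= i <= j)%N ->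
  pmap X i h (pmap X j i x) = pmap X j h x.
Proof.
move=> /andP[hi ij]; move: j ij x; apply: ord_le_ind => [x|j k e ik IH x].
  by rewrite pmap_id.
by rewrite !(pmap_step e) ?IH // (leq_trans hi).
Qed.

Lemma pmap_hom X Y (f : mor_hom X Y) i j x :
  f i (pmap X j i x) = pmap Y j i (f j x).
Proof.
have [ij|ji] := leqP i j; last by rewrite !pmap_gt // linear0.
move: j ij x; apply: ord_le_ind => [x|j k e ik IH x]; first by rewrite !pmap_id.
by rewrite !(pmap_step e) // IH hom_comm.
Qed.

End Composites.

(** * Subobjects, quotients and products of representations *)

Section Objects.
Variables (R : comNzRingType) (A : nzRingType) (al : central_alg R A) (n : nat).
Hypothesis flR : fin_len R^o.
Local Notation obj := (mor_obj A n).
Implicit Types X Y Z : obj.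

Definition mkhom X Y (f : forall i, X i -> Y i) (fl : forall i, linear (f i))
   (fc : forall (i j : 'I_n) (e : j = i.+1 :> nat) (x : X j),
      f i (mor_map X e x) = mor_map Y e (f j x)) : mor_hom X Y :=
  @MorHom A n X Y (fun i => mklin (fl i)) fc.

Definition inj_hom X Y (f : mor_hom X Y) := forall i, injective (f i).
Definition surj_hom X Y (f : mor_hom X Y) := forall i y, exists x, f i x = y.

Section SubQuot.
Variables (X : obj) (U : forall i, set (X i)).
Arguments U : clear implicits.
Hypothesis sU : forall i, submod (U i).
Hypothesis stU : forall (i j : 'I_n) (e : j = i.+1 :> nat) x,
  U j x -> U i (mor_map X e x).

(** The subobject is known only through an injective morphism and its image; with [lift_mono] this
    treats kernels, images and pullbacks alike. *)
Lemma subobj_exists : exists (S : obj) (io : mor_hom S X),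
  inj_hom io /\ forall i x, U i x <-> exists s, io i s = x.
Proof.
have ex (i j : 'I_n) (e : j = i.+1 :> nat) (x : subm (sU j)) :
    exists y : subm (sU i), subi (sU i) y = mor_map X e (subi (sU j) x).
  by apply: subi_im; apply: stU; apply: subiP.
have [f hf] : exists f : forall (i j : 'I_n) (e : j = i.+1 :> nat), subm (sU j) -> subm (sU i),
    forall i j e x, subi (sU i) (f i j e x) = mor_map X e (subi (sU j) x).
  by exists (fun i j e x => sval (cid (ex i j e x))) => i j e x; case: cid.
have fP i j e : linear (f i j e).
  by move=> a x y; apply: (@subi_inj _ _ _ (sU i)); rewrite lin_comb /= !hf !lin_comb.
have fg i : fin_gen (subm (sU i)).
  exact: (fin_gen_inj al flR (@subi_inj _ _ _ (sU i)) (@mor_fin_gen A n X i)).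
pose S := @MorObj A n (fun i => subm (sU i)) (fun i j e => mklin (fP i j e)) fg.
exists S, (@mkhom S X (fun i => subi (sU i)) (fun i => linearP (subi (sU i))) hf).
split=> [i|i x]; first exact: subi_inj.
by split=> [/(subi_im (sU i))//|[s <-]]; apply: subiP.
Qed.

Lemma quotobj_exists : exists (Q : obj) (pi : mor_hom X Q),
  surj_hom pi /\ forall i x, pi i x = 0 <-> U i x.
Proof.
pose f (i j : 'I_n) (e : j = i.+1 :> nat) (q : quotm (sU j)) := qpi (sU i) (mor_map X e (val q)).
have fE (i j : 'I_n) (e : j = i.+1 :> nat) x : f i j e (qpi (sU j) x) = qpi (sU i) (mor_map X e x).
  apply: qpi_eq.
  by rewrite -linearB; apply: stU; apply: qrepP.
have fP (i j : 'I_n) (e : j = i.+1 :> nat) : linear (f i j e).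
  move=> a x y; have [{}x <-] := qpi_surj x; have [{}y <-] := qpi_surj y.
  by rewrite -lin_comb !fE !lin_comb.
have fg i : fin_gen (quotm (sU i)).
  exact: (fin_gen_surj (@qpi_surj _ _ _ (sU i)) (@mor_fin_gen A n X i)).
pose Q := @MorObj A n (fun i => quotm (sU i)) (fun i j e => mklin (fP i j e)) fg.
exists Q, (@mkhom X Q (fun i => qpi (sU i)) (fun i => linearP (qpi (sU i))) (fun i j e x => esym (fE i j e x))).
split=> [i y|i x]; first exact: qpi_surj.
exact: qpi0.
Qed.
End SubQuot.

Section Product.
Variables X Y : obj.
Definition prod_map (i j : 'I_n) (e : j = i.+1 :> nat) (p : X j * Y j) : X i * Y i :=
  (mor_map X e p.1, mor_map Y e p.2).
Fact prod_map_linear i j e : linear (@prod_map i j e).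
Proof. by move=> a x y; apply/pair_equal_spec; rewrite !lin_comb. Qed.
Definition prod_obj : obj := @MorObj A n (fun i => (X i * Y i)%type)
  (fun i j e => mklin (@prod_map_linear i j e))
  (fun i => fin_gen_prod (@mor_fin_gen A n X i) (@mor_fin_gen A n Y i)).
Definition prod_fst : mor_hom prod_obj X :=
  @mkhom prod_obj X (fun i p => p.1) (fun i a x y => erefl) (fun i j e x => erefl).
Definition prod_snd : mor_hom prod_obj Y :=
  @mkhom prod_obj Y (fun i p => p.2) (fun i a x y => erefl) (fun i j e x => erefl).
Definition prod_inl : mor_hom X prod_obj.
Proof.
refine (@mkhom X prod_obj (fun i x => (x, 0)) _ _).
  by move=> i a x y; apply/pair_equal_spec; rewrite /= scaler0 addr0.
by move=> i j e x; apply/pair_equal_spec; rewrite /= linear0.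
Defined.
Definition prod_inr : mor_hom Y prod_obj.
Proof.
refine (@mkhom Y prod_obj (fun i x => (0, x)) _ _).
  by move=> i a x y; apply/pair_equal_spec; rewrite /= scaler0 addr0.
by move=> i j e x; apply/pair_equal_spec; rewrite /= linear0.
Defined.
End Product.

Definition hom_zero X Y : mor_hom X Y.
Proof.
refine (@mkhom X Y (fun i x => 0) _ _).
  by move=> i a x y; rewrite scaler0 addr0.
by move=> i j e x; rewrite linear0.
Defined.

Definition hom_lin X Y (r : R) (f g : mor_hom X Y) : mor_hom X Y.
Proof.
refine (@mkhom X Y (fun i x => rho al r *: f i x + g i x) _ _).
  move=> i a x y; rewrite !lin_comb !scalerDr !scalerA rho_central.
  by rewrite addrACA.
by move=> i j e x; rewrite lin_comb !hom_comm.
Defined.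

Definition hom_sub X Y (f g : mor_hom X Y) : mor_hom X Y.
Proof.
refine (@mkhom X Y (fun i x => f i x - g i x) _ _).
  by move=> i a x y; rewrite !lin_comb addrACA scalerDr.
by move=> i j e x; rewrite linearB !hom_comm.
Defined.

Lemma lift_mono T X Y (f : mor_hom X Y) (t : mor_hom T Y) : inj_hom f ->
  (forall i z, exists x, f i x = t i z) ->
  exists s : mor_hom T X, forall i z, f i (s i z) = t i z.
Proof.
move=> fi ex; pose s i z := sval (cid (ex i z)).
have hs i z : f i (s i z) = t i z by rewrite /s; case: cid.
have sl i : linear (s i) by move=> a x y; apply: (fi i); rewrite lin_comb !hs lin_comb.
exists (@mkhom T X s sl
  (fun i j e x => fi i _ _ (etrans (hs i _) (etrans (hom_comm t e x)
    (etrans (congr1 (mor_map Y e) (esym (hs j x))) (esym (hom_comm f e _))))))).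
exact: hs.
Qed.

Lemma factor_epi T Y Z (g : mor_hom Y Z) (u : mor_hom Y T) : surj_hom g ->
  (forall i y, g i y = 0 -> u i y = 0) ->
  exists s : mor_hom Z T, forall i y, s i (g i y) = u i y.
Proof.
move=> gs gu; pose s i z := u i (sval (cid (gs i z))).
have hs i y : s i (g i y) = u i y.
  rewrite /s; case: cid => y' /= gy; apply/eqP; rewrite -subr_eq0 -linearB.
  by apply/eqP/gu; rewrite linearB gy subrr.
have sl i : linear (s i).
  move=> a x y; have [x' <-] := gs i x; have [y' <-] := gs i y.
  by rewrite -lin_comb !hs lin_comb.
have sc (i j : 'I_n) (e : j = i.+1 :> nat) z : s i (mor_map Z e z) = mor_map T e (s j z).
  by have [z' <-] := gs j z; rewrite -hom_comm !hs hom_comm.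
by exists (@mkhom Z T s sl sc).
Qed.

Lemma bij_iso X Y (f : mor_hom X Y) : inj_hom f -> surj_hom f -> hom_iso f.
Proof.
move=> fi fs; have [g hg] := lift_mono (t := hom_id Y) fi fs.
by exists g; split=> i x /=; [apply: (fi i); rewrite hg|rewrite hg].
Qed.

Lemma iso_inj X Y (f : mor_hom X Y) : hom_iso f -> inj_hom f.
Proof. by move=> [g [gf _]] i x y /(congr1 (g i)); rewrite [LHS]gf [RHS]gf. Qed.

Lemma obj_fin_len X i : fin_len (res al (X i)).
Proof. exact/(fin_gen_len al flR)/mor_fin_gen. Qed.

Lemma endo_inj_surj X (f : mor_hom X X) : inj_hom f -> surj_hom f.
Proof.
move=> fi i y.
exact: (fin_len_inj_surj (f := res_lin al (f i)) (obj_fin_len X i) (@fi i) y).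
Qed.

End Objects.

Arguments iso_inj {A n X Y f} _ i [x1 x2] _.

Section Iterates.
Variables (R : comNzRingType) (M : lmodType R) (f : {linear M -> M}).

Lemma iter_linear k : linear (iter k f).
Proof. by elim: k => [|k IH] a x y //=; rewrite IH lin_comb. Qed.

(** The kernels of the iterates ascend, so finite length forces two consecutive ones to agree, and
    from there on they are constant. *)
Lemma ker_stable : fin_len M ->
  exists k, forall m x, iter m f x = 0 -> iter k f x = 0.
Proof.
move=> [n hn]; pose K m : set M := [set x | iter m f x = 0].
have sK m : submod (K m) := submod_ker (mklin (@iter_linear m)).
have KS m : K m `<=` K m.+1.
  by move=> x mx; change (f (iter m f x) = 0); rewrite (mx : iter m f x = 0) linear0.
have [k Kk] : exists k, K k.+1 `<=` K k.
  have : flen n (K 0%N) setT by apply: flen_lower hn => _ ->.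
  elim: n {hn} 0%N => [|n IH] m h; first by exists m; exact: (h (K m.+1) (sK _) (KS _) (@subsetT _ _)).
  have [?|nK] := pselect (K m.+1 `<=` K m); first by exists m.
  by apply: (IH m.+1); exact: (h (K m.+1) (sK _) (KS _) (@subsetT _ _) nK).
exists k => m x; have [mk|km] := leqP m k.
  by move=> mx; rewrite -(subnK mk) iterD mx; elim: (k - m)%N => //= ? ->; rewrite linear0.
rewrite -(subnK (ltnW km)); elim: (m - k)%N x => // d IH x.
move=> h; apply: IH; rewrite addnC iterD; apply: (Kk (iter d f x)).
by change (iter k.+1 f (iter d f x) = 0); rewrite -iterD addSnnS addnC.
Qed.

Lemma fin_len_surj_inj : fin_len M -> (forall y, exists x, f x = y) -> injective f.
Proof.
move=> /ker_stable[k hk] fs; apply: ker0_inj => x fx.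
have [y yx] : exists y, iter k f y = x.
  by elim: k {hk} x {fx} => [|k IH] x; [exists x|have [z <-] := fs x; have [y <-] := IH z; exists y].
by rewrite -yx; apply: (hk k.+1); rewrite /= yx.
Qed.

End Iterates.

(** * Fitting's lemma, local endomorphism rings and minimal maps *)

Section KrullSchmidt.
Variables (R : comNzRingType) (A : nzRingType) (al : central_alg R A) (n : nat).
Hypothesis flR : fin_len R^o.
Local Notation obj := (mor_obj A n).
Implicit Types X Y Z : obj.

Fixpoint hpow X (f : mor_hom X X) k : mor_hom X X :=
  if k is k'.+1 then hom_comp f (hpow f k') else hom_id X.

Lemma hpowE X (f : mor_hom X X) k i x : hpow f k i x = iter k (f i) x.
Proof. by elim: k => //= k ->. Qed.

Lemma iter_eq0 X (f : mor_hom X X) i x k m :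
  (k <= m)%N -> iter k (f i) x = 0 -> iter m (f i) x = 0.
Proof.
by move=> /subnK <- h; rewrite iterD h; elim: (m - k)%N => //= ? ->; rewrite linear0.
Qed.

Lemma hpow_stable X (f : mor_hom X X) :
  exists k, forall i x m, iter m (f i) x = 0 -> iter k (f i) x = 0.
Proof.
have ex i : exists k, forall m x, iter m (f i) x = 0 -> iter k (f i) x = 0.
  exact: (ker_stable (res_lin al (f i)) (obj_fin_len al flR X i)).
(* The sum dominates the stable exponent of every level. *)
have [k hk] := choice ex; exists (\sum_i k i)%N => i x m /hk.
by apply: iter_eq0; rewrite (bigD1 i) //= leq_addr.
Qed.

(** For a stable power [g] of [f], the object is the direct sum of the kernel and the image of [g].
    If the kernel vanishes, [f] is an isomorphism; if the image does, [f] is nilpotent. *)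
Lemma fitting X (f : mor_hom X X) : indecomposable X ->
  hom_iso f \/ exists k, forall i x, iter k (f i) x = 0.
Proof.
move=> [_ indX]; have [k hk] := hpow_stable f; pose g := hpow f k.
have gg i x : g i (g i x) = 0 -> g i x = 0.
  by rewrite !hpowE -iterD => /hk.
have [I [io [ioi hI]]] := @subobj_exists _ _ al _ flR X (fun i => range (g i))
  (fun i => submod_img (g i) (submodT _)) (fun i j e x '(ex_intro2 y _ yx) =>
    ex_intro2 _ _ (mor_map X e y) Logic.I
     (etrans (hom_comm g e y) (congr1 (mor_map X e) yx))).
have [K [ka [kai hK]]] := @subobj_exists _ _ al _ flR X (fun i => [set x | g i x = 0])
  (fun i => submod_ker (g i)) (fun i j e x gx =>
     etrans (hom_comm g e x) (etrans (congr1 (mor_map X e) gx) (linear0 _))).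
(* [e] is the restriction of [g] to its image. It is injective by stability, hence invertible, and
   its inverse after [g] projects [X] onto [I]. *)
have [e he] : exists e : mor_hom I I, forall i z, io i (e i z) = (hom_comp g io) i z.
  by apply: lift_mono => // i z; apply/hI; exists (io i z).
have [g' hg'] : exists g' : mor_hom X I, forall i z, io i (g' i z) = g i z.
  by apply: lift_mono => // i z; apply/hI; exists z.
have ei : inj_hom e.
  move=> i; apply: ker0_inj => s es; apply: (inj_ker0 (ioi i)).
  have [x _ xE] : range (g i) (io i s) by apply/hI; exists s.
  rewrite -xE; apply: gg; rewrite xE.
  by have := he i s; rewrite es linear0.
have [e' [e'e ee']] := bij_iso ei (endo_inj_surj al flR ei).
pose pI := hom_comp e' g'.
have epI i x : e i (pI i x) = g' i x by exact: ee'.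
have pIio i s : pI i (io i s) = s.
  by apply: (ei i); rewrite epI; apply: (ioi i); rewrite hg' he.
have gpI i x : g i (io i (pI i x)) = g i x.
  by rewrite -(hg' i x) -epI he.
pose q := hom_sub (hom_id X) (hom_comp io pI).
have qE i x : q i x = x - io i (pI i x) by [].
have [pK hpK] : exists pK : mor_hom X K, forall i z, ka i (pK i z) = q i z.
  by apply: lift_mono => // i z; apply/hK; change (g i (q i z) = 0); rewrite qE linearB gpI subrr.
have gka i s : g i (ka i s) = 0 by apply: (hK i (ka i s)).2; exists s.
have pIka i s : pI i (ka i s) = 0.
  by rewrite /pI /=; have -> : g' i (ka i s) = 0; [apply: (ioi i); rewrite hg' gka linear0|rewrite linear0].
have dsum : is_direct_sum X K I.
  exists ka, pK, io, pI; split.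
  - by move=> i s; apply: (kai i); rewrite [LHS]hpK qE pIka linear0 subr0.
  - exact: pIio.
  - by move=> i s; apply: (kai i); rewrite hpK qE pIio subrr linear0.
  - exact: pIka.
  - by move=> i x; rewrite hpK qE subrK.
have [K0|I0] := indX _ _ dsum; [left|right].
  have fi : inj_hom f.
    move=> i; apply: ker0_inj => x fx.
    have [s <-] : exists s, ka i s = x.
      by apply/hK; rewrite /= hpowE; apply: (hk i x 1%N).
    by rewrite (K0 i s) linear0.
  exact: bij_iso fi (endo_inj_surj al flR fi).
by exists k => i x; rewrite -hpowE -hg' (I0 i (g' i x)) linear0.
Qed.

(** The endomorphism ring is local. If [d] inverts [r f + g], then [d r f + d g = 1], and by Fitting
    [d r f] is invertible or nilpotent. In the first case [f] is injective. In the second, [d r f]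
    fixes the kernel of [g], which is therefore zero. *)
Lemma noniso_lin X r (f g : mor_hom X X) : indecomposable X ->
  ~ hom_iso f -> ~ hom_iso g -> ~ hom_iso (hom_lin al r f g).
Proof.
move=> indX nf ng ic; have ci := iso_inj ic; have [d [dc _]] := ic.
have mkiso (h : mor_hom X X) : inj_hom h -> hom_iso h.
  by move=> hi; apply: bij_iso hi (endo_inj_surj al flR hi).
pose f' := hom_comp d (hom_lin al r f (hom_zero X X)).
have fgE i x : f' i x + d i (g i x) = x.
  by rewrite /f' /= -linearD addr0; apply: dc.
have [if'|[k f'0]] := fitting f' indX.
  apply/nf/mkiso => i; apply: ker0_inj => x fx; apply: (inj_ker0 (iso_inj if' i)).
  by rewrite /f' /= fx scaler0 addr0 linear0.
apply/ng/mkiso => i; apply: ker0_inj => x gx.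
have fx : f' i x = x by rewrite -[RHS](fgE i) gx linear0 addr0.
by rewrite -(f'0 i x); elim: k {f'0} => //= k <-.
Qed.

Lemma split_epi_comp X W (u : mor_hom W X) (h : mor_hom X W) :
  hom_iso (hom_comp u h) -> split_epi u.
Proof. by move=> [s [_ us]]; exists (hom_comp h s) => i x; apply: us. Qed.

Definition len_le X N := exists l : 'I_n -> nat,
  (forall i, fl (l i) (res al (X i))) /\ (\sum_i l i <= N)%N.

Lemma len_exists X : exists N, len_le X N.
Proof.
have [l hl] := choice (obj_fin_len al flR X).
by exists (\sum_i l i)%N, l.
Qed.

Lemma len_sub X Y (io : mor_hom X Y) N : inj_hom io -> len_le Y N ->
  ~ surj_hom io -> exists2 N', (N' < N)%N & len_le X N'.
Proof.
move=> ioi [l [hl lN]] /existsNP[i0 /existsNP[y ny]].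
have h i : fl (l i) (res al (X i)).
  exact: (flen_inj (f := res_lin al (io i)) (@ioi i) _ _ (hl i)).
have [l0 h0] : (0 < l i0)%N /\ fl (l i0).-1 (res al (X i0)).
  have := hl i0; set f := res_lin al (io i0).
  have nT : ~ (setT `<=` range f) by move=> /(_ y I)[x _ fx]; apply: ny; exists x.
  have s0 : [set 0] `<=` range f by move=> _ ->; exists 0; rewrite ?linear0.
  have sY := submodT (res al (Y i0)).
  case: (l i0) => [|m] hm; first by case: (flen_strict0 sY s0 _ nT hm).
  split=> //; apply: (flen_inj (f := f) (@ioi i0) _ _ (flen_strict sY s0 _ nT hm)) => //.
exists (\sum_i (if i == i0 then (l i0).-1 else l i))%N.
  apply: leq_trans lN; rewrite (bigD1 i0) //= [in X in (_ < X)%N](bigD1 i0) //= eqxx.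
  rewrite -(ltn_predK l0) ltnS /= leq_add2l; apply: leq_sum => i /negPf ->; by [].
exists (fun i => if i == i0 then (l i0).-1 else l i); split=> // i.
by case: eqP => [->|_].
Qed.

(** A right almost split map with source of least total length is right minimal: if [g h = g], then
    [g] restricted to the image of [h] is again right almost split, so [h] is onto and hence
    bijective. *)
Lemma sink_of_right_almost_split (C : obj -> Prop) Y Z (g : mor_hom Y Z) :
  (forall X W (io : mor_hom X W), inj_hom io -> C W -> C X) ->
  C Y -> C Z -> right_almost_split C g ->
  exists Y' (g' : mor_hom Y' Z), sink_map C g'.
Proof.
move=> Csub CY CZ hg.
have ex : exists N, `[< exists Y (g : mor_hom Y Z),
    [/\ C Y, right_almost_split C g & len_le Y N] >].
  by have [N hN] := len_exists Y; exists N; apply/asboolP; exists Y, g.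
case: (ex_minnP ex) => N /asboolP[{}Y [{hg}g [{}CY [ng hg] lY]]] Nmin.
exists Y, g; split=> // h gh.
have [I [io [ioi hI]]] := @subobj_exists _ _ al _ flR Y (fun i => range (h i))
  (fun i => submod_img (h i) (submodT _)) (fun i j e x '(ex_intro2 y _ yx) =>
    ex_intro2 _ _ (mor_map Y e y) Logic.I
     (etrans (hom_comm h e y) (congr1 (mor_map Y e) yx))).
have [h' hh'] : exists h' : mor_hom Y I, forall i z, io i (h' i z) = h i z.
  by apply: lift_mono => // i z; apply/hI; exists z.
have ios : surj_hom io.
  apply: contrapT => nios; have [N' N'N lI] := len_sub ioi lY nios.
  suff /Nmin : `[< exists Y (g : mor_hom Y Z),
    [/\ C Y, right_almost_split C g & len_le Y N'] >] by rewrite leqNgt N'N.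
  apply/asboolP; exists I, (hom_comp g io); split=> //; first exact: Csub CY.
  split=> [[s hs]|W u CW nu].
    by apply: ng; exists (hom_comp io s) => i x; apply: (hs i).
  have [v gv] := hg W u CW nu; exists (hom_comp h' v) => i w.
  by rewrite /= hh' -[RHS]gv; apply: (gh i).
have hs : surj_hom h.
  by move=> i y; have [s <-] := ios i y; have [|x _ <-] := (hI i (io i s)).2; [exists s|exists x].
apply: (bij_iso _ hs) => i.
exact: (fin_len_surj_inj (f := res_lin al (h i)) (obj_fin_len al flR Y i) (hs i)).
Qed.

Lemma split_mono_epi X Y Z (f : mor_hom X Y) (g : mor_hom Y Z) :
  short_exact f g -> split_mono f -> split_epi g.
Proof.
move=> ses [s sf]; pose q := hom_sub (hom_id Y) (hom_comp f s).
have gs : surj_hom g by move=> i; have [] := ses i.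
have gf i x : g i (f i x) = 0 by have [_ _ h] := ses i; apply/h; exists x.
have [|t ht] := @factor_epi _ _ _ _ _ g q gs.
  move=> i y gy; have [_ _ /(_ y)[/(_ gy)[x <-] _]] := ses i.
  by rewrite /q /= [s i _]sf subrr.
exists t => i z; have [y <-] := gs i z.
by rewrite /= ht /q /= linearB gf subr0.
Qed.

End KrullSchmidt.

(** * Almost split sequences of monomorphism representations from sink maps *)

Section MonoAR.
Variables (R : comNzRingType) (A : nzRingType) (al : central_alg R A) (n : nat).
Hypothesis flR : fin_len R^o.
Local Notation obj := (mor_obj A n).
Local Notation C := (@mono_cat A n).
Implicit Types X Y Z : obj.

Lemma mono_sub X Y (io : mor_hom X Y) : inj_hom io -> C Y -> C X.
Proof.
move=> ioi CY i j e x y exy; apply: (ioi j); apply: (CY i j e).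
by rewrite -!hom_comm exy.
Qed.

Lemma mono_prod X Y : C X -> C Y -> C (prod_obj X Y).
Proof.
move=> CX CY i j e [x y] [x' y'] /= [hx hy].
by rewrite (CX _ _ _ _ _ hx) (CY _ _ _ _ _ hy).
Qed.

(** The sequence is the kernel of the sink map. What must be shown is that [g] is onto, which uses
    non-projectivity, and that the kernel inclusion is a source map. *)
Lemma AR_sequence_end Z Y (g : mor_hom Y Z) : C Z -> indecomposable Z ->
  ~ exact_projective C Z -> sink_map C g ->
  exists X Y (f : mor_hom X Y) (g : mor_hom Y Z), AR_sequence C f g.
Proof.
move=> CZ indZ nproj sg; have [CY _ [ng hg] gmin] := sg.
have gs : surj_hom g.
  (* The pullback [p] of the deflation [g'] along [u] is onto. If it did not split, it would factor
     through [g] and make [g] onto; so it splits, and a section lifts [u]. *)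
  apply: contrapT => ngs; apply: nproj => X' Y' Z' f' g' [CX' CY' CZ' ses] u.
  pose d := hom_sub (hom_comp g' (prod_fst Y' Z)) (hom_comp u (prod_snd Y' Z)).
  have [P [io [ioi hP]]] := @subobj_exists _ _ al _ flR (prod_obj Y' Z)
    (fun i => [set x | d i x = 0])
    (fun i => submod_ker (d i)) (fun i j e x gx =>
     etrans (hom_comm d e x) (etrans (congr1 (mor_map Z' e) gx) (linear0 _))).
  pose p := hom_comp (prod_snd Y' Z) io.
  have dio i s : g' i (io i s).1 = u i (io i s).2.
    have /eqP : d i (io i s) = 0 by apply: (hP i _).2; exists s.
    by rewrite subr_eq0 => /eqP.
  have ps : surj_hom p.
    move=> i z; have [_ /(_ (u i z))[y yz] _] := ses i.
    have [s hs] : exists s, io i s = (y, z) by apply/hP; rewrite /= yz subrr.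
    by exists s; rewrite /p /= hs.
  have CP : C P by apply: (mono_sub ioi); apply: mono_prod.
  have [[s hs]|/(hg P p CP)[v gv]] := pselect (split_epi p).
    exists (hom_comp (prod_fst Y' Z) (hom_comp io s)) => i z.
    by rewrite /= dio [X in u i X]hs.
  case: ngs => i z; have [x <-] := ps i z; exists (v i x); exact: gv.
have [X [f [fi hf]]] := @subobj_exists _ _ al _ flR Y (fun i => [set x | g i x = 0])
  (fun i => submod_ker (g i)) (fun i j e x gx =>
     etrans (hom_comm g e x) (etrans (congr1 (mor_map Z e) gx) (linear0 _))).
have CX : C X by apply: mono_sub fi CY.
have ses : short_exact f g.
  by move=> i; split; [exact: fi|exact: gs|move=> y; apply: hf].
have gf i x : g i (f i x) = 0 by apply: (hf i _).2; exists x.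
have nf : ~ split_mono f by move=> /(split_mono_epi ses).
exists X, Y, f, g; split=> //; split=> //; last first.
  (* Left minimality: [h] induces [h'] on the indecomposable [Z]. If [h'] is invertible, so is [h].
     If it is nilpotent, some power of [h] maps into the kernel of [g] and fixes [X], which splits
     [f]. *)
  move=> h hfE; have [|h' hh'] := @factor_epi _ _ _ _ _ g (hom_comp g h) gs.
    move=> i y /(hf i)[x <-]; have /= := hfE i x; rewrite /= => ->; exact: gf.
  have [ih'|[k h'0]] := fitting al flR h' indZ.
    have hi : inj_hom h.
      move=> i; apply: ker0_inj => y hy.
      have gy : g i y = 0.
        by apply: (inj_ker0 (iso_inj ih' i)); rewrite hh' /= hy linear0.
      by have [x xy] := (hf i y).1 gy; subst y; rewrite -[LHS](hfE i).
    exact: bij_iso hi (endo_inj_surj al flR hi).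
  have hk i y : g i (iter k (h i) y) = 0.
    by rewrite -(h'0 i (g i y)); elim: k {h'0} => //= k <-; rewrite hh'.
  have [s hs] : exists s : mor_hom Y X, forall i y, f i (s i y) = hpow h k i y.
    by apply: lift_mono => // i y; apply/hf; change (g i (hpow h k i y) = 0); rewrite hpowE.
  case: nf; exists s => i x; apply: (fi i); rewrite [LHS]hs hpowE /=.
  by elim: k {h'0 hk s hs} => //= k ->; apply: (hfE i).
split=> // W u CW nu.
(* Left almost splitness: [Q] is the pushout of [f] and [u], an extension of [Z] by [W]. *)
pose r : mor_hom X (prod_obj Y W) :=
  hom_sub (hom_comp (prod_inl Y W) f) (hom_comp (prod_inr Y W) u).
have rE i x : r i x = (f i x, - u i x).
  by apply/pair_equal_spec; rewrite /= subr0 sub0r.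
have [Q [pi [pis hQ]]] := @quotobj_exists _ _ (prod_obj Y W)
  (fun i => range (r i))
  (fun i => submod_img (r i) (submodT _)) (fun i j e x '(ex_intro2 y _ yx) =>
    ex_intro2 _ _ (mor_map X e y) Logic.I
     (etrans (hom_comm r e y) (congr1 (mor_map _ e) yx))).
have piE i y w : pi i (y, w) = 0 -> exists x, y = f i x /\ w = - u i x.
  by move=> /hQ[x _]; rewrite rE => -[<- <-]; exists x.
have pir i x : pi i (f i x, 0) = pi i (0, u i x).
  apply/eqP; rewrite -subr_eq0 -linearB; apply/eqP/hQ; exists x => //.
(* An extension of monomorphism representations is one: an element of the kernel lies over [0] in
   [Z], as [Z] has injective maps, and then vanishes because [W] does. *)
have CQ : C Q.
  move=> i j e; apply: ker0_inj => a; have [[y w] <-] := pis j a.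
  rewrite -hom_comm /= => /piE[x [yx wx]].
  have [x' yx'] : exists x', f j x' = y.
    apply/hf/(CZ i j e); rewrite /= -hom_comm yx linear0; exact: gf.
  have xx' : x = mor_map X e x' by apply: (fi i); rewrite hom_comm yx' yx.
  apply/hQ; exists x' => //; rewrite rE yx'; congr pair.
  by apply: (CW i j e); rewrite linearN -hom_comm -xx' -wx.
have [q hq] : exists q : mor_hom Q Z, forall i a, q i (pi i a) =
    (hom_comp g (prod_fst Y W)) i a.
  apply: factor_epi => // i [y w] /piE[x [-> _]]; exact: gf.
pose iY := hom_comp pi (prod_inl Y W).
pose iW := hom_comp pi (prod_inr Y W).
have qY i y : q i (iY i y) = g i y by rewrite /iY /= hq.
have qW i w : q i (iW i w) = 0 by rewrite /iW /= hq /= linear0.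
have iWi : inj_hom iW.
  move=> i; apply: ker0_inj => w /piE[x [/esym fx ->]].
  by rewrite (inj_ker0 (fi i) fx) linear0 oppr0.
have kerq i a : q i a = 0 -> exists w, iW i w = a.
  have [[y w] <-] := pis i a; rewrite hq /= => /(hf i)[x <-].
  exists (u i x + w).
  have -> : (f i x, w) = (f i x, 0) + (0, w) :> (Y i * W i)%type.
    by apply/pair_equal_spec; rewrite /= addr0 add0r.
  rewrite (linearD (pi i)) pir -(linearD (pi i)); congr (pi i _).
  by apply/pair_equal_spec; rewrite /= addr0.
have fuE i x : iY i (f i x) = iW i (u i x) by exact: pir.
(* If [q] splits, the complementary projection onto [W] restricts to [Y] as an extension of [u]
   along [f]. *)
have [[s qs]|nq] := pselect (split_epi q).
  pose d := hom_sub iY (hom_comp s g).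
  have [v hv] : exists v : mor_hom Y W, forall i y, iW i (v i y) = d i y.
    apply: lift_mono => // i y; apply: kerq.
    by rewrite /d /= linearB qY [q i (s i _)]qs subrr.
  exists v => i x; apply: (iWi i); rewrite [LHS]hv.
  have -> : d i (f i x) = iY i (f i x) - s i (g i (f i x)) by [].
  by rewrite gf linear0 subr0 fuE.
(* Otherwise [q] factors through [g], and minimality of [g] makes the composite [Y -> Q -> Y]
   invertible. Following [W -> Q -> Y] by its inverse lands in the kernel of [g] and gives a
   retraction of [u], which was excluded. *)
have [v gv] := hg Q q CQ nq.
pose h := hom_comp v iY.
have [h' [h'h hh']] : hom_iso h by apply: gmin => i y; rewrite [LHS]gv; apply: qY.
have gh' i y : g i (h' i y) = g i y.
  have {2}-> : y = h i (h' i y) by rewrite [RHS]hh'.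
  by rewrite /h /= [RHS]gv qY.
have [t ht] : exists t : mor_hom W X, forall i w, f i (t i w) =
    (hom_comp h' (hom_comp v iW)) i w.
  apply: lift_mono => // i w; apply/hf; rewrite /= gh' [LHS]gv; exact: qW.
case: nu; exists t => i x; apply: (fi i).
rewrite [LHS]ht /= -[pi i _]fuE; exact: h'h.
Qed.

End MonoAR.

(** * Right almost split maps *)

Section DependentProduct.
Variables (R : nzRingType) (T : finType) (V : T -> lmodType R).

Definition dprod : Type := forall t, V t.
HB.instance Definition _ := Choice.on dprod.

Lemma dprod_ext (f g : dprod) : (forall t, f t = g t) -> f = g.
Proof. by move=> h; apply: functional_extensionality_dep. Qed.

Definition dp_add (f g : dprod) : dprod := fun t => f t + g t.
Definition dp_opp (f : dprod) : dprod := fun t => - f t.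
Definition dp_scale r (f : dprod) : dprod := fun t => r *: f t.

Fact dp_addA : associative dp_add.
Proof. by move=> f g h; apply: dprod_ext => t; rewrite /dp_add addrA. Qed.
Fact dp_addC : commutative dp_add.
Proof. by move=> f g; apply: dprod_ext => t; rewrite /dp_add addrC. Qed.
Fact dp_add0 : left_id ((fun t => 0) : dprod) dp_add.
Proof. by move=> f; apply: dprod_ext => t; rewrite /dp_add add0r. Qed.
Fact dp_addN : left_inverse ((fun t => 0) : dprod) dp_opp dp_add.
Proof. by move=> f; apply: dprod_ext => t; rewrite /dp_add addNr. Qed.
HB.instance Definition _ :=
  GRing.isZmodule.Build dprod dp_addA dp_addC dp_add0 dp_addN.

Fact dp_scaleA r s (f : dprod) : dp_scale r (dp_scale s f) = dp_scale (r * s) f.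
Proof. by apply: dprod_ext => t; rewrite /dp_scale scalerA. Qed.
Fact dp_scale1 : left_id 1 dp_scale.
Proof. by move=> f; apply: dprod_ext => t; rewrite /dp_scale scale1r. Qed.
Fact dp_scaleDr : right_distributive dp_scale +%R.
Proof. by move=> r f g; apply: dprod_ext => t; rewrite /dp_scale scalerDr. Qed.
Fact dp_scaleDl (f : dprod) : {morph dp_scale^~ f : r s / r + s}.
Proof. by move=> r s; apply: dprod_ext => t; rewrite /dp_scale scalerDl. Qed.
HB.instance Definition _ :=
  GRing.Zmodule_isLmodule.Build R dprod dp_scaleA dp_scale1 dp_scaleDr dp_scaleDl.

Lemma dprodE a (f g : dprod) t : (a *: f + g) t = a *: f t + g t.
Proof. by []. Qed.

Lemma dprod_sum (I : finType) (F : I -> dprod) t : (\sum_i F i) t = \sum_i F i t.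
Proof. by elim/big_rec2: _ => // i x y _ <-. Qed.

Definition dp_in t (x : V t) : dprod :=
  @dfwith T (fun s => V s) (fun s => 0 : V s) t x.

Lemma dp_in_linear t : linear (@dp_in t).
Proof.
move=> a x y; apply: dprod_ext => s; rewrite dprodE /dp_in.
have [ts|ts] := eqVneq t s; last by rewrite !dfwith_out // scaler0 addr0.
by subst s; rewrite !dfwith_in.
Qed.

Lemma dprod_decomp (f : dprod) : f = \sum_t dp_in (f t).
Proof.
apply: dprod_ext => t; rewrite dprod_sum (bigD1 t) //= /dp_in dfwith_in.
by rewrite big1 ?addr0 // => s st; rewrite dfwith_out.
Qed.

Lemma dprod_functional (E : lmodType R) (f : {linear dprod -> E}) :
  exists th : forall t, {linear V t -> E}, forall y : dprod, f y = \sum_t th t (y t).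
Proof.
exists (fun t => f \o mklin (@dp_in_linear t)) => y.
by rewrite {1}(dprod_decomp y) linear_sum.
Qed.
End DependentProduct.

Section RightAlmostSplit.
Variables (R : comNzRingType) (E : lmodType R).
Hypothesis flR : fin_len R^o.
Hypothesis ssE : simple_socle E.
Hypothesis Emax : socle_maximal E.
Variables (A B : nzRingType) (al : central_alg R A) (be : central_alg R B).
Variables (t : anti_iso al be) (n : nat).
Local Notation obj := (mor_obj A n).
Implicit Types W Z : obj.

Lemma gens_pad (M : lmodType A) (U : set M) k (e : 'I_k -> M) K : submod U ->
  (k <= K)%N -> (forall i, U (e i)) ->
  (forall x, U x -> exists c : 'I_k -> A, x = \sum_i c i *: e i) ->
  exists e' : 'I_K -> M, (forall i, U (e' i)) /\
    (forall x, U x -> exists c : 'I_K -> A, x = \sum_i c i *: e' i).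
Proof.
move=> sU kK Ue he.
exists (fun i => if insub (val i) is Some j then e j else 0); split=> [i|x /he[c ->]].
  by case: insubP => // _; case: sU.
exists (fun i => if insub (val i) is Some j then c j else 0).
pose F m := if insub m is Some j then c j *: e j else 0 : M.
rewrite (eq_bigr (fun i : 'I_k => F i)) => [|i _]; last by rewrite /F valK.
rewrite (big_ord_widen K F) // big_mkcond /=; apply: eq_bigr => i _.
rewrite /F; case: insubP => [j ij _|/negPf->]; last by rewrite scale0r.
by rewrite ij.
Qed.

(** One number of generators for all levels, so that generators and relations are indexed by product
    types; short lists are padded with zeros. *)
Lemma gens_family (I : finType) (M : I -> lmodType A) (U : forall i, set (M i)) :
  (forall i, submod (U i)) -> (forall i, fin_len (res al (M i))) ->
  exists K (e : forall i, 'I_K -> M i), (forall i k, U i (e i k)) /\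
    forall i x, U i x -> exists c : 'I_K -> A, x = \sum_k c k *: e i k.
Proof.
move=> sU fM.
have [k hk] := choice (fun i => fin_len_gens (sU i) (fM i)).
pose K := (\sum_i k i)%N.
have ex i : exists e : 'I_K -> M i, (forall k, U i (e k)) /\
    (forall x, U i x -> exists c : 'I_K -> A, x = \sum_k c k *: e k).
  have [e [Ue he]] := hk i; apply: (gens_pad (sU i) _ Ue he).
  by rewrite /K (bigD1 i) //= leq_addr.
exists K, (fun i => sval (cid (ex i))); split=> i; by case: cid => e [].
Qed.

Section Presentation.
Variable Z : obj.
Variables (K : nat) (e : forall i, 'I_K -> Z i).
Hypothesis he : forall i x, exists c : 'I_K -> A, x = \sum_k c k *: e i k.
Local Notation T := ('I_n * 'I_K)%type.

(** Level [i] of the map to [W] from the projective representation on generators sent to the [y t].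
    Generators below level [i] contribute [0], since [pmap] vanishes there, so all levels share one
    coefficient module. *)
Definition comb W (y : forall t : T, W t.1) i (c : T -> A) : W i :=
  \sum_t c t *: pmap W t.1 i (y t).

Definition gen (t : T) : Z t.1 := e t.1 t.2.

Lemma comb_linear W y i : linear (@comb W y i : (T -> A^o) -> W i).
Proof.
move=> a c d; rewrite /comb scaler_sumr -big_split /=; apply: eq_bigr => u _.
by rewrite scalerA -scalerDl.
Qed.

Definition level (j : 'I_n) (c : 'I_K -> A) (t : T) : A :=
  if t.1 == j then c t.2 else 0.

Lemma comb_level W y i j c :
  @comb W y i (level j c) = \sum_k c k *: pmap W j i (y (j, k)).
Proof.
transitivity (\sum_j' \sum_k level j c (j', k) *: pmap W j' i (y (j', k))).
  by rewrite pair_bigA /=; apply: eq_bigr => -[j' k] _.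
rewrite (bigD1 j) //= [X in _ + X]big1 ?addr0.
  by apply: eq_bigr => k _; rewrite /level /= eqxx.
by move=> j' /negPf j'j; rewrite big1 // => k _; rewrite /level /= j'j scale0r.
Qed.

Definition relations i : set (T -> A^o) := [set c | comb gen i c = 0].

Lemma hom_of_gens W (y : forall t : T, W t.1) :
  (forall i c, relations i c -> comb y i c = 0) ->
  exists h : mor_hom Z W, forall t, h t.1 (gen t) = y t.
Proof.
move=> hy.
have ex i x : exists c : 'I_K -> A, x = comb gen i (level i c).
  have [c ->] := he x; exists c; rewrite comb_level; apply: eq_bigr => k _.
  by rewrite pmap_id.
pose h i x := comb y i (level i (sval (cid (ex i x)))).
have hE i c : h i (comb gen i c) = comb y i c.
  rewrite /h; case: cid => d /= dE; apply/eqP; rewrite -subr_eq0; apply/eqP.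
  rewrite -[LHS](linearB (mklin (comb_linear y i)) (level i d) c); apply: hy.
  by rewrite /relations /mkset [LHS](linearB (mklin (comb_linear gen i))) /= -dE subrr.
have hl i : linear (h i).
  move=> a x x'; have [c ->] := ex i x; have [d ->] := ex i x'.
  by rewrite -[in LHS](lin_comb (mklin (comb_linear gen i))) /= !hE comb_linear.
have hc (i j : 'I_n) (ij : j = i.+1 :> nat) x : h i (mor_map Z ij x) = mor_map W ij (h j x).
  have [c ->] := ex j x; rewrite hE.
  have mapE (V : obj) (z : forall t : T, V t.1) : mor_map V ij (comb z j (level j c)) =
      comb z i (level j c).
    rewrite !comb_level linear_sum; apply: eq_bigr => k _.
    by rewrite linearZ_LR -pmap_map pmap_comp // ij leqnSn leqnn.
  by rewrite !mapE hE.
exists (mkhom hl hc) => -[i k]; rewrite /gen /=.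
have {1}-> : e i k = comb gen i (level i (fun m => (m == k)%:R)).
  rewrite comb_level (bigD1 k) //= eqxx scale1r pmap_id big1 ?addr0 // => m /negPf ->.
  by rewrite scale0r.
rewrite hE comb_level (bigD1 k) //= eqxx scale1r pmap_id big1 ?addr0 // => m /negPf ->.
by rewrite scale0r.
Qed.

Lemma hom_gens_eq W (h h' : mor_hom Z W) :
  (forall t, h t.1 (gen t) = h' t.1 (gen t)) -> hom_eq h h'.
Proof.
move=> hh i x; have [c ->] := he x; rewrite !linear_sum; apply: eq_bigr => k _.
by rewrite !linearZ_LR; congr (_ *: _); apply: (hh (i, k)).
Qed.

End Presentation.

Section Construction.
Variable Z : obj.
Hypothesis indZ : indecomposable Z.
Variables (K : nat) (e : forall i, 'I_K -> Z i).
Hypothesis he : forall i x, exists c : 'I_K -> A, x = \sum_k c k *: e i k.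
Local Notation T := ('I_n * 'I_K)%type.
Local Notation gen := (gen e).
Variables (L : nat) (r : forall i : 'I_n, 'I_L -> (T -> A^o)).
Hypothesis r_rel : forall i l, relations e i (r i l).
Hypothesis hr : forall i c, relations e i c -> exists a : 'I_L -> A, c = \sum_l a l *: r i l.
Local Notation P := ('I_n * 'I_L)%type.

Local Notation GW W := (dprod (fun u : T => res al (W u.1))).
Local Notation HW W := (dprod (fun p : P => res al (W p.1))).

(* [Hom(Z, -)] is the kernel of the natural map [GW -> HW]. *)
Definition rel_map W (y : GW W) : HW W := fun p => comb y p.1 (r p.1 p.2).

Lemma rel_linear W : linear (@rel_map W).
Proof.
move=> s x y; apply: dprod_ext => p; rewrite dprodE /rel_map /comb resE scaler_sumr.
rewrite -big_split /=; apply: eq_bigr => u _.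
rewrite dprodE resE lin_comb scalerDr !scalerA.
by rewrite -[_ * rho al s](rho_central al s).
Qed.

Lemma rel_hom W (y : GW W) : rel_map y = 0 ->
  exists h : mor_hom Z W, forall u : T, h u.1 (gen u) = y u.
Proof.
move=> ry; apply: hom_of_gens => // i c /hr[a ->].
rewrite -[LHS]/(mklin (comb_linear y i) (\sum_l a l *: r i l)).
rewrite linear_sum big1 // => l _; rewrite linearZ_LR.
have := congr1 (fun f : HW W => f (i, l)) ry; rewrite /rel_map /= => ->.
by rewrite scaler0.
Qed.

(** [ev] embeds the endomorphisms of [Z] into the values on generators. The non-isomorphisms form a
    submodule avoiding the identity, so a functional on all such values separates them; [ph] lists
    its components. *)
Lemma separating_functional : exists ph : forall u : T, {linear res al (Z u.1) -> E},
  \sum_u ph u (gen u) <> 0 /\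
  forall h : mor_hom Z Z, ~ hom_iso h -> \sum_u ph u (h u.1 (gen u)) = 0.
Proof.
pose ev (h : mor_hom Z Z) : GW Z := fun u => h u.1 (gen u).
pose U : set (GW Z) := [set y | exists2 h, ~ hom_iso h & y = ev h].
have sU : submod U.
  split.
    exists (hom_zero Z Z) => // i0; case: indZ => nz _; apply: nz => i x.
    by apply: (iso_inj i0).
  move=> s _ _ [h nh ->] [h' nh' ->]; exists (hom_lin al s h h').
    exact: (noniso_lin flR indZ nh nh').
  by apply: dprod_ext.
have nU : ~ U (ev (hom_id Z)).
  move=> [h nh hE]; apply: nh.
  have hi : hom_eq h (hom_id Z).
    apply: (hom_gens_eq he) => u; have := congr1 (fun f : GW Z => f u) hE; by [].
  apply: bij_iso => [i x y|i y]; first by rewrite !hi.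
  by exists y; rewrite hi.
have [ph [phU phv]] := separate flR ssE Emax sU nU.
have [th hth] := dprod_functional ph.
exists th; split; first by move: phv; rewrite hth.
move=> h nh; have : ph (ev h) = 0 by apply: phU; exists h.
by rewrite hth.
Qed.

Variable ph : forall u : T, {linear res al (Z u.1) -> E}.
Hypothesis ph1 : \sum_u ph u (gen u) <> 0.
Hypothesis ph0 : forall h : mor_hom Z Z, ~ hom_iso h -> \sum_u ph u (h u.1 (gen u)) = 0.

(** As no [u \o h] is an isomorphism, the functional [g] vanishes on [Hom(Z, W)], the kernel of
    [rel_map]. By injectivity of [E] it factors through [rel_map], and [th] lists the components of
    the factor. *)
Lemma lifting_functional W (u : mor_hom W Z) : ~ split_epi u ->
  exists th : forall p : P, {linear res al (W p.1) -> E},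
    forall (s : T) (w : W s.1), \sum_p th p (r p.1 p.2 s *: pmap W s.1 p.1 w) = ph s (u s.1 w).
Proof.
move=> nu.
pose g (y : GW W) : E := \sum_s ph s (u s.1 (y s)).
have gl : linear g.
  move=> a x y; rewrite /g scaler_sumr -big_split /=; apply: eq_bigr => s _.
  by rewrite dprodE resE lin_comb; apply: (lin_comb (ph s)).
have [y ry|f hf] := extend_factor ssE Emax (f := mklin (@rel_linear W)) (g := mklin gl).
  have [h hh] := rel_hom ry.
  rewrite /= /g -[RHS](ph0 (h := hom_comp u h)); last by move=> /split_epi_comp.
  by apply: eq_bigr => s _; rewrite -hh.
have [th hth] := dprod_functional f; exists th => s w.
pose y : GW W := dp_in (w : (fun u : T => res al (W u.1)) s).
have y0 s' : s != s' -> y s' = 0 by move=> ss'; rewrite /y /dp_in dfwith_out.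
have ys : y s = w by rewrite /y /dp_in dfwith_in.
have gE : g y = ph s (u s.1 w).
  rewrite /g (bigD1 s) //= ys big1 ?addr0 // => s' s's.
  by rewrite y0 1?eq_sym // !linear0.
have h : \sum_p th p (rel_map y p) = g y by rewrite -hth; apply: (hf y).
rewrite -gE -h; apply: eq_bigr => p _; rewrite /rel_map /comb (bigD1 s) //= ys.
by rewrite big1 ?addr0 // => s' s's; rewrite y0 1?eq_sym // linear0 scaler0.
Qed.

Local Notation DA := (dual E (anti_swap t) (B^o : lmodType B)).

Definition app (f : DA) (b : B) : E := homR_fun f (b : B^o).

Lemma appZ a (f : DA) b : app (a *: f) b = app f (sig t a * b).
Proof. by []. Qed.

Lemma appD (f g : DA) b : app (f + g) b = app f b + app g b.
Proof. exact: homR_funD. Qed.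

Lemma app0 b : app 0 b = 0.
Proof. exact: homR_fun0. Qed.

Lemma app_ext (f g : DA) : (forall b, app f b = app g b) -> f = g.
Proof. by move=> h; apply: (@homR_ext R (res be B^o) E f g) => b; apply: h. Qed.

Lemma app_rho s (f : DA) : app (rho al s *: f) 1 = s *: app f 1.
Proof.
rewrite appZ sig_rho /app -(linearZ_LR (homR_fun f)); congr (homR_fun f _).
Qed.

Section Orbit.
Variables (M : lmodType A) (th : {linear res al M -> E}) (w : M).
Lemma orbit_linear : linear (fun b : res be B^o => th (tau t b *: w)).
Proof.
move=> s b c; rewrite -(linearP th); congr (th _).
by rewrite !resE tauD tauM tau_rho scalerDl -rho_central scalerA.
Qed.
(** The correspondence between [R]-functionals on [M] and [A]-linear maps from [M] to the injective
    module [DA], evaluated at [w]. *)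
Definition orbit_functional : DA := homR_of (mklin orbit_linear).
Lemma orbit_functionalE b : app orbit_functional b = th (tau t b *: w).
Proof. by []. Qed.
End Orbit.

(** Together with the support condition in [total_set], component [p] lives on the levels from [p.1]
    upwards. It is the injective representation to which the Nakayama functor sends the projective
    one generated at level [p.1]. *)
Definition trunc (i : 'I_n) (psi : P -> DA) : P -> DA :=
  fun p => if (p.1 <= i)%N then psi p else 0.

Lemma trunc_linear i : linear (trunc i).
Proof.
move=> a f g; apply/funext => p; rewrite /trunc.
have fE (x y : P -> DA) : (a *: x + y) p = a *: x p + y p by [].
by rewrite !fE; case: ifP => // _; rewrite scaler0 addr0.
Qed.

Lemma cofree_fin_gen : fin_gen (P -> DA).
Proof.
apply/fin_gen_fun/dual_fin_gen => //.
exists 1%N, (fun=> 1) => b; exists (fun=> b).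
by rewrite big_ord1 [LHS](esym (mulr1 b)).
Qed.

Definition cofree : obj := @MorObj A n (fun i => (P -> DA) : lmodType A)
  (fun i j e => mklin (trunc_linear i)) (fun i => cofree_fin_gen).

Lemma cofree_pmap (i j : 'I_n) (psi : cofree j) (p : P) :
  (p.1 <= i)%N -> (i <= j)%N -> pmap cofree j i psi p = psi p.
Proof.
move=> pi ij; move: j ij psi; apply: ord_le_ind => [psi|j k jk ik IH psi].
  by rewrite pmap_id.
by rewrite (pmap_step jk) // IH /= /trunc (leq_trans pi).
Qed.

(* The pairs [(z, psi)] in the pullback: [psi] is a family of functionals on the
   relations, whose restriction to the generators is [ph] evaluated along [z]. *)
Definition total_set (J : 'I_n) : set (prod_obj Z cofree J) :=
  [set x | (forall p : P, (J < p.1)%N -> x.2 p = 0) /\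
    forall s : T, (s.1 <= J)%N -> forall b : B,
      \sum_(p : P | (p.1 <= s.1)%N) app (x.2 p) (b * sig t (r p.1 p.2 s)) =
      ph s (tau t b *: pmap Z J s.1 x.1)].

Lemma submod_total J : submod (@total_set J).
Proof.
split.
  split=> // s sJ b; rewrite big1 => [|p _]; last exact: app0.
  by rewrite /= linear0 scaler0 linear0.
move=> a x y [x1 x2] [y1 y2].
have E1 p : (a *: x + y).2 p = a *: x.2 p + y.2 p by [].
have E2 : (a *: x + y).1 = a *: x.1 + y.1 by [].
split=> [p Jp|s sJ b]; first by rewrite E1 x1 // y1 // scaler0 addr0.
rewrite E2 lin_comb scalerDr scalerA (linearD (ph s)) -y2 //.
have -> : tau t b * a = tau t (sig t a * b) by rewrite tauM sigK.
rewrite -x2 // -big_split /=; apply: eq_bigr => p _.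
by rewrite -mulrA -appZ -appD.
Qed.

Lemma total_stable (i j : 'I_n) (ij : j = i.+1 :> nat) x :
  @total_set j x -> @total_set i (mor_map (prod_obj Z cofree) ij x).
Proof.
case: x => z psi [h1 h2]; split=> [p ip|s si b].
  by rewrite /= /trunc leqNgt ip.
have sj : (s.1 <= j)%N by rewrite ij leqW.
rewrite -(pmap_step ij) // -(h2 s sj b); apply: eq_bigr => p ps.
by rewrite /= /trunc (leq_trans ps si).
Qed.

Lemma right_almost_split_construct : exists (Y : obj) (g : mor_hom Y Z),
  right_almost_split (fun _ => True) g.
Proof.
have [Y [io [ioi hY]]] := @subobj_exists _ _ al _ flR _ _ submod_total total_stable.
exists Y, (hom_comp (prod_fst Z cofree) io); split.
  (* Evaluating the [cofree] part of a section at [1] gives functionals [th p] that express each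
     [ph u (gen u)] as a sum over the relations. Summing over [u] first gives zero, since each
     [r p.1 p.2] is a relation among the generators. *)
  move=> [s hs]; apply: ph1.
  pose psi i (z : Z i) : P -> DA := (io i (s i z)).2.
  have psi_hom (i j : 'I_n) z (p : P) : (p.1 <= i)%N -> (i <= j)%N -> psi i (pmap Z j i z) p = psi j z p.
    move=> pi ij; rewrite -(cofree_pmap (psi j z) pi ij).
    by rewrite /psi -[in RHS](pmap_hom (hom_comp (prod_snd Z cofree) (hom_comp io s))).
  have psi_lin i : linear (@psi i).
    by move=> a x y; rewrite /psi !lin_comb.
  pose th (p : P) (z : Z p.1) : E := app (psi p.1 z p) 1.
  have thl p : linear (@th p : res al (Z p.1) -> E).
    move=> a x y; rewrite /th resE psi_lin appD; congr (_ + _).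
    exact: app_rho.
  have key (u : T) : ph u (gen u) =
      \sum_p th p (r p.1 p.2 u *: pmap Z u.1 p.1 (gen u)).
    have [_ h] : @total_set u.1 (io u.1 (s u.1 (gen u))) by apply/hY; exists (s u.1 (gen u)).
    have := h u (leqnn _) 1; rewrite tau1 scale1r pmap_id [X in ph u X]hs => <-.
    rewrite big_mkcond /=; apply: eq_bigr => p _; case: leqP => pu; last first.
      by rewrite pmap_gt // scaler0 [RHS](linear0 (mklin (thl p))).
    rewrite mul1r /th -(linearZ_LR (pmap Z u.1 p.1)) psi_hom //.
    pose c : A := r p.1 p.2 u.
    have psiZ : psi u.1 (c *: gen u) = c *: psi u.1 (gen u).
      exact: (linearZ_LR (mklin (psi_lin u.1))).
    rewrite -/c psiZ -[RHS]/(app (c *: psi u.1 (gen u) p) 1).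
    by rewrite appZ mulr1.
  rewrite (eq_bigr _ (fun u _ => key u)) exchange_big /= big1 // => p _.
  rewrite -(linear_sum (mklin (thl p))).
  have -> : \sum_u r p.1 p.2 u *: pmap Z u.1 p.1 (gen u) = 0 by exact: (r_rel p.1 p.2).
  exact: (linear0 (mklin (thl p))).
(* Each [th p] becomes a map into component [p] of [cofree]; [hth] says that paired with [u] these
   maps land in [total_set]. *)
move=> W u _ /lifting_functional[th hth].
pose v2 J (w : W J) : P -> DA := fun p => orbit_functional (th p) (pmap W J p.1 w).
have v2l J : linear (@v2 J).
  move=> a x y; apply/funext => p; apply: app_ext => b.
  have -> : (a *: v2 J x + v2 J y) p = a *: v2 J x p + v2 J y p by [].
  rewrite appD appZ !orbit_functionalE lin_comb scalerDr (linearD (th p)) scalerA.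
  by rewrite tauM sigK.
have v2c (i j : 'I_n) (ij : j = i.+1 :> nat) w : v2 i (mor_map W ij w) = mor_map cofree ij (v2 j w).
  apply/funext => p; rewrite /= /trunc; case: leqP => pi.
    by rewrite /v2 -pmap_step.
  apply: app_ext => b; rewrite orbit_functionalE pmap_gt // scaler0 linear0.
  by rewrite app0.
pose v : mor_hom W cofree := @mkhom A n W cofree v2 v2l v2c.
pose uv : mor_hom W (prod_obj Z cofree) := @mkhom A n W (prod_obj Z cofree)
  (fun i w => (u i w, v i w))
  (fun i a x y => f_equal2 pair (lin_comb (u i) a x y) (lin_comb (v i) a x y))
  (fun i j e x => f_equal2 pair (hom_comm u e x) (hom_comm v e x)).
have [f hf] : exists f : mor_hom W Y, forall i w, io i (f i w) = uv i w.
  apply: lift_mono => // J w; apply/hY; split=> [p Jp|s sJ b].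
    apply: app_ext => b; rewrite /= orbit_functionalE pmap_gt // scaler0 linear0.
    by rewrite app0.
  rewrite /= -pmap_hom -(linearZ_LR (u s.1)) -hth big_mkcond /=.
  apply: eq_bigr => p _; case: leqP => ps; last first.
    by rewrite pmap_gt // scaler0 linear0.
  rewrite orbit_functionalE tauM sigK linearZ_LR pmap_comp ?ps // scalerA.
  by [].
by exists f => i w; rewrite /= hf.
Qed.

End Construction.

Lemma right_almost_split_exists Z : indecomposable Z ->
  exists (Y : obj) (g : mor_hom Y Z), right_almost_split (fun _ => True) g.
Proof.
move=> indZ.
have [K [e [_ he]]] := @gens_family 'I_n (fun i => Z i) (fun i => setT)
  (fun i => submodT _) (fun i => obj_fin_len al flR Z i).
have he' i x : exists c : 'I_K -> A, x = \sum_k c k *: e i k by apply: he.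
have fA : fin_gen (A^o : lmodType A).
  exists 1%N, (fun=> 1) => b; exists (fun=> b).
  by rewrite big_ord1 [LHS](esym (mulr1 b)).
have [L [r [r_rel hr]]] := @gens_family 'I_n
  (fun i => ('I_n * 'I_K -> A^o)%type : lmodType A) (fun i => relations e i)
  (fun i => submod_ker (mklin (comb_linear (gen e) i)))
  (fun i => fin_gen_len al flR (fin_gen_fun _ fA)).
have [ph [ph1 ph0]] := separating_functional indZ he'.
exact: (right_almost_split_construct he' r_rel hr ph1 ph0).
Qed.

End RightAlmostSplit.

(** * Approximations *)

Section Approximations.
Variables (R : comNzRingType) (A : nzRingType) (al : central_alg R A) (n : nat).
Hypothesis flR : fin_len R^o.
Local Notation obj := (mor_obj A n).
Implicit Types X Y Z M : obj.

Lemma mono_pmap X (i j : 'I_n) : mono_cat X -> (i <= j)%N -> injective (pmap X j i).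
Proof.
move=> mX ij; apply: ker0_inj; move: j ij; apply: ord_le_ind => [x|j k e ik IH x].
  by rewrite pmap_id.
by rewrite (pmap_step e) // => /IH /(inj_ker0 (mX _ _ e)).
Qed.

Lemma epi_pmap X (i j : 'I_n) : epi_cat X -> (i <= j)%N ->
  forall y, exists x, pmap X j i x = y.
Proof.
move=> eX ij; move: j ij; apply: ord_le_ind => [y|j k e ik IH y].
  by exists y; rewrite pmap_id.
by have [z <-] := IH y; have [x <-] := eX _ _ e z; exists x; rewrite (pmap_step e).
Qed.

Variables (o l : 'I_n).
Hypothesis o0 : forall i : 'I_n, (o <= i)%N.
Hypothesis lmax : forall i : 'I_n, (i <= l)%N.

(** Elements killed on the way down to the lowest level [o] vanish under every map to a monomorphism
    representation, and dividing them out already makes all structure maps injective. *)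
Lemma mono_covariantly_finite : covariantly_finite (@mono_cat A n).
Proof.
move=> M.
have [|Q [pi [pis hQ]]] := @quotobj_exists _ _ M (fun i => [set x | pmap M i o x = 0])
  (fun i => submod_ker (pmap M i o)).
  move=> i j e x; rewrite /mkset -pmap_map pmap_comp //.
  by rewrite o0 e leqnSn.
have kerE i x : pi i x = 0 <-> pmap M i o x = 0 by exact: hQ.
exists Q, pi; split.
  move=> i j e; apply: ker0_inj => q; have [x <-] := pis j q.
  rewrite -hom_comm => /kerE; rewrite -(pmap_step e) //; by move=> /kerE.
move=> Y g CY; have [|h hh] := @factor_epi _ _ _ _ _ pi g pis.
  move=> i x /kerE xo; apply: (inj_ker0 (mono_pmap CY (o0 i))).
  by rewrite -pmap_hom xo linear0.
by exists h.
Qed.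

(** The images of the top level [l] form the largest subobject with surjective maps, and every map
    from an epimorphism representation lands there. *)
Lemma epi_contravariantly_finite : contravariantly_finite (@epi_cat A n).
Proof.
move=> M.
have [|S [io [ioi hS]]] := @subobj_exists _ _ al _ flR M (fun i => range (pmap M l i))
  (fun i => submod_img (pmap M l i) (submodT _)).
  move=> i j e x [y _ <-]; exists y => //.
  by rewrite -pmap_map pmap_comp // e leqnSn -e lmax.
exists S, io; split.
  move=> i j e y; have [z _ zy] : range (pmap M l i) (io i y) by apply/hS; exists y.
  have [x xz] : exists x, io j x = pmap M l j z by apply/hS; exists z.
  exists x; apply: (ioi i); rewrite hom_comm xz -zy -pmap_map pmap_comp //.
  by rewrite e leqnSn -e lmax.
move=> Y g CY; apply: lift_mono => // i y; apply/hS.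
have [x <-] := epi_pmap CY (lmax i) y; exists (g l x) => //.
by rewrite pmap_hom.
Qed.

Section AddFree.
Variables (M : obj) (K : nat) (e : forall i, 'I_K -> M i).
Hypothesis he : forall i x, exists c : 'I_K -> A, x = \sum_k c k *: e i k.
Local Notation P := ('I_n * 'I_K)%type.
Local Notation F := ((P -> A^o) : lmodType A).

Definition level_sum i (f : P -> A^o) : M i := \sum_k (f (i, k) : A) *: e i k.

Lemma level_sum_linear i : linear (@level_sum i).
Proof.
move=> a f g; rewrite /level_sum scaler_sumr -big_split /=; apply: eq_bigr => k _.
by rewrite scalerA -scalerDl.
Qed.

(* The free summand indexed by the generators of [M i] lives in the levels above
   [i] and is sent onto [M i] when level [i] is reached. *)
Definition free_map (i j : 'I_n) (ij : j = i.+1 :> nat) (x : (M j * F)%type) : (M i * F)%type :=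
  (mor_map M ij x.1 + level_sum i x.2,
   fun p : P => if (p.1 < i)%N then x.2 p else 0).

Lemma free_map_linear i j ij : linear (@free_map i j ij).
Proof.
move=> a x y; apply/pair_equal_spec; split.
  rewrite /= level_sum_linear lin_comb scalerDr !addrA; congr (_ + _).
  by rewrite -!addrA; congr (_ + _); rewrite addrC.
apply/funext => p.
have fE (f g : P -> A^o) : (a *: f + g) p = a *: f p + g p by [].
by rewrite /= !fE; case: ifP => // _; rewrite scaler0 addr0.
Qed.

Lemma regular_fin_gen (B : nzRingType) : fin_gen (B^o : lmodType B).
Proof.
exists 1%N, (fun=> 1) => b; exists (fun=> b).
by rewrite big_ord1 [LHS](esym (mulr1 b)).
Qed.

Definition free_obj : obj := @MorObj A n (fun i => (M i * F)%type)
  (fun i j ij => mklin (@free_map_linear i j ij))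
  (fun i => fin_gen_prod (@mor_fin_gen A n M i) (fin_gen_fun _ (regular_fin_gen A))).

Definition free_supp i : set (free_obj i) :=
  [set x | forall p : P, (i <= p.1)%N -> x.2 p = 0].

(** The free summands add the missing preimages. Being free, they impose no condition when a map
    from [M] is extended to them. *)
Lemma left_epi_approx : exists (X : obj) (f : mor_hom M X), left_approx (@epi_cat A n) f.
Proof.
have sU i : submod (@free_supp i).
  split=> [p _ //|a x y hx hy p ip].
  have -> : (a *: x + y).2 p = a *: x.2 p + y.2 p by [].
  by rewrite hx // hy // scaler0 addr0.
have stU (i j : 'I_n) (ij : j = i.+1 :> nat) x :
    @free_supp j x -> @free_supp i (mor_map free_obj ij x).
  by move=> _ p ip; rewrite /= ltnNge ip.
have [S [io [ioi hS]]] := @subobj_exists _ _ al _ flR free_obj _ sU stU.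
have ioS i s : @free_supp i (io i s) by apply/hS; exists s.
have CS : epi_cat S.
  move=> i j ij y; have hy := ioS i y; case yE : (io i y) hy => [x' f'] hy.
  have [c cE] := he x'.
  (* The [M i] component of [y] is supplied entirely by the free summand indexed by level [i], so
     the [M j] component of the preimage can be zero. *)
  pose f : P -> A^o := fun p => if p.1 == i then c p.2 else f' p.
  have [s sE] : exists s, io j s = (0, f).
    apply/hS => p jp; rewrite /= /f; case: eqP => [pi|_]; last by apply: hy; rewrite ltnW // -ij.
    by move: jp; rewrite pi ij ltnn.
  exists s; apply: (ioi i); rewrite hom_comm sE yE.
  apply/pair_equal_spec; split.
    rewrite /= linear0 add0r cE; apply: eq_bigr => k _.
    by rewrite /f /= eqxx.
  apply/funext => p; rewrite /= /f; case: ltnP => pi.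
    by case: eqP => // pE; rewrite pE ltnn in pi.
  by rewrite [RHS]hy.
have [inM inME] : exists f : mor_hom M free_obj, forall i x, f i x = (x, 0).
  unshelve eexists; first refine (@mkhom A n M free_obj (fun i x => (x, 0)) _ _).
    by move=> i a x y; apply/pair_equal_spec; rewrite /= scaler0 addr0.
  move=> i j ij x; apply/pair_equal_spec; split.
    by rewrite /= [level_sum i 0](linear0 (mklin (@level_sum_linear i))) addr0.
  by apply/funext => p /=; case: ifP.
  by [].
have [f hf] : exists f : mor_hom M S, forall i x, io i (f i x) = inM i x.
  by apply: lift_mono => // i x; apply/hS => p _; rewrite inME.
exists S, f; split=> // Y g CY.
(* The image of each generator is lifted at once to the top level of [Y]; its projections give
   compatible values for the free summand on all levels. *)
have [b hb] := choice (fun p : P => epi_pmap CY (lmax p.1) (g p.1 (e p.1 p.2))).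
pose h i (s : S i) : Y i := g i (io i s).1 + \sum_p ((io i s).2 p : A) *: pmap Y l i (b p).
have hl i : linear (h i).
  move=> a x y; rewrite /h !lin_comb scalerDr addrACA; congr (_ + _).
  rewrite scaler_sumr -big_split /=; apply: eq_bigr => p _.
  by rewrite scalerA -scalerDl.
have hc (i j : 'I_n) (ij : j = i.+1 :> nat) s : h i (mor_map S ij s) = mor_map Y ij (h j s).
  rewrite /h hom_comm; have := ioS j s; case: (io j s) => x f0 /= fs.
  have {}fs (p : P) : (j <= p.1)%N -> f0 p = 0 := fs p.
  rewrite !linearD hom_comm -addrA; congr (_ + _).
  rewrite /level_sum !linear_sum /= [RHS](bigID (fun p : P => p.1 == i)) /=; congr (_ + _).
    transitivity (\sum_(i' | i' == i) \sum_k (f0 (i', k) : A) *: mor_map Y ij (pmap Y l j (b (i', k)))).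
      rewrite big_pred1_eq; apply: eq_bigr => k _.
      rewrite linearZ_LR -(hb (i, k)) -pmap_map pmap_comp //.
      by rewrite ij leqnSn -ij lmax.
    rewrite pair_big_dep /=; apply: eq_big => [[i' k]|[i' k] _] /=; first by rewrite andbT.
    by rewrite linearZ_LR.
  rewrite big_mkcond /= [RHS]big_mkcond /=; apply: eq_bigr => p _.
  rewrite linearZ_LR -pmap_map pmap_comp ?ij ?leqnSn -?ij ?lmax //.
  case: ltngtP => pi //.
  - by rewrite -val_eqE /= ltn_eqF.
  - by rewrite scale0r -val_eqE /= gtn_eqF // fs ?scale0r // ij.
  - by rewrite -val_eqE /= pi eqxx scale0r.
exists (mkhom hl hc) => i x; rewrite /= /h hf inME /= big1 ?addr0 // => p _.
by rewrite scale0r.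
Qed.
End AddFree.

Lemma epi_covariantly_finite : covariantly_finite (@epi_cat A n).
Proof.
move=> M; have [K [e [_ he]]] := @gens_family _ _ al 'I_n (fun i => M i) (fun i => setT)
  (fun i => submodT _) (fun i => obj_fin_len al flR M i).
apply: (left_epi_approx (e := e)) => i x; exact: he.
Qed.

End Approximations.

(** * Levelwise duality of representations *)

Section ObjectPairing.
Variables (R : comNzRingType) (E : lmodType R) (n : nat).

(* [X' i'] is the dual of [X i] when [i + i' = n - 1]. *)
Record opair (A B : nzRingType) (al : central_alg R A) (be : central_alg R B)
    (t : anti_iso al be) (X : mor_obj A n) (X' : mor_obj B n) := Opair {
  op_pr :> forall i i' : 'I_n, (i + i').+1 = n -> pairing E t (X i) (X' i');
  op_adj : forall (i i' j j' : 'I_n) (e : j = i.+1 :> nat) (e' : i' = j'.+1 :> nat)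
    (h : (i + i').+1 = n) (h' : (j + j').+1 = n) x x',
    op_pr h (mor_map X e x) x' = op_pr h' x (mor_map X' e' x')
}.

Section Existence.
Hypothesis flR : fin_len R^o.
Hypothesis ssE : simple_socle E.
Hypothesis Emax : socle_maximal E.
Variables (A B : nzRingType) (al : central_alg R A) (be : central_alg R B).
Variables (t : anti_iso al be) (X : mor_obj A n).

Fact rev_step (i j : 'I_n) : j = i.+1 :> nat -> rev_ord i = (rev_ord j).+1 :> nat.
Proof. by move=> e /=; rewrite e subnSK // -e ltn_ord. Qed.

Fact rev_ord_eq (i i' : 'I_n) : (i + i').+1 = n -> rev_ord i' = i.
Proof. by move=> h; apply: val_inj; rewrite /= -{1}h -addnS addnK. Qed.

Local Notation D i := (dual E t (X (rev_ord i))).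

Definition dual_map (i j : 'I_n) (e : j = i.+1 :> nat) (f : D j) : D i :=
  homR_of (homR_fun f \o res_lin al (mor_map X (rev_step e))).

Lemma dual_map_linear (i j : 'I_n) (e : j = i.+1 :> nat) : linear (@dual_map i j e).
Proof.
move=> b f g; apply: homR_ext => x.
rewrite [RHS]homR_funD; rewrite [LHS]homR_funD; congr (_ + _).
by rewrite [RHS]dual_scaleE [LHS]dual_scaleE [RHS]homR_ofE /= linearZ_LR.
Qed.

Definition dual_obj : mor_obj B n := @MorObj B n (fun i => D i)
  (fun i j e => mklin (@dual_map_linear i j e))
  (fun i => dual_fin_gen t flR ssE (@mor_fin_gen A n X (rev_ord i))).

(** [pmap] between the equal indices [i] and [rev_ord i'] is the identity and stands in for a
    cast. *)
Definition dual_obj_pr (i i' : 'I_n) (h : (i + i').+1 = n) :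
  {p : pairing E t (X i) (dual_obj i') |
    forall x f, p x f = homR_fun f (pmap X i (rev_ord i') x)}.
Proof.
move: (rev_ord_eq h) => e; subst i.
have [p hp] := dual_pairing t flR ssE Emax (@mor_fin_gen A n X (rev_ord i')).
by exists p => x f; rewrite pmap_id; apply: hp.
Qed.

Lemma opair_exists : exists X', inhabited (opair t X X').
Proof.
exists dual_obj; constructor.
apply: (@Opair _ _ al be t X dual_obj (fun i i' h => sval (dual_obj_pr h))).
move=> i i' j j' e e' h h' x f.
case: (dual_obj_pr h) => p /= ->; case: (dual_obj_pr h') => q /= ->.
have ri : rev_ord i' = i :> nat by rewrite (rev_ord_eq h).
have rj : rev_ord j' = j :> nat by rewrite (rev_ord_eq h').
rewrite -[RHS]/(homR_fun f (mor_map X (rev_step e') (pmap X j (rev_ord j') x))).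
congr (homR_fun f _); rewrite -(pmap_step e); last by rewrite [X in (X <= _)%N]ri.
rewrite -pmap_map pmap_comp //.
by apply/andP; split; [rewrite (rev_step e')|rewrite [X in (X <= _)%N]rj].
Qed.
End Existence.

Definition opair_swap A B (al : central_alg R A) (be : central_alg R B)
  (t : anti_iso al be) X X' (p : opair t X X') : opair (anti_swap t) X' X.
Proof.
refine (@Opair _ _ be al (anti_swap t) X' X
  (fun i i' h => pairing_swap (p i' i (etrans (congr1 S (addnC i' i)) h))) _).
by move=> i i' j j' e e' h h' x x' /=; apply: esym; apply: op_adj.
Defined.

Definition opair_unswap A B (al : central_alg R A) (be : central_alg R B)
  (t : anti_iso al be) X X' (p : opair (anti_swap t) X' X) : opair t X X'.
Proof.
refine (@Opair _ _ al be t X X'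
  (fun i i' h => pairing_unswap (p i' i (etrans (congr1 S (addnC i' i)) h))) _).
by move=> i i' j j' e e' h h' x x' /=; apply: esym; apply: op_adj.
Defined.

Section Adjoints.
Variables (A B : nzRingType) (al : central_alg R A) (be : central_alg R B).
Variables (t : anti_iso al be).

Definition hadj X X' Y Y' (p : opair t X X') (q : opair t Y Y')
    (f : mor_hom X Y) (f' : mor_hom Y' X') :=
  forall i i' h x y, q i i' h (f i x) y = p i i' h x (f' i' y).

Lemma opair_irr X X' (p : opair t X X') i i' h h' x y : p i i' h x y = p i i' h' x y.
Proof. by rewrite (eq_irrelevance h h'). Qed.

Lemma rev_sum (i : 'I_n) : (rev_ord i + i).+1 = n.
Proof. by rewrite /= -addnS subnK. Qed.

Lemma opair_extr X X' (p : opair t X X') i' (y y' : X' i') :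
  (forall i h x, p i i' h x y = p i i' h x y') -> y = y'.
Proof. by move=> hy; apply: (pr_extr (p := p _ _ (rev_sum i'))) => x; apply: hy. Qed.

Lemma hadj_exists X X' Y Y' (p : opair t X X') (q : opair t Y Y') (f : mor_hom X Y) :
  exists f', hadj p q f f'.
Proof.
have [g hg] : exists g : forall i', {linear Y' i' -> X' i'},
    forall i i' h x y, q i i' h (f i x) y = p i i' h x (g i' y).
  have ex i' : exists g : {linear Y' i' -> X' i'}, forall i h x y,
      q i i' h (f i x) y = p i i' h x (g y).
    have [g hg] := adjoint_exists (p _ _ (rev_sum i')) (q _ _ (rev_sum i')) (f (rev_ord i')).
    exists g => i h x y; have e : i = rev_ord i'.
      by apply: val_inj; apply/eqP; rewrite -(eqn_add2r i') -eqSS h rev_sum.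
    by subst i; rewrite (opair_irr q h (rev_sum i')) hg; apply: opair_irr.
  by exists (fun i' => sval (cid (ex i'))) => i i'; case: cid.
have gc (i' j' : 'I_n) (e : j' = i'.+1 :> nat) y :
    g i' (mor_map Y' e y) = mor_map X' e (g j' y).
  apply: (opair_extr (p := p)) => i h x.
  rewrite -hg.
  have h' : (rev_ord j' + j').+1 = n := rev_sum j'.
  have e' : i = (rev_ord j').+1 :> nat.
    by apply/eqP; rewrite -(eqn_add2r i') -eqSS h addSn -addnS -e rev_sum.
  by rewrite -(op_adj q e' e h' h) -hom_comm hg -(op_adj p e' e h' h).
by exists (MorHom gc).
Qed.

End Adjoints.

Section AdjointsRev.
Variables (A B : nzRingType) (al : central_alg R A) (be : central_alg R B).
Variables (t : anti_iso al be).

Lemma opair_extl X X' (p : opair t X X') i (x x' : X i) :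
  (forall i' h y, p i i' h x y = p i i' h x' y) -> x = x'.
Proof.
move=> hx; apply: (opair_extr (p := opair_swap p)) => i' h y; exact: hx.
Qed.

Lemma hadj_exists_rev X X' Y Y' (p : opair t X X') (q : opair t Y Y')
  (f' : mor_hom Y' X') : exists f, hadj p q f f'.
Proof.
have [f hf] := hadj_exists (opair_swap q) (opair_swap p) f'.
exists f => i i' h x y.
have h' : (i' + i).+1 = n by rewrite addnC.
by have := hf i' i h' y x; rewrite /= (opair_irr p _ h) (opair_irr q _ h).
Qed.

Lemma hadj_eq X X' Y Y' (p : opair t X X') (q : opair t Y Y') f f' g g' :
  hadj p q f f' -> hadj p q g g' -> hom_eq f g <-> hom_eq f' g'.
Proof.
move=> hf hg; split=> fg i x.
  by apply: (opair_extr (p := p)) => j h y; rewrite -hf -hg fg.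
by apply: (opair_extl (p := q)) => j h y; rewrite hf hg fg.
Qed.

Lemma hadj_comp X X' Y Y' W W' (p : opair t X X') (q : opair t Y Y')
    (r : opair t W W') f f' g g' :
  hadj p q f f' -> hadj q r g g' -> hadj p r (hom_comp g f) (hom_comp f' g').
Proof. by move=> hf hg i i' h x y; rewrite /= hg hf. Qed.

Lemma epi_mono X X' (p : opair t X X') : epi_cat X' -> mono_cat X.
Proof.
move=> eX' i j e; apply: ker0_inj => x fx; apply: (opair_extl (p := p)) => j' h y.
have lt : (j'.+1 < n)%N by apply: (leq_trans _ (eq_leq h)); rewrite e addSn !ltnS leq_addl.
pose i' : 'I_n := Ordinal lt.
have h' : (i + i').+1 = n by rewrite -[RHS]h e /= addnS.
have [y' <-] := eX' j' i' erefl y.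
by rewrite -(op_adj p e (erefl : i' = j'.+1 :> nat) h' h) fx !pr0l.
Qed.

Hypothesis flR : fin_len R^o.
Hypothesis ssE : simple_socle E.
Hypothesis Emax : socle_maximal E.

(** An element of [X' j'] is a functional on [X j]; by injectivity of [E] it extends along the
    monomorphism into [X i], and the extension is represented by a preimage. *)
Lemma mono_epi X X' (p : opair t X X') : mono_cat X -> epi_cat X'.
Proof.
move=> mX j' i' e' y.
pose j := rev_ord j'; pose i := rev_ord i'.
have e : j = i.+1 :> nat by apply: rev_step.
have h := rev_sum i'; have h' := rev_sum j'.
have [x /= mx|f hf] := extend_factor ssE Emax (f := res_lin al (mor_map X e)) (g := prl (p _ _ h') y).
  by rewrite (inj_ker0 (mX _ _ e) mx) pr0l.
have [y' hy'] := pr_repr (p _ _ h) f; exists y'.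
apply: (pr_extr (p := p _ _ h')) => x.
by rewrite -(op_adj p e e' h h') hy' [LHS]hf.
Qed.

Lemma opair_exists_left (X' : mor_obj B n) : exists X, inhabited (opair t X X').
Proof.
have [X [p]] := opair_exists flR ssE Emax (anti_swap t) X'.
by exists X; constructor; apply: opair_unswap.
Qed.

End AdjointsRev.

Section MonoRight.
Variables (A B : nzRingType) (al : central_alg R A) (be : central_alg R B).
Variables (t : anti_iso al be).
Hypothesis flR : fin_len R^o.
Hypothesis ssE : simple_socle E.
Hypothesis Emax : socle_maximal E.

(** The right approximation is the dual of a left approximation of the dual object over [B]. *)
Lemma mono_contravariantly_finite : covariantly_finite (@epi_cat B n) ->
  contravariantly_finite (@mono_cat A n).
Proof.
move=> cf M; have [M' [p]] := opair_exists flR ssE Emax t M.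
have [Y' [f' [CY' hf']]] := cf M'.
have [Y [q]] := opair_exists_left t flR ssE Emax Y'.
have [f hf] := hadj_exists_rev q p f'.
exists Y, f; split; first exact: epi_mono q CY'.
move=> W g CW; have [W' [r]] := opair_exists flR ssE Emax t W.
have [g' hg] := hadj_exists r p g.
have [h' hE] := hf' W' g' (mono_epi ssE Emax r CW).
have [h hh] := hadj_exists_rev r q h'.
by exists h; apply/(hadj_eq (hadj_comp hh hf) hg).
Qed.

(** A right almost split map in the whole category stays so within the subcategory after composition
    with a right approximation of its source. *)
Lemma mono_sink Z : contravariantly_finite (@mono_cat A n) ->
  mono_cat Z -> indecomposable Z -> exists (Y : mor_obj A n) (g : mor_hom Y Z),
  sink_map (@mono_cat A n) g.
Proof.
move=> cf CZ indZ; have [Y [g [ng hg]]] := right_almost_split_exists flR ssE Emax t indZ.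
have [X [f [CX hf]]] := cf Y.
apply: (sink_of_right_almost_split al flR (g := hom_comp g f)) => //.
  exact: mono_sub.
split=> [[s hs]|W u CW nu].
  by apply: ng; exists (hom_comp f s) => i x; apply: hs.
have [v gv] := hg W u Logic.I nu; have [w fw] := hf W v CW.
by exists w => i x; rewrite -(gv i x) /= -(fw i x).
Qed.
End MonoRight.
End ObjectPairing.

(** * Transport along exact dualities *)

(** Only the vocabulary of the statements to be transported, without laws, so that opposites are
    obtained by exchanging arguments. *)
Record exact_cat := Cat {
  ob : Type;
  hm : ob -> ob -> Type;
  heq : forall x y, hm x y -> hm x y -> Prop;
  cmp : forall x y z, hm y z -> hm x y -> hm x z;
  idm : forall x, hm x x;
  ses : forall x y z, hm x y -> hm y z -> Prop;
  ind : ob -> Prop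
}.
Arguments heq {_ _ _}.
Arguments cmp {_ _ _ _}.
Arguments idm {_}.
Arguments ses {_ _ _ _}.
Arguments ind {_}.

Definition opcat (c : exact_cat) : exact_cat := {|
  ob := ob c;
  hm := fun x y => hm y x;
  heq := fun x y => @heq c y x;
  cmp := fun x y z g f => cmp f g;
  idm := fun x => idm x;
  ses := fun x y z f g => ses g f;
  ind := fun x => ind x
|}.

Definition sink (c : exact_cat) (y z : ob c) (g : hm y z) :=
  [/\ ~ (exists s : hm z y, heq (cmp g s) (idm z)),
      (forall w (u : hm w z), ~ (exists s : hm z w, heq (cmp u s) (idm z)) ->
        exists v : hm w y, heq (cmp g v) u)
    & forall h : hm y y, heq (cmp g h) g ->
        exists k, heq (cmp k h) (idm y) /\ heq (cmp h k) (idm y)].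

Definition source (c : exact_cat) (x y : ob c) (f : hm x y) := @sink (opcat c) y x f.

Definition projective (c : exact_cat) (p : ob c) :=
  forall (x y z : ob c) (f : hm x y) (g : hm y z), ses f g ->
    forall u : hm p z, exists v : hm p y, heq (cmp g v) u.

(* The half of the theorem concerning right ends of sequences; the other half
   is the same statement for the opposite category. *)
Definition ends (c : exact_cat) :=
  (forall z : ob c, ind z -> exists (y : ob c) (g : hm y z), sink g) /\
  (forall z : ob c, ind z -> ~ projective z ->
    exists (x y : ob c) (f : hm x y) (g : hm y z), [/\ ses f g, source f & sink g]).

(** An equivalence as a relation on objects and morphisms, total on both sides, since the dualities
    are given by pairings. [orel] is in [Type] because adjointness refers to the chosen pairing. *)
Record equiv (c d : exact_cat) := Equiv {
  orel : ob c -> ob d -> Type;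
  hrel : forall x x' y y', orel x x' -> orel y y' -> hm x y -> hm x' y' -> Prop;
  orel_r : forall x, exists x', inhabited (orel x x');
  orel_l : forall x', exists x, inhabited (orel x x');
  hrel_r : forall x x' y y' (p : orel x x') (q : orel y y') f, exists f', hrel p q f f';
  hrel_l : forall x x' y y' (p : orel x x') (q : orel y y') f', exists f, hrel p q f f';
  hrel_eq : forall x x' y y' (p : orel x x') (q : orel y y') f f' g g',
    hrel p q f f' -> hrel p q g g' -> heq f g <-> heq f' g';
  hrel_cmp : forall x x' y y' z z' (p : orel x x') (q : orel y y') (r : orel z z') f f' g g',
    hrel p q f f' -> hrel q r g g' -> hrel p r (cmp g f) (cmp g' f');
  hrel_id : forall x x' (p : orel x x'), hrel p p (idm x) (idm x');
  hrel_ses : forall x x' y y' z z' (p : orel x x') (q : orel y y') (r : orel z z') f f' g g',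
    hrel p q f f' -> hrel q r g g' -> ses f g <-> ses f' g';
  orel_ind : forall x x', orel x x' -> ind x -> ind x'
}.

Definition equiv_op c d (e : equiv c d) : equiv (opcat c) (opcat d) :=
  @Equiv (opcat c) (opcat d) (@orel c d e)
    (fun x x' y y' p q f f' => @hrel c d e _ _ _ _ q p f f')
    (@orel_r c d e) (@orel_l c d e)
    (fun x x' y y' p q f => @hrel_r c d e _ _ _ _ q p f)
    (fun x x' y y' p q f => @hrel_l c d e _ _ _ _ q p f)
    (fun x x' y y' p q f f' g g' => @hrel_eq _ _ e _ _ _ _ q p f f' g g')
    (fun x x' y y' z z' p q r f f' g g' hf hg =>
       @hrel_cmp _ _ e _ _ _ _ _ _ r q p g g' f f' hg hf)
    (fun x x' p => @hrel_id c d e x x' p)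
    (fun x x' y y' z z' p q r f f' g g' hf hg =>
       @hrel_ses _ _ e _ _ _ _ _ _ r q p g g' f f' hg hf)
    (@orel_ind c d e).

Section Transport.
Variables (c d : exact_cat) (e : equiv c d).

Lemma sink_transport y y' z z' (q : orel e y y') (r : orel e z z') g g' :
  hrel q r g g' -> sink g' -> sink g.
Proof.
move=> hg [ng hs gm]; split.
- move=> [s gs]; have [s' hs'] := hrel_r r q s; apply: ng; exists s'.
  exact/(hrel_eq (hrel_cmp hs' hg) (hrel_id r)).
- move=> w u nu; have [w' [p]] := orel_r e w; have [u' hu] := hrel_r p r u.
  have [[s' us']|v' gv'] := hs w' u'.
    have [s hs'] := hrel_l r p s'; apply: nu; exists s.
    exact/(hrel_eq (hrel_cmp hs' hu) (hrel_id r)).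
  have [v hv] := hrel_l p q v'; exists v.
  exact/(hrel_eq (hrel_cmp hv hg) hu).
move=> h gh; have [h' hh] := hrel_r q q h.
have [|k' [kh hk]] := gm h'; first exact/(hrel_eq (hrel_cmp hh hg) hg).
have [k hk'] := hrel_l q q k'; exists k; split.
  exact/(hrel_eq (hrel_cmp hh hk') (hrel_id q)).
exact/(hrel_eq (hrel_cmp hk' hh) (hrel_id q)).
Qed.

Lemma projective_transport z z' (r : orel e z z') : projective z' -> projective z.
Proof.
move=> pz x y w f g fg u.
have [x' [px]] := orel_r e x; have [y' [py]] := orel_r e y; have [w' [pw]] := orel_r e w.
have [f' hf] := hrel_r px py f; have [g' hg] := hrel_r py pw g; have [u' hu] := hrel_r r pw u.
have [v' gv] := pz _ _ _ f' g' ((hrel_ses hf hg).1 fg) u'.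
have [v hv] := hrel_l r py v'; exists v.
exact/(hrel_eq (hrel_cmp hv hg) hu).
Qed.
End Transport.

Lemma ends_transport c d (e : equiv c d) : ends d -> ends c.
Proof.
move=> [hs ha]; split=> z iz; have [z' [r]] := orel_r e z; have iz' := orel_ind r iz.
  have [y' [g' sg]] := hs z' iz'; have [y [q]] := orel_l e y'.
  by have [g hg] := hrel_l q r g'; exists y, g; apply: sink_transport hg sg.
move=> npz; have npz' : ~ projective z' by move=> /(projective_transport r).
have [x' [y' [f' [g' [fg sf sg]]]]] := ha z' iz' npz'.
have [x [p]] := orel_l e x'; have [y [q]] := orel_l e y'.
have [f hf] := hrel_l p q f'; have [g hg] := hrel_l q r g'.
exists x, y, f, g; split.
- exact/(hrel_ses hf hg).
- exact: (@sink_transport _ _ (equiv_op e) y y' x x' q p f f' hf sf).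
exact: sink_transport hg sg.
Qed.

Section Subcategory.
Variables (A : nzRingType) (n : nat) (P : mor_obj A n -> Prop).

Definition subcat : exact_cat := {|
  ob := {X : mor_obj A n | P X};
  hm := fun X Y => mor_hom (sval X) (sval Y);
  heq := fun X Y f g => hom_eq f g;
  cmp := fun X Y Z g f => hom_comp g f;
  idm := fun X => hom_id (sval X);
  ses := fun X Y Z f g => short_exact f g;
  ind := fun X => indecomposable (sval X)
|}.

Definition in_cat X (PX : P X) : ob subcat := exist _ X PX.

Lemma sinkP Y Z (PY : P Y) (PZ : P Z) (g : mor_hom Y Z) :
  @sink subcat (in_cat PY) (in_cat PZ) g <-> sink_map P g.
Proof.
split=> [[ng hg gm]|[_ _ [ng hg] gm]].
  by split=> //; split=> // W u PW; apply: (hg (in_cat PW)).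
by split=> // -[W PW] u; apply: hg.
Qed.

Lemma sourceP X Y (PX : P X) (PY : P Y) (f : mor_hom X Y) :
  @source subcat (in_cat PX) (in_cat PY) f <-> source_map P f.
Proof.
split=> [[nf hf fm]|[_ _ [nf hf] fm]].
  split=> //; first by split=> // W u PW; apply: (hf (in_cat PW)).
  by move=> h /fm[k [hk kh]]; exists k.
by split=> //= [[W PW] u|h /fm[k [kh hk]]]; [apply: hf|exists k].
Qed.

Lemma projectiveP Z (PZ : P Z) :
  @projective subcat (in_cat PZ) <-> exact_projective P Z.
Proof.
split=> pZ.
  move=> U V W f g [PU PV PW fg]; exact: (pZ (in_cat PU) (in_cat PV) (in_cat PW) f g fg).
by move=> [U PU] [V PV] [W PW] f g fg; apply: (pZ U V W f g).
Qed.

Lemma injectiveP Z (PZ : P Z) :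
  @projective (opcat subcat) (in_cat PZ) <-> exact_injective P Z.
Proof.
split=> pZ.
  move=> U V W f g [PU PV PW fg]; exact: (pZ (in_cat PW) (in_cat PV) (in_cat PU) g f fg).
by move=> [U PU] [V PV] [W PW] f g fg; apply: (pZ W V U g f).
Qed.

Lemma ends_of_AR :
  (forall Z, P Z -> indecomposable Z -> exists Y (g : mor_hom Y Z), sink_map P g) ->
  (forall Z, P Z -> indecomposable Z -> ~ exact_projective P Z ->
     exists X Y (f : mor_hom X Y) (g : mor_hom Y Z), AR_sequence P f g) ->
  ends subcat.
Proof.
move=> hs ha; split=> -[Z PZ] /= iZ.
  have [Y [g sg]] := hs Z PZ iZ; have [PY _ _ _] := sg.
  by exists (in_cat PY), g; apply/(sinkP PY PZ).
move=> npZ; have [|X [Y [f [g [[PX PY _ fg] sf sg]]]]] := ha Z PZ iZ.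
  by move=> /(projectiveP PZ).
by exists (in_cat PX), (in_cat PY), f, g; split=> //; [apply/(sourceP PX PY)|apply/(sinkP PY PZ)].
Qed.

Lemma AR_of_ends : ends subcat -> ends (opcat subcat) -> has_AR_sequences P.
Proof.
move=> [hs ha] [hs' ha']; split=> Z PZ iZ.
- have [[Y PY] [g sg]] := hs (in_cat PZ) iZ.
  by exists Y, g; apply/(sinkP PY PZ).
- have [[Y PY] [g sg]] := hs' (in_cat PZ) iZ.
  by exists Y, g; apply/(sourceP PZ PY).
- move=> np; have [|[X PX] [[Y PY] [f [g [fg sf sg]]]]] := ha (in_cat PZ) iZ.
    by move=> /projectiveP.
  by exists X, Y, f, g; split=> //; [apply/(sourceP PX PY)|apply/(sinkP PY PZ)].
move=> np; have [|[X PX] [[Y PY] [f [g [fg sf sg]]]]] := ha' (in_cat PZ) iZ.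
  by move=> /injectiveP.
exists Y, X, g, f; split=> //; first by apply/(sourceP PZ PY).
by apply/(sinkP PY PX).
Qed.
End Subcategory.

(** * Indecomposability through idempotent endomorphisms *)

Section Indecomposables.
Variables (R : comNzRingType) (A B : nzRingType) (al : central_alg R A) (n : nat).
Hypothesis flR : fin_len R^o.

Lemma idempotent_trivial (X : mor_obj A n) (e : mor_hom X X) : indecomposable X ->
  hom_eq (hom_comp e e) e -> hom_eq e (hom_zero X X) \/ hom_eq e (hom_id X).
Proof.
move=> [_ indX] ee.
have [I [io [ioi hI]]] := @subobj_exists _ _ al _ flR X (fun i => range (e i))
  (fun i => submod_img (e i) (submodT _)) (fun i j a x '(ex_intro2 y _ yx) =>
    ex_intro2 _ _ (mor_map X a y) Logic.I
     (etrans (hom_comm e a y) (congr1 (mor_map X a) yx))).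
have [K [ka [kai hK]]] := @subobj_exists _ _ al _ flR X (fun i => [set x | e i x = 0])
  (fun i => submod_ker (e i)) (fun i j a x gx =>
     etrans (hom_comm e a x) (etrans (congr1 (mor_map X a) gx) (linear0 _))).
have [pI hpI] : exists pI : mor_hom X I, forall i z, io i (pI i z) = e i z.
  by apply: lift_mono => // i z; apply/hI; exists z.
pose q := hom_sub (hom_id X) e.
have qE i x : q i x = x - e i x by [].
have [pK hpK] : exists pK : mor_hom X K, forall i z, ka i (pK i z) = q i z.
  apply: lift_mono => // i z; apply/hK; rewrite /mkset qE linearB.
  by rewrite [e i (e i z)]ee subrr.
have eio i s : e i (io i s) = io i s.
  have [x _ <-] : range (e i) (io i s) by apply/hI; exists s.
  exact: ee.
have eka i s : e i (ka i s) = 0 by apply: (hK i (ka i s)).2; exists s.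
have dsum : is_direct_sum X I K.
  exists io, pI, ka, pK; split.
  - by move=> i s; apply: (ioi i); rewrite [LHS]hpI eio.
  - by move=> i s; apply: (kai i); rewrite [LHS]hpK qE eka subr0.
  - by move=> i s; apply: (ioi i); rewrite hpI eka linear0.
  - by move=> i s; apply: (kai i); rewrite hpK qE eio subrr linear0.
  - by move=> i x; rewrite hpK hpI qE addrC subrK.
have [I0|K0] := indX _ _ dsum; [left|right] => i x.
  by rewrite -hpI (I0 i (pI i x)) linear0.
have : q i x = 0 by rewrite -hpK (K0 i (pK i x)) linear0.
by rewrite qE => /eqP; rewrite subr_eq0 => /eqP.
Qed.

(** A decomposition of [X'] is tested by its idempotent, which is carried to [X] by the
    anti-isomorphism [r] of endomorphism rings; the summands themselves need no dual. *)
Lemma indecomposable_transport (X : mor_obj A n) (X' : mor_obj B n)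
    (r : mor_hom X X -> mor_hom X' X' -> Prop) :
  (forall e', exists e, r e e') ->
  (forall d d' e e', r d d' -> r e e' -> r (hom_comp d e) (hom_comp e' d')) ->
  (forall d d' e e', r d d' -> r e e' -> hom_eq d e <-> hom_eq d' e') ->
  r (hom_zero X X) (hom_zero X' X') -> r (hom_id X) (hom_id X') ->
  indecomposable X -> indecomposable X'.
Proof.
move=> rex rcomp req r0 r1 indX; have [nz _] := indX; split.
  move=> z'; apply: nz => i x; have := (req _ _ _ _ r1 r0).2; apply.
  by move=> j y; rewrite [RHS]/=; apply: z'.
move=> Y Z [iY [pY [iZ [pZ [pYiY pZiZ pYiZ pZiY sum]]]]].
have [e he] := rex (hom_comp iY pY).
have pY1 i y : pY i (iY i y) = y by exact: pYiY.
have pZ1 i z : pZ i (iZ i z) = z by exact: pZiZ.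
have ee : hom_eq (hom_comp e e) e.
  by apply/(req _ _ _ _ (rcomp _ _ _ _ he he) he) => i x; rewrite /= pY1.
have [e0|e1] := idempotent_trivial indX ee; [left|right] => i y.
  have h := (req _ _ _ _ he r0).1 e0 i (iY i y).
  by rewrite -[LHS]pY1 -[LHS]pY1 [X in pY i X]h linear0.
have h := (req _ _ _ _ he r1).1 e1 i (iZ i y).
by rewrite -[LHS]pZ1 -[X in pZ i X]h /= pYiZ !linear0.
Qed.
End Indecomposables.

(** * The levelwise duality and the annihilator duality *)

Section Dualities.
Variables (R : comNzRingType) (E : lmodType R) (n : nat).
Hypothesis flR : fin_len R^o.
Hypothesis ssE : simple_socle E.
Hypothesis Emax : socle_maximal E.

Lemma pairing_exact (A B : nzRingType) (al : central_alg R A) (be : central_alg R B)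
    (t : anti_iso al be) (X Y Z : lmodType A) (X' Y' Z' : lmodType B)
    (p : pairing E t X X') (q : pairing E t Y Y') (r : pairing E t Z Z')
    (f : {linear X -> Y}) (g : {linear Y -> Z})
    (f' : {linear Y' -> X'}) (g' : {linear Z' -> Y'}) :
  (forall x y, q (f x) y = p x (f' y)) -> (forall y z, r (g y) z = q y (g' z)) ->
  injective f -> (forall z, exists y, g y = z) ->
  (forall y, g y = 0 <-> exists x, f x = y) ->
  [/\ injective g', (forall x, exists y, f' y = x)
    & forall y, f' y = 0 <-> exists z, g' z = y].
Proof.
move=> hf hg fi gs ex; split.
- apply: ker0_inj => z gz; apply: (pr_injr (p := r)) => x.
  by have [y <-] := gs x; rewrite hg gz pr0r.
- move=> x'; have [x /= fx|h hh] :=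
    extend_factor ssE Emax (f := res_lin al f) (g := prl p x').
    by rewrite (inj_ker0 fi fx) pr0l.
  have [y hy] := pr_repr q h; exists y; apply: (pr_extr (p := p)) => x.
  by rewrite -hf hy [LHS]hh.
move=> y'; split=> [fy|[z <-]]; last first.
  apply: (pr_injr (p := p)) => x; rewrite -hf -hg.
  by have -> : g (f x) = 0; [apply/ex; exists x|rewrite pr0l].
have [y /= /ex[x <-]|h hh] :=
  extend_factor ssE Emax (f := res_lin al g) (g := prl q y').
  by rewrite hf fy pr0r.
have [z hz] := pr_repr r h; exists z; apply: (pr_extr (p := q)) => y.
by rewrite -hg hz [LHS]hh.
Qed.

Section Levelwise.
Variables (A B : nzRingType) (al : central_alg R A) (be : central_alg R B).
Variables (t : anti_iso al be).

Lemma hadj_swap (X Y : mor_obj A n) (X' Y' : mor_obj B n) (p : opair E t X X')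
    (q : opair E t Y Y') f f' : hadj p q f f' -> hadj (opair_swap q) (opair_swap p) f' f.
Proof. by move=> hf i i' h y x; rewrite /= hf. Qed.

Lemma hadj_ses (X Y Z : mor_obj A n) (X' Y' Z' : mor_obj B n)
    (p : opair E t X X') (q : opair E t Y Y') (r : opair E t Z Z') f f' g g' :
  hadj p q f f' -> hadj q r g g' -> short_exact f g -> short_exact g' f'.
Proof.
move=> hf hg fg i'; have h := rev_sum i'; have [fi gs ex] := fg (rev_ord i').
exact: (pairing_exact (hf _ _ h) (hg _ _ h)).
Qed.
End Levelwise.

Section LevelwiseEquiv.
Variables (A B : nzRingType) (al : central_alg R A) (be : central_alg R B).
Variables (t : anti_iso al be).

Lemma dual_equiv : inhabited
  (equiv (subcat (@epi_cat A n)) (opcat (subcat (@mono_cat B n)))).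
Proof.
constructor.
apply: (@Equiv (subcat (@epi_cat A n)) (opcat (subcat (@mono_cat B n)))
  (fun X X' => opair E t (sval X) (sval X'))
  (fun X X' Y Y' p q f f' => hadj p q f f')).
- move=> [X eX]; have [X' [p]] := opair_exists flR ssE Emax t X.
  by exists (exist _ X' (epi_mono (opair_swap p) eX)).
- move=> [X' mX']; have [X [p]] := opair_exists_left t flR ssE Emax X'.
  by exists (exist _ X (mono_epi ssE Emax (opair_swap p) mX')).
- by move=> X X' Y Y' p q f; apply: hadj_exists.
- by move=> X X' Y Y' p q f'; apply: hadj_exists_rev.
- by move=> X X' Y Y' p q f f' g g'; apply: hadj_eq.
- by move=> X X' Y Y' Z Z' p q r f f' g g'; apply: hadj_comp.
- by [].
- move=> X X' Y Y' Z Z' p q r f f' g g' hf hg; split; first exact: hadj_ses hf hg.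
  exact: hadj_ses (hadj_swap hg) (hadj_swap hf).
move=> X X' p; apply: (indecomposable_transport al flR (r := hadj p p)).
- by move=> e'; apply: hadj_exists_rev.
- by move=> d d' e e' hd he; apply: hadj_comp he hd.
- by move=> d d' e e'; apply: hadj_eq.
- by move=> i i' h x y; rewrite /= pr0l pr0r.
- by [].
Qed.
End LevelwiseEquiv.

Section Annihilators.
Variable o : 'I_n.
Hypothesis o0 : o = 0%N :> nat.

Lemma o_le (i : 'I_n) : (o <= i)%N.
Proof. by rewrite o0. Qed.

(* [X' o] is dual to [X o], and the image of [X' i] in it is the annihilator of
   the image of [X (n - i)], both being regarded as filtrations. *)
Record apair (A B : nzRingType) (al : central_alg R A) (be : central_alg R B)
    (t : anti_iso al be) (X : mor_obj A n) (X' : mor_obj B n) := Apair {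
  ap_pr : pairing E t (X o) (X' o);
  ap_ann : forall (i : 'I_n) x', (exists y, pmap X' i o y = x') <->
    forall j : 'I_n, (n <= i + j)%N -> forall x, ap_pr (pmap X j o x) x' = 0;
  ap_ann' : forall (j : 'I_n) x, (exists y, pmap X j o y = x) <->
    forall i : 'I_n, (n <= j + i)%N -> forall x', ap_pr x (pmap X' i o x') = 0
}.

Definition apair_swap (A B : nzRingType) (al : central_alg R A) (be : central_alg R B)
    (t : anti_iso al be) (X : mor_obj A n) (X' : mor_obj B n)
    (p : apair t X X') : apair (anti_swap t) X' X :=
  @Apair _ _ be al (anti_swap t) X' X (pairing_swap (ap_pr p)) (ap_ann' p) (ap_ann p).

Definition apair_unswap (A B : nzRingType) (al : central_alg R A) (be : central_alg R B)
    (t : anti_iso al be) (X : mor_obj A n) (X' : mor_obj B n)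
    (p : apair (anti_swap t) X' X) : apair t X X' :=
  @Apair _ _ al be t X X' (pairing_unswap (ap_pr p)) (ap_ann' p) (ap_ann p).

Section Base.
Variables (A : nzRingType).

(** A monomorphism representation is a filtration of its bottom level, so a morphism into it amounts
    to a linear map there that respects the images. *)
Lemma hom_of_base (X Y : mor_obj A n) (g : {linear Y o -> X o}) : mono_cat X ->
  (forall i y, exists x, pmap X i o x = g (pmap Y i o y)) ->
  exists f : mor_hom Y X, forall y, f o y = g y.
Proof.
move=> mX ex; have pi i := mono_pmap mX (o_le i).
pose f i y := sval (cid (ex i y)).
have hf i y : pmap X i o (f i y) = g (pmap Y i o y) by rewrite /f; case: cid.
have fl i : linear (f i).
  by move=> a x y; apply: pi; rewrite lin_comb !hf !lin_comb.
have fc (i j : 'I_n) (e : j = i.+1 :> nat) x : f i (mor_map Y e x) = mor_map X e (f j x).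
  by apply: (pi i); rewrite hf -!(pmap_step e) ?o_le // hf.
exists (mkhom fl fc) => y /=.
by have := hf o y; rewrite !pmap_id.
Qed.

Lemma hom_eq_base (X Y : mor_obj A n) (f g : mor_hom Y X) : mono_cat X ->
  hom_eq f g <-> forall y, f o y = g o y.
Proof.
move=> mX; split=> [fg y|fg i y]; first exact: fg.
by apply: (mono_pmap mX (o_le i)); rewrite -!pmap_hom fg.
Qed.

(** The ambient object in which the annihilators, as submodules of one dual module, form a
    subobject. *)
Definition const_obj (M : lmodType A) (fM : fin_gen M) : mor_obj A n :=
  @MorObj A n (fun=> M) (fun i j e => idfun) (fun=> fM).

Lemma const_pmap (M : lmodType A) (fM : fin_gen M) (i j : 'I_n) x : (i <= j)%N ->
  pmap (const_obj fM) j i x = x.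
Proof.
move=> ij; move: j ij x; apply: ord_le_ind => [x|j k e ik IH x]; first by rewrite pmap_id.
by rewrite (pmap_step e) // IH.
Qed.
End Base.

Section PairingIso.
Variables (A B : nzRingType) (al : central_alg R A) (be : central_alg R B).
Variables (t : anti_iso al be).

Lemma pairing_iso (M : lmodType A) (M' N' : lmodType B) (p : pairing E t M M')
    (f : {linear N' -> M'}) : injective f -> (forall y, exists x, f x = y) ->
  {q : pairing E t M N' | forall x y, q x y = p x (f y)}.
Proof.
move=> fi fs; unshelve eexists.
  apply: (@Pairing _ _ _ _ al be t M N' (fun x y => p x (f y))).
  - by move=> y; apply: (pr_linl p).
  - by move=> x a y y'; rewrite -(pr_linr p) !resE lin_comb.
  - by move=> b x y; rewrite pr_bal linearZ_LR.
  - move=> h; have [y' hy] := pr_repr p h; have [y fy] := fs y'.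
    by exists y => x; rewrite fy.
  - move=> h; have [g hg] : exists g : {linear M' -> N'}, forall y, g (f y) = y.
      have [g hg] := choice fs.
      have gl : linear g by move=> a x y; apply: fi; rewrite lin_comb !hg.
      by exists (mklin gl) => y; apply: fi; rewrite /= hg.
    have [x hx] := pr_repl p (h \o res_lin be g).
    by exists x => y; rewrite hx /= hg.
  - by move=> y hy; apply: (inj_ker0 fi); apply: (pr_injr (p := p)).
  - move=> x hx; apply: (pr_injl (p := p)) => y'; have [y <-] := fs y'; exact: hx.
by [].
Qed.

Lemma apair_exists (X : mor_obj A n) : exists X' : mor_obj B n,
  mono_cat X' /\ inhabited (apair t X X').
Proof.
have fX := @mor_fin_gen A n X o.
have fD := dual_fin_gen t flR ssE fX.
have [p hp] := dual_pairing t flR ssE Emax fX.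
pose C := const_obj fD.
pose U (i : 'I_n) : set (C i) := [set f | forall j : 'I_n, (n <= i + j)%N ->
  forall x, p (pmap X j o x) f = 0].
have sU i : submod (U i).
  split=> [j _ x|b f g hf hg j ij x]; first exact: pr0r.
  by rewrite prDr -pr_bal -linearZ_LR hf // hg // addr0.
have stU (i j : 'I_n) (e : j = i.+1 :> nat) f : U j f -> U i (mor_map C e f).
  by move=> h k ik x; apply: h; rewrite e addSn leqW.
have [S [io [ioi hS]]] := @subobj_exists _ _ be _ flR C U sU stU.
have mS : mono_cat S.
  move=> i j e x y exy; apply: (ioi j).
  by have := congr1 (io i) exy; rewrite !hom_comm.
exists S; split=> //; constructor.
have ios y : exists x, io o x = y.
  (* At level [o] no index [j] satisfies [n <= j], so nothing has to be annihilated and the whole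
     dual is obtained. *)
  by apply/hS => j; rewrite o0 add0n leqNgt ltn_ord.
have [q hq] := pairing_iso p (@ioi o) ios.
have iop i y : io o (pmap S i o y) = io i y by rewrite pmap_hom const_pmap // o_le.
apply: (@Apair _ _ al be t X S q).
- move=> i x'; split=> [[y <-] j ij x|h].
    rewrite hq iop; suff h : U i (io i y) by exact: h.
    by apply/hS; exists y.
  have [|y yx] := (hS i (io o x')).1; first by move=> j ij x; rewrite -hq h.
  by exists y; apply: (ioi o); rewrite iop.
move=> j x; split=> [[y <-] i ji x'|h].
  rewrite hq iop; suff hU : U i (io i x') by apply: hU; rewrite addnC.
  by apply/hS; exists x'.
apply: contrapT => nx.
(* The double annihilator is no larger: a functional vanishing on the image of [X j] but not at [x]
   belongs to level [n - j] of the dual filtration. *)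
have sV : submod (range (pmap X j o) : set (res al (X o))).
  exact/res_submod/submod_img/submodT.
have nV : ~ (range (pmap X j o) : set (res al (X o))) x.
  by move=> [y _ yx]; apply: nx; exists y.
have [f [fV fx]] := separate flR ssE Emax sV nV; apply: fx.
have [y' hy] := pr_repr q f; rewrite -hy.
(* [n - j] is an index only for [j > 0]; for [j = 0] the image is all of [X o]. *)
have [j0|j0] := posnP j.
  have oj : j = o by apply: val_inj; rewrite /= o0.
  by case: nx; subst j; exists x; rewrite pmap_id.
have lt : (n - j < n)%N by rewrite ltn_subrL j0 (leq_ltn_trans (leq0n j)).
pose i := Ordinal lt.
have [|z zy] := (hS i (io o y')).1.
  move=> k; rewrite /= => nk w; rewrite -hq hy fV //.
  have jk : (j <= k)%N by rewrite -(leq_add2l (n - j)) subnK // ltnW.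
  by exists (pmap X k j w) => //; rewrite pmap_comp // o_le.
have -> : y' = pmap S i o z by apply: (ioi o); rewrite iop.
by apply: h; rewrite /= subnKC // ltnW.
Qed.

Definition ahadj (X Y : mor_obj A n) (X' Y' : mor_obj B n) (p : apair t X X')
    (q : apair t Y Y') (f : mor_hom X Y) (f' : mor_hom Y' X') :=
  forall x y, ap_pr q (f o x) y = ap_pr p x (f' o y).

Lemma ahadj_exists (X Y : mor_obj A n) (X' Y' : mor_obj B n) (p : apair t X X')
    (q : apair t Y Y') (f : mor_hom X Y) : mono_cat X' -> exists f', ahadj p q f f'.
Proof.
move=> mX'; have [g hg] := adjoint_exists (ap_pr p) (ap_pr q) (f o).
have [|f' hf'] := hom_of_base (g := g) mX'.
  move=> i y; apply/(ap_ann p) => j ij x.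
  by rewrite -hg pmap_hom; apply: (ap_ann q i _).1 => //; exists y.
by exists f' => x y; rewrite hf' hg.
Qed.

Lemma ahadj_comp (X Y Z : mor_obj A n) (X' Y' Z' : mor_obj B n) (p : apair t X X')
    (q : apair t Y Y') (r : apair t Z Z') f f' g g' :
  ahadj p q f f' -> ahadj q r g g' -> ahadj p r (hom_comp g f) (hom_comp f' g').
Proof. by move=> hf hg x y; rewrite /= hg hf. Qed.

Lemma ahadj_eq (X Y : mor_obj A n) (X' Y' : mor_obj B n) (p : apair t X X')
    (q : apair t Y Y') f f' g g' : mono_cat Y -> mono_cat X' ->
  ahadj p q f f' -> ahadj p q g g' -> hom_eq f g <-> hom_eq f' g'.
Proof.
move=> mY mX' hf hg; rewrite (hom_eq_base _ _ mY) (hom_eq_base _ _ mX').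
split=> fg y.
  by apply: (pr_extr (p := ap_pr p)) => x; rewrite -hf -hg fg.
by apply: (pr_extl (p := ap_pr q)) => x; rewrite hf hg fg.
Qed.

(** At the bottom level this is exactness of [Hom(-, E)]. The new point is that [f'] is onto at
    every level, for which an annihilating functional must be extended to an annihilating one. *)
Lemma ahadj_ses (X Y Z : mor_obj A n) (X' Y' Z' : mor_obj B n)
    (p : apair t X X') (q : apair t Y Y') (r : apair t Z Z') f f' g g' :
  mono_cat Z -> mono_cat X' -> mono_cat Y' -> mono_cat Z' ->
  ahadj p q f f' -> ahadj q r g g' -> short_exact f g -> short_exact g' f'.
Proof.
move=> mZ mX' mY' mZ' hf hg fg.
have [foi gos exo] := fg o.
have [g'i f's ex'] := pairing_exact hf hg foi gos exo.
move=> i; split.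
- apply: ker0_inj => z gz; apply: (inj_ker0 (mono_pmap mZ' (o_le i))).
  by apply: (inj_ker0 g'i); rewrite pmap_hom gz linear0.
- move=> x'; have [i0|i0] := posnP i.
    have oi : i = o by apply: val_inj; rewrite /= o0.
    by subst i; apply: f's.
  have lt : (n - i < n)%N by rewrite ltn_subrL i0 (leq_ltn_trans (leq0n i)).
  pose j := Ordinal lt.
  have nij : (n <= i + j)%N by rewrite /= subnKC // ltnW.
  pose x0 := pmap X' i o x'.
  have x0_ann (k : 'I_n) x : (n <= i + k)%N -> ap_pr p (pmap X k o x) x0 = 0.
    by move=> ik; apply: (ap_ann p i _).1 => //; exists x'.
  (* A functional on [Y o] is sought that extends [x0] along [f] and kills the image of [Y j]. If
     [f x] plus the image of [y] is zero, then [g y = 0], as [Z j] embeds in [Z o]; so [y] comes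
     from [X j], and [x] lies in the image of [X j], which [x0] kills. *)
  pose F (w : (res al (X o) * res al (Y j))%type) : res al (Y o) := f o w.1 + pmap Y j o w.2.
  pose G (w : (res al (X o) * res al (Y j))%type) : E := ap_pr p w.1 x0.
  have lF : linear F.
    by move=> a u v; rewrite /F !resE !lin_comb scalerDr addrACA.
  have lG : linear G by move=> a u v; apply: (pr_linl (ap_pr p)).
  have [|h hh] := extend_factor ssE Emax (f := mklin lF) (g := mklin lG).
    move=> [x y]; rewrite /= /F /G /= => xy.
    have [_ _ exj] := fg j.
    have /exj[w wy] : g j y = 0.
      apply: (inj_ker0 (mono_pmap mZ (o_le j))); rewrite -pmap_hom.
      have gf : g o (f o x) = 0 by apply/exo; exists x.
      by rewrite -[LHS]add0r -gf -(linearD (g o)) xy linear0.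
    have -> : x = - pmap X j o w.
      apply: foi; rewrite linearN pmap_hom wy; apply/eqP; rewrite -addr_eq0.
      exact/eqP.
    by rewrite -(linearN (pmap X j o)) x0_ann.
  have [y0 hy0] := pr_repr (ap_pr q) h.
  have y0E x y : ap_pr q (f o x + pmap Y j o y) y0 = ap_pr p x x0.
    by rewrite hy0; apply: (hh (x, y)).
  have [|y' yy] := (ap_ann q i y0).2.
    move=> k ik y; have jk : (j <= k)%N by rewrite /= leq_subLR.
    rewrite -(pmap_comp (i := j)) ?o_le ?jk //.
    by have := y0E 0 (pmap Y k j y); rewrite linear0 add0r pr0l.
  exists y'; apply: (mono_pmap mX' (o_le i)); rewrite -pmap_hom yy.
  apply: (pr_extr (p := ap_pr p)) => x; rewrite -hf.
  by have := y0E x 0; rewrite linear0 addr0.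
move=> y'; split=> [fy|[z <-]]; last first.
  apply: (mono_pmap mX' (o_le i)); rewrite linear0 -!pmap_hom.
  by apply/ex'; exists (pmap Z' i o z).
have /ex'[z0 z0y] : f' o (pmap Y' i o y') = 0 by rewrite pmap_hom fy linear0.
have [|z zz] := (ap_ann r i z0).2.
  move=> j ij z; have [_ gs _] := fg j; have [y <-] := gs z.
  rewrite -pmap_hom hg z0y; apply: (ap_ann q i _).1 => //; by exists y'.
exists z; apply: (mono_pmap mY' (o_le i)).
by rewrite -pmap_hom zz.
Qed.
End PairingIso.

Section AnnihilatorEquiv.
Variables (A B : nzRingType) (al : central_alg R A) (be : central_alg R B).
Variables (t : anti_iso al be).

Lemma annihilator_equiv : inhabited
  (equiv (opcat (subcat (@mono_cat A n))) (subcat (@mono_cat B n))).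
Proof.
constructor.
apply: (@Equiv (opcat (subcat (@mono_cat A n))) (subcat (@mono_cat B n))
  (fun X X' => apair t (sval X) (sval X'))
  (fun X X' Y Y' p q f f' => ahadj q p f f')).
- move=> [X mX]; have [X' [mX' [p]]] := apair_exists t X.
  by exists (exist _ X' mX').
- move=> [X' mX']; have [X [mX [p]]] := apair_exists (anti_swap t) X'.
  by exists (exist _ X mX); constructor; apply: apair_unswap.
- move=> X Y' Y X' q p f; exact: (ahadj_exists p q f (svalP X')).
- move=> Y Y' X X' q p f'.
  have [f hf] := ahadj_exists (apair_swap q) (apair_swap p) f' (svalP Y).
  by exists f => x y; rewrite [RHS](hf y x).
- move=> Y Y' X X' q p f f' g g'; exact: (ahadj_eq (svalP Y) (svalP X')).
- by move=> Z Z' Y Y' X X' r q p g g' f f' hg hf; apply: ahadj_comp hf hg.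
- by [].
- move=> [Z mZ] [Z' mZ'] [Y mY] [Y' mY'] [X mX] [X' mX'] r q p g g' f f' hg hf /=.
  split; first exact: (ahadj_ses mZ mX' mY' mZ' hf hg).
  apply: (ahadj_ses (p := apair_swap r) (q := apair_swap q) (r := apair_swap p)) => //.
    by move=> x y; rewrite [RHS](hg y x).
  by move=> x y; rewrite [RHS](hf y x).
move=> X X' p; have mX := svalP X; have mX' := svalP X'.
apply: (indecomposable_transport al flR (r := ahadj p p)).
- move=> f'; have [f hf] := ahadj_exists (apair_swap p) (apair_swap p) f' mX.
  by exists f => x y; rewrite [RHS](hf y x).
- by move=> d d' e e' hd he; apply: ahadj_comp he hd.
- by move=> d d' e e'; apply: ahadj_eq.
- by move=> x y; rewrite /= pr0l pr0r.
- by [].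
Qed.
End AnnihilatorEquiv.
End Annihilators.
End Dualities.

(** * Assembling the four statements *)

Section Conclusion.
Variables (R : comNzRingType) (E : lmodType R) (n : nat).
Hypothesis flR : fin_len R^o.
Hypothesis ssE : simple_socle E.
Hypothesis Emax : socle_maximal E.
Hypothesis n0 : (0 < n)%N.

Let o : 'I_n := Ordinal n0.
Let l : 'I_n := Ordinal (eq_ind_r (fun m => (n.-1 < m)%N) (ltnSn n.-1) (esym (prednK n0))).

Let o_min (i : 'I_n) : (o <= i)%N.
Proof. by []. Qed.

Let l_max (i : 'I_n) : (i <= l)%N.
Proof. by rewrite /= -ltnS prednK. Qed.

Lemma ends_mono (A B : nzRingType) (al : central_alg R A) (be : central_alg R B)
  (t : anti_iso al be) : ends (subcat (@mono_cat A n)).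
Proof.
have cf := mono_contravariantly_finite t flR ssE Emax (epi_covariantly_finite be flR l_max).
apply: ends_of_AR => Z CZ iZ; first exact: (mono_sink t flR ssE Emax cf CZ iZ).
move=> nproj; have [Y [g sg]] := mono_sink t flR ssE Emax cf CZ iZ.
exact: (AR_sequence_end al flR CZ iZ nproj sg).
Qed.

Lemma mono_epi_AR (A B : nzRingType) (al : central_alg R A) (be : central_alg R B)
  (t : anti_iso al be) :
  (functorially_finite (@mono_cat A n) /\ has_AR_sequences (@mono_cat A n)) /\
  (functorially_finite (@epi_cat A n) /\ has_AR_sequences (@epi_cat A n)).
Proof.
have eA := ends_mono t; have eB := ends_mono (anti_swap t).
have o0 : o = 0%N :> nat by [].
have [annA] := annihilator_equiv flR ssE Emax o0 t.
have [annB] := annihilator_equiv flR ssE Emax o0 (anti_swap t).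
have [dualA] := dual_equiv n flR ssE Emax t.
split; split.
- split; last exact: (mono_covariantly_finite o_min).
  apply: (mono_contravariantly_finite t flR ssE Emax).
  exact: (epi_covariantly_finite be flR l_max).
(* Left ends over [A] are right ends over [B], through the annihilator duality. *)
- exact: AR_of_ends eA (ends_transport annA eB).
- split; first exact: (epi_contravariantly_finite al flR l_max).
  exact: (epi_covariantly_finite al flR l_max).
(* [dualA] turns right ends for epimorphisms over [A] into left ends for monomorphisms over [B], and
   [annB] turns these into right ends over [A]. *)
apply: AR_of_ends; first exact: ends_transport dualA (ends_transport annB eA).
exact: ends_transport (equiv_op dualA) eB.
Qed.
End Conclusion.

(** * The artin algebra and its converse ring as central algebras *)

Section Algebra.
Variables (R : comNzRingType) (A : algType R).
Hypothesis fgA : fin_gen A.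

Fact in_alg_central (r : R) (a : A) : r%:A * a = a * r%:A.
Proof. by rewrite mulr_algl mulr_algr. Qed.

Fact in_alg_fg : exists (k : nat) (e : 'I_k -> A),
  forall a, exists c : 'I_k -> R, a = \sum_i (c i)%:A * e i.
Proof.
have [k [e he]] := fgA; exists k, e => a; have [c ->] := he a; exists c.
by apply: eq_bigr => i _; rewrite mulr_algl.
Qed.

Definition alg_central : central_alg R A :=
  @CentralAlg R A (in_alg A : {rmorphism R -> A}) in_alg_central in_alg_fg.

Definition in_conv (r : R) : A^c := (r%:A : A).

Fact in_conv_additive : zmod_morphism in_conv.
Proof. by move=> r s; rewrite /in_conv scalerBl. Qed.

Fact in_conv_multiplicative : monoid_morphism in_conv.
Proof.
split=> [|r s]; first by rewrite /in_conv scale1r.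
transitivity ((s%:A : A) * r%:A); last by [].
by rewrite /in_conv -scalerAl mul1r scalerA mulrC.
Qed.

Definition in_conv_morph : {rmorphism R -> A^c} :=
  HB.pack in_conv (GRing.isZmodMorphism.Build R A^c in_conv in_conv_additive)
    (GRing.isMonoidMorphism.Build R A^c in_conv in_conv_multiplicative).

Fact in_conv_central (r : R) (a : A^c) : in_conv_morph r * a = a * in_conv_morph r.
Proof. exact: (esym (in_alg_central r a)). Qed.

Fact in_conv_fg : exists (k : nat) (e : 'I_k -> A^c),
  forall a, exists c : 'I_k -> R, a = \sum_i in_conv_morph (c i) * e i.
Proof.
have [k [e he]] := in_alg_fg; exists k, e => a; have [c ac] := he a; exists c.
rewrite {1}ac; apply: eq_bigr => i _; exact: (in_alg_central (c i) (e i)).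
Qed.

Definition alg_conv_central : central_alg R A^c :=
  @CentralAlg R A^c in_conv_morph in_conv_central in_conv_fg.

Definition alg_anti_iso : anti_iso alg_central alg_conv_central :=
  @AntiIso R A A^c alg_central alg_conv_central id id
    (fun _ => erefl) (fun _ => erefl) (fun _ _ => erefl) erefl (fun _ _ => erefl)
    (fun _ => erefl).
End Algebra.

Theorem corollary1p4 (R : comNzRingType) (A : algType R) (n : nat) :
  artin_algebra A -> (2 <= n)%N ->
  (functorially_finite (@mono_cat A n) /\ has_AR_sequences (@mono_cat A n)) /\
  (functorially_finite (@epi_cat A n) /\ has_AR_sequences (@epi_cat A n)).
Proof.
move=> [artR fgA] n2; have flR := artinian_fin_len artR.
have [E [ssE Emax]] := maximal_simple_socle flR.
exact: (mono_epi_AR flR ssE Emax (ltnW n2) (alg_anti_iso fgA)).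
Qed.
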